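(* Let $N_0\ge1$, $m=N_0$, $\alpha=2N_0+1$, and let $$v=Y_{10}+\sum_{i+j+|\mathbf{n}|\ge2,\ i+j\ge1}a^{(0)}_{ij\mathbf{n}}X_{ij}\mu^{\mathbf{n}}+\sum_{i+j+|\mathbf{n}|\ge2,\ i+j\ge1}b^{(0)}_{ij\mathbf{n}}Y_{ij}\mu^{\mathbf{n}}\in\mathscr{L}$$ be parametric generic and of parametric dimension $N_0$. Then there exist $Y^T\in F^1\mathscr{R}$, $Y^P\in F^1\mathscr{P}^{m}$, $Y^S\in F^1\mathscr{L}$ and an invertible linear reparametrization $\phi^P_{Y_0^P}$ such that $\phi^P_{Y^P_0}\circ\phi^P_{Y^P*}\circ\phi^T_{Y^T*}\circ\phi^S_{Y^S*}$ uniquely transforms $v$ into the infinite-level parametric normal form $$v^{(\infty)}=Y_{10}+a^{(\infty)}_{(N_0+1)N_0\mathbf{0}}X_{(N_0+1)N_0}+\sum_{\mathbf{n}\in\mathbb{N}_0^{N_0}}a^{(\infty)}_{(2N_0+1)2N_0\mathbf{n}}X_{(2N_0+1)2N_0}\mu^{\mathbf{n}}+\sum_{k=1}^{N_0}X_{k(k-1)}\mu_{\sigma(k)}$$ for some permutation $\sigma\in S_{N_0}$ and some coefficients $a^{(\infty)}_{(N_0+1)N_0\mathbf{0}}, a^{(\infty)}_{(2N_0+1)2N_0\mathbf{n}}\in\mathbb{F}$; i.e. these coefficients are uniquely determined by $v$.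
   Context: The field is $\mathbb{F}=\mathbb{R}$; $m\ge1$ (number of parameters $\mu=(\mu_1,\dots,\mu_m)$) and $\alpha\ge 1$ (weight) are integers. For $\mathbf{n}\in\mathbb{N}_0^m$, $\mu^{\mathbf{n}}=\prod\mu_i^{n_i}$ and $|\mathbf{n}|=\sum n_i$. On $\mathbb{C}^2$ with coordinates $(z,w)$ put $X_{jk}=(z^jw^k,\,w^jz^k)^T$, $Y_{jk}=(iz^jw^k,\,-iw^jz^k)^T$. State space. $\mathscr{L}$ is the space of formal series $aY_{10}+\sum \alpha_{jk\mathbf{n}}X_{jk}\mu^{\mathbf{n}}+\sum\beta_{jk\mathbf{n}}Y_{jk}\mu^{\mathbf{n}}$, with coefficients in $\mathbb{F}$, sums over $j+k\ge1$, $j+k+|\mathbf{n}|\ge2$. It is a Lie algebra under $[u,v]=u'v-v'u$ ($'$ = Jacobian in $(z,w)$), graded by $\delta(X_{jk}\mu^{\mathbf{n}})=\delta(Y_{jk}\mu^{\mathbf{n}})=j+k-1+\alpha|\mathbf{n}|$; $\mathscr{L}_k$ is the grade-$k$ part. Time space. $\mathscr{R}=\mathbb{F}[[Z_1,\mu]]$, $Z_k=z^kw^k$, graded by $\delta(Z_k\mu^{\mathbf{n}})=2k+\alpha|\mathbf{n}|$; it acts on $\mathscr{L}$ by $Z_i\mu^{\mathbf{a}}X_{jk}\mu^{\mathbf{b}}=X_{(i+j)(i+k)}\mu^{\mathbf{a}+\mathbf{b}}$, and likewise for $Y_{jk}$. Parameter space. $\mathscr{P}^m=\mathbb{F}[[\mu]]^m$,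 graded by $\delta(\mu^{\mathbf{n}}\mathbf{e}_k)=\alpha|\mathbf{n}|-\alpha$. For each graded space $V$, $F^kV$ is the set of formal sums of terms of grade $\ge k$. Infinite direct sums mean formal (infinite) sums. Transformations. For $Y^S\in F^1\mathscr{L}$: $\phi^S_{Y^S*}=\exp(\mathrm{ad}_{Y^S})$. For $Y^T\in F^1\mathscr{R}$: $\phi^T_{Y^T*}(v)=v+Y^Tv$. For $Y^P\in F^1\mathscr{P}^m$: $\phi^P_{Y^P*}(v)$ is obtained by substituting $\mu=\nu+Y^P(\nu)$ in $v$ (and renaming $\nu$ as $\mu$). An invertible linear reparametrization substitutes $\mu=M\nu$ with $M\in GL_m(\mathbb{F})$. Let $A^0=F^1\mathscr{P}^m\times F^1\mathscr{R}\times F^1\mathscr{L}$ with the product filtration $F^nA^0$. Extended partial normal forms. For $v\in\mathscr{L}$, $Y=(Y^P,Y^T,Y^S)\in A^0$ let $d(v,Y)=D_\mu(v)Y^P+Y^Tv+[Y^S,v]$. Put $\tilde v^{(0)}=v$. For $r\ge1$, let $\mathscr{T}_n^{(r)}\subseteq\mathscr{L}_n$ be the projection to $\mathscr{L}_n$ of $F^n\mathscr{L}\cap d(\tilde v^{(r-1)},F^{\max(n-r+1,1)}A^0)$, let $\mathscr{N}_n^{(r)}$ be its unique complement in $\mathscr{L}_n$, and let the $r$th level extended partial parametric normal form $\tilde v^{(r)}$ be the image of $v$ under a composition $\phi^P_{Y^P*}\circ\phi^T_{Y^T*}\circ\phi^S_{Y^S*}$ with $\tilde v^{(r)}\in\bigoplus_n\mathscr{N}_n^{(r)}$.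 (For $v=Y_{10}+\cdots$ as in the claim, $\mathscr{N}_n^{(1)}=\mathrm{span}\{X_{(k+1)k}\mu^{\mathbf{n}}: n=2k+\alpha|\mathbf{n}|\}$ for $n\ge1$.) Here the unique complement is defined by the formal basis style: the monomials of $\mathscr{L}$ are put in a fixed sequence $e_1,e_2,\dots$ in which lower grades come first and, within a grade, $Y$ terms precede $X$ terms and parameter-free terms precede terms with parameters; the unique complement of $W\subseteq\mathscr{L}_n$ is the span of $e_{n_1},e_{n_2},\dots$, where inductively $n_k$ is the least index (among basis elements of $\mathscr{L}_n$) with $e_{n_k}\notin W\oplus\mathrm{span}\{e_{n_i}:i<k\}$. Parametric dimension. $v$ has parametric dimension $N_0$ if for every natural number $r$ the coefficient of the (parameter-free) term $X_{(i+1)i}$ in $\tilde v^{(r)}$ is zero for all $i<N_0$ and the coefficient of $X_{(N_0+1)N_0}$ is nonzero. Parametric generic. Let $A^{(1)}$ be the $N_0\times m$ matrix whose rows are indexed by $k=0,\dots,N_0-1$, with $(k,j)$ entry the coefficient of $X_{(k+1)k}\mu_j$ in $\tilde v^{(1)}$ (the matrix of $D_\mu\tilde v^{(1)}$ at $\mu=\mathbf 0$ on $\mathrm{span}\{X_{(k+1)k}\}_{k=0}^{N_0-1}$). $v$ is parametric generic if $\mathrm{rank}\,A^{(1)}=N_0$. *)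

(* Defs.v *)
From HB Require Import structures.
From mathcomp Require Import all_boot all_order all_algebra all_fingroup.
From mathcomp Require Import functions reals complex.

Set Implicit Arguments.
Unset Strict Implicit.
Unset Printing Implicit Defensive.

Import GRing.Theory.

Local Open Scope ring_scope.
Local Open Scope complex_scope.

Notation mindex I := {ffun I -> nat}.
Notation fps I K := (mindex I -> K).

Definition mdeg (I : finType) (n : mindex I) : nat := (\sum_i n i)%N.

Definition munit (I : finType) (i : I) : mindex I := [ffun j => nat_of_bool (j == i)].

Definition mindices (I : finType) (d : nat) : seq (mindex I) :=
  [seq q <- [seq [ffun i => nat_of_ord (a i)] | a : {ffun I -> 'I_d.+1}]
     | (mdeg q <= d)%N].

Section FormalSeries.
Variables (I : finType) (K : comNzRingType).

Definition fps1 : fps I K := fun n => (n == 0)%:R.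

Definition fpsvar (i : I) : fps I K := fun n => (n == munit i)%:R.

Definition fpsM (f g : fps I K) : fps I K := fun n =>
  \sum_(a <- mindices I (mdeg n)) \sum_(b <- mindices I (mdeg n) | a + b == n)
    f a * g b.

Definition fpsX (f : fps I K) (k : nat) : fps I K := iter k (fpsM f) fps1.

Definition fpsD (i : I) (f : fps I K) : fps I K := fun n =>
  (n i).+1%:R * f (n + munit i).

End FormalSeries.

(* Substitution of G i for the i-th variable.  It is only used for series G i
   without constant term, for which the monomials of degree > mdeg n do not
   contribute to the coefficient of index n. *)
Definition fpscomp (I J : finType) (K : comNzRingType)
    (f : fps I K) (G : I -> fps J K) : fps J K := fun n =>
  \sum_(a <- mindices I (mdeg n))
    f a * (\big[@fpsM J K/@fps1 J K]_(i : I) fpsX (G i) (a i)) n.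

(* The variables z, w are inl 0, inl 1 and the parameters mu_i are inr i. *)
Notation pvar m := ('I_2 + 'I_m)%type.

Definition pz (m : nat) : pvar m := inl ord0.
Definition pw (m : nat) : pvar m := inl ord_max.

Definition zdeg (m : nat) (q : mindex (pvar m)) : nat := q (pz m).
Definition wdeg (m : nat) (q : mindex (pvar m)) : nat := q (pw m).
Definition mupart (m : nat) (q : mindex (pvar m)) : mindex 'I_m :=
  [ffun i => q (inr i)].

(* The index of the monomial z^j w^k mu^n. *)
Definition mi (m : nat) (j k : nat) (n : mindex 'I_m) : mindex (pvar m) :=
  [ffun i => match i with
             | inl s => if s == ord0 then j else k
             | inr i => n i
             end].

Definition swapzw (m : nat) (q : mindex (pvar m)) : mindex (pvar m) :=
  mi (wdeg q) (zdeg q) (mupart q).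

Section ParametricFields.
Variables (R : realType) (m : nat).

(* Coordinates (z, w): component 0 is the z-component, component 1 the w-component. *)
Definition vfield := 'I_2 -> fps (pvar m) R[i].
HB.instance Definition _ := GRing.Lmodule.on vfield.

Definition Xq (q : mindex (pvar m)) : vfield := fun c p =>
  (p == if c == ord0 then q else swapzw q)%:R.

Definition Yq (q : mindex (pvar m)) : vfield := fun c p =>
  (if c == ord0 then 'i else - 'i) *
  (p == if c == ord0 then q else swapzw q)%:R.

Definition Xjk (j k : nat) (n : mindex 'I_m) : vfield := Xq (mi j k n).
Definition Yjk (j k : nat) (n : mindex 'I_m) : vfield := Yq (mi j k n).

(* The formal sum of the x q B_q over the q with P q.  It is only used for
   B = Xq and B = Yq, and B_q is then homogeneous of degree mdeg q in
   (z, w, mu), so only finitely many terms contribute to each coefficient. *)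
Definition formal_sum (P : pred (mindex (pvar m))) (x : mindex (pvar m) -> R)
    (B : mindex (pvar m) -> vfield) : vfield := fun c p =>
  \sum_(q <- mindices (pvar m) (mdeg p) | P q) (x q)%:C * B q c p.

Definition Ldom (q : mindex (pvar m)) : bool :=
  (1 <= zdeg q + wdeg q)%N && (2 <= zdeg q + wdeg q + mdeg (mupart q))%N.

Definition inL (v : vfield) : Prop :=
  exists (a : R) (x y : mindex (pvar m) -> R),
    v = a%:C *: Yjk 1 0 0 + formal_sum Ldom x Xq + formal_sum Ldom y Yq.

Definition coefX (v : vfield) (j k : nat) (n : mindex 'I_m) : R :=
  complex.Re (v ord0 (mi j k n)).

Definition bracket (u v : vfield) : vfield := fun c =>
  \sum_(s < 2) (fpsM (fpsD (inl s) (u c)) (v s)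
                - fpsM (fpsD (inl s) (v c)) (u s)).

(* A series in the parameters, and the series sum T_k,n Z_k mu^n, as series
   in (z, w, mu). *)
Definition mulift (f : fps 'I_m R) : fps (pvar m) R[i] := fun q =>
  if (zdeg q == 0)%N && (wdeg q == 0)%N then (f (mupart q))%:C else 0.

Definition timespace := nat -> fps 'I_m R.
Definition tlift (T : timespace) : fps (pvar m) R[i] := fun q =>
  if zdeg q == wdeg q then (T (zdeg q) (mupart q))%:C else 0.

Definition tact (T : timespace) (v : vfield) : vfield := fun c =>
  fpsM (tlift T) (v c).

Definition paramspace := 'I_m -> fps 'I_m R.

Definition Dmu (v : vfield) (P : paramspace) : vfield := fun c =>
  \sum_(i < m) fpsM (fpsD (inr i) (v c)) (mulift (P i)).

Variable alpha : nat.

(* Truncated predecessor: every monomial of L has zdeg + wdeg >= 1. *)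
Definition gradeL (q : mindex (pvar m)) : nat :=
  (zdeg q + wdeg q + alpha * mdeg (mupart q)).-1.

Definition projL (n : nat) (v : vfield) : vfield := fun c q =>
  if gradeL q == n then v c q else 0.

Definition FL (n : nat) (v : vfield) : Prop :=
  inL v /\ forall c q, (gradeL q < n)%N -> v c q = 0.

Definition FR (n : nat) (T : timespace) : Prop :=
  forall k p, (2 * k + alpha * mdeg p < n)%N -> T k p = 0.

(* mu^p e_i has grade alpha |p| - alpha, which is negative for p = 0. *)
Definition FP (n : nat) (P : paramspace) : Prop :=
  forall i p, (alpha * mdeg p < n + alpha)%N -> P i p = 0.

Definition FA (n : nat) (P : paramspace) (T : timespace) (S : vfield) : Prop :=
  [/\ FP n P, FR n T & FL n S].

(* exp (ad S) v.  For S in F^1 L and v in L, (ad S)^l v only has terms of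
   degree > l in (z, w, mu), so the sum is the whole exponential series. *)
Definition phiS (S : vfield) (v : vfield) : vfield := fun c q =>
  \sum_(l < (mdeg q).+1) (l`!%:R)^-1 * iter l (bracket S) v c q.

Definition phiT (T : timespace) (v : vfield) : vfield := v + tact T v.

Definition substmu (g : paramspace) (v : vfield) : vfield := fun c =>
  fpscomp (v c) (fun i => match i with
                          | inl s => fpsvar _ (inl s)
                          | inr i => mulift (g i)
                          end).

Definition phiP (P : paramspace) : vfield -> vfield :=
  substmu (fun i => fpsvar R i + P i).

Definition phiM (M : 'M[R]_m) : vfield -> vfield :=
  substmu (fun i n => \sum_(j < m) M i j * fpsvar R j n).

Definition dmap (v : vfield) (P : paramspace) (T : timespace) (S : vfield)
    : vfield :=
  Dmu v P + tact T v + bracket S v.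

(* (true, q) stands for X_q and (false, q) for Y_q. *)
Definition lmono := (bool * mindex (pvar m))%type.

Definition inLmono (t : lmono) : bool :=
  (t == (false, mi 1 0 0)) || Ldom t.2.

Definition lbasis (t : lmono) : vfield := if t.1 then Xq t.2 else Yq t.2.

(* Within a grade the two rules are read lexicographically: first Y before X,
   then, among terms of the same kind, parameter-free before the others. *)
Definition basis_order (e : nat -> lmono) : Prop :=
  [/\ injective e,
      forall t, inLmono t <-> exists k, e k = t
    & forall k l, (k < l)%N ->
        [/\ (gradeL (e k).2 <= gradeL (e l).2)%N,
            gradeL (e k).2 = gradeL (e l).2 -> (e k).1 -> (e l).1
          & gradeL (e k).2 = gradeL (e l).2 -> (e k).1 = (e l).1 ->
            mupart (e k).2 != 0 -> mupart (e l).2 != 0]].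

Definition espan (e : nat -> lmono) (s : seq nat) (u : vfield) : Prop :=
  exists c : nat -> R, u = \sum_(k <- s) (c k)%:C *: lbasis (e k).

Definition fresh (e : nat -> lmono) (W : vfield -> Prop) (n : nat) (s : seq nat)
    (k : nat) : Prop :=
  gradeL (e k).2 = n /\
  ~ exists u w, [/\ W u, espan e s w & lbasis (e k) = u + w].

Inductive greedy (e : nat -> lmono) (W : vfield -> Prop) (n : nat)
    : seq nat -> Prop :=
| greedy_nil : greedy e W n [::]
| greedy_rcons s k : greedy e W n s -> fresh e W n s k ->
    (forall l, fresh e W n s l -> (k <= l)%N) -> greedy e W n (rcons s k).

Definition unique_complement (e : nat -> lmono) (W : vfield -> Prop) (n : nat)
    (u : vfield) : Prop :=
  exists2 s, greedy e W n s & espan e s u.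

(* T_n^(r) and N_n^(r), computed from the normal form w of level r - 1. *)
Definition tangentT (r n : nat) (w u : vfield) : Prop :=
  exists P T S, [/\ FA (maxn (n.+1 - r) 1) P T S,
                    FL n (dmap w P T S)
                  & u = projL n (dmap w P T S)].

Definition normalN (e : nat -> lmono) (r n : nat) (w : vfield)
    : vfield -> Prop :=
  unique_complement e (tangentT r n w) n.

(* vt r is only one possible choice of the level r normal form. *)
Definition extended_partial_nf (e : nat -> lmono) (v : vfield)
    (vt : nat -> vfield) : Prop :=
  vt 0 = v /\
  forall r, (1 <= r)%N ->
    (exists P T S, FA 1 P T S /\ vt r = phiP P (phiT T (phiS S v))) /\
    (forall n, normalN e r n (vt r.-1) (projL n (vt r))).

Definition parametric_dimension (vt : nat -> vfield) (N0 : nat) : Prop :=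
  forall r, (1 <= r)%N ->
    (forall i, (i < N0)%N -> coefX (vt r) i.+1 i 0 = 0) /\
    coefX (vt r) N0.+1 N0 0 != 0.

Definition parametric_generic (vt : nat -> vfield) (N0 : nat) : Prop :=
  \rank (\matrix_(k < N0, j < m) coefX (vt 1) k.+1 k (munit j)) = N0.

Definition transforms (v u : vfield) : Prop :=
  exists (M : 'M[R]_m) P T S,
    [/\ M \in unitmx, FA 1 P T S & u = phiM M (phiP P (phiT T (phiS S v)))].

End ParametricFields.

(* The permutation is on 'I_N0, so its index k stands for k + 1. *)
Definition vinfty (R : realType) (N0 : nat) (s : 'S_N0) (a : R)
    (b : mindex 'I_N0 -> R) : vfield R N0 :=
  Yjk R 1 0 0 + a%:C *: Xjk R N0.+1 N0 0
  + formal_sum (fun q => (zdeg q == (2 * N0).+1)%N && (wdeg q == 2 * N0)%N)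
      (fun q => b (mupart q)) (@Xq R N0)
  + \sum_(k < N0) Xjk R k.+1 k (munit (s k)).

(* Main.v *)
Require Import Defs.
From mathcomp Require Import all_boot all_order all_algebra all_fingroup.
From mathcomp Require Import functions reals complex.
From HB Require Import structures.
From mathcomp Require Import boolp zify ring.

(** Let rho = z w, and call a field radial when its z-component is z (i + r) with
    r a real series in rho and the parameters, the w-component being conjugate.
    At the first level the operator ad of the rotation is diagonal on monomials,
    so every term except the X_{(k+1)k} mu^n lies in the tangent space (the
    resonant Y terms through the time change): a first level normal form is
    radial ([tangent_nonres], [first_level_radial]).  The assumptions then say
    that r starts with a nonzero multiple of rho^N0 at mu = 0, and that the terms
    of degree one in mu of the coefficients of 1, rho, .., rho^(N0-1) form an
    invertible matrix.

    Existence.  The rescaling z -> z h(rho, mu) keeps the angular velocity and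
    turns r into the r2 with h r2(rho h^2) = r (h + 2 rho dh/drho).  Linearized
    at h = 1 and r = a rho^N0, this equation is diagonal on monomials; a term
    rho^i mu^n of r other than a rho^N0 can be removed unless i < N0 or i = 2 N0.  Hence r becomes
      a rho^N0 + sum_(k < N0) psi_k(mu) rho^k + beta(mu) rho^(2 N0)
    ([radial_form_exists]).  Give rho the weight 1 and each parameter the weight
    N0 + 1: then a rho^N0 dominates and the nonlinear terms are a contraction.
    The linear parts of the psi_k are independent because those of the
    coefficients of r are ([radial_form_linear_part]), so the psi_k can be taken
    as new parameters ([param_inverse]).  The resulting change of phase variables
    is the flow of some S in the state space ([flow_log]), and the normal form is
    reached with the identity permutation ([normal_form_exists]).

    Uniqueness.  Undoing the time and parameter parts of two transformations of v
    leaves two fields z (i + r_j) / (1 + t_j), with r_j of the above shape in the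
    original parameters, conjugate by a formal change of variables.  Such a
    conjugacy commutes with the rotation ([conj_rotd]): the lowest order part of
    the defect would be a rotation eigenvector for a wrong eigenvalue.  It thus
    maps rho to some y = rho H(rho, mu), and comparing real and imaginary parts
    gives F_2(y) (1 + kappa F_1) = F_1 dy/drho with F_j = rho r_j
    ([conj_radial_eq]).  Divide y - rho by F_1; the remainder and the differences
    of the psi_k and of beta then enter the equation at different powers of rho
    in every weight, and vanish ([radial_lead_unique], [radial_coefs_unique]).
    So the two normal forms differ by the substitution of the parameters that
    identifies the coefficients of each rho^k ([normal_form_unique]).

    Formal series are handled as a commutative ring with filtrations by weight;
    changes of variables are filtered ring morphisms, which are determined by
    the images of the variables, and vector fields are derivations. *)

Set Implicit Arguments.
Unset Strict Implicit.
Unset Printing Implicit Defensive.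

Import Order.TTheory GRing.Theory Num.Theory.

Local Open Scope ring_scope.

(** * Multi-indices *)

Section Indices.
Variable I : finType.
Implicit Types (a b n : mindex I) (w : I -> nat).

Definition wt w n : nat := (\sum_i w i * n i)%N.

Definition w1 : I -> nat := fun=> 1%N.

Definition leqm a n := [forall i, (a i <= n i)%N].
Definition subm n a : mindex I := [ffun i => (n i - a i)%N].

Lemma wtD w a b : wt w (a + b) = (wt w a + wt w b)%N.
Proof.
rewrite /wt -big_split; apply: eq_bigr => i _; rewrite ffunE /=.
by rewrite -mulnDr.
Qed.

Lemma wt0 w : wt w 0 = 0%N.
Proof. by rewrite /wt big1 // => i _; rewrite ffunE muln0. Qed.

Lemma wt_munit w i : wt w (munit i) = w i.
Proof.
rewrite /wt (bigD1 i) //= ffunE eqxx muln1 big1 ?addn0 // => j /negPf ji.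
by rewrite ffunE ji muln0.
Qed.

Lemma wt1_munit i : wt w1 (munit i) = 1%N.
Proof. exact: wt_munit. Qed.

Lemma mdegE n : mdeg n = wt w1 n.
Proof. by apply: eq_bigr => i _; rewrite mul1n. Qed.

Lemma leq_mdeg n i : (n i <= mdeg n)%N.
Proof. by rewrite /mdeg (bigD1 i) //= leq_addr. Qed.

Lemma mem_mindices d n : (n \in mindices I d) = (mdeg n <= d)%N.
Proof.
rewrite mem_filter; case: leqP => //= nd; apply/imageP.
exists [ffun i => inord (n i)] => //; apply/ffunP=> i.
by rewrite !ffunE inordK // ltnS (leq_trans (leq_mdeg _ _)).
Qed.

Lemma uniq_mindices d : uniq (mindices I d).
Proof.
apply: filter_uniq; rewrite map_inj_uniq ?enum_uniq // => f g /ffunP fg.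
by apply/ffunP=> i; apply/val_inj; move: (fg i); rewrite !ffunE.
Qed.

Lemma submK a n : leqm a n -> a + subm n a = n.
Proof.
by move/forallP=> an; apply/ffunP=> i; rewrite !ffunE; apply: subnKC.
Qed.

Lemma leqmDr a b : leqm a (a + b).
Proof. by apply/forallP=> i; rewrite ffunE; apply: leq_addr. Qed.

Lemma addmK a b : subm (a + b) a = b.
Proof. by apply/ffunP=> i; rewrite !ffunE addKn. Qed.

Lemma addmI a : injective (+%R a).
Proof. by move=> b c /(congr1 (subm^~ a)); rewrite !addmK. Qed.

Lemma leqm_mdeg a n : leqm a n -> (mdeg a <= mdeg n)%N.
Proof. by move=> /submK <-; rewrite !mdegE wtD leq_addr. Qed.

Lemma addm_eqE a b n : (a + b == n) = leqm a n && (b == subm n a).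
Proof.
apply/eqP/andP=> [<-|[an /eqP->]]; last exact: submK.
by rewrite leqmDr addmK.
Qed.

Lemma mdeg0 : mdeg (0 : mindex I) = 0%N. Proof. by rewrite mdegE wt0. Qed.

Lemma mdeg_eq0 n : (mdeg n == 0%N) = (n == 0).
Proof.
apply/eqP/eqP=> [n0|->]; last by rewrite mdegE wt0.
by apply/ffunP=> i; apply/eqP; rewrite ffunE -leqn0 -n0 leq_mdeg.
Qed.

Lemma addm_eq0 a b : (a + b == 0) = (a == 0) && (b == 0).
Proof. by rewrite -!mdeg_eq0 !mdegE wtD addn_eq0. Qed.

Lemma leqm_munit n i : leqm (munit i) n = (0 < n i)%N.
Proof.
apply/forallP/idP=> [/(_ i)|ni j]; first by rewrite ffunE eqxx.
by rewrite ffunE; case: eqP => // ->.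
Qed.

Lemma munit_neq0 i : munit i != 0 :> mindex I.
Proof. by rewrite -mdeg_eq0 mdegE wt_munit. Qed.

Lemma mindex_ind (P : mindex I -> Prop) :
  P 0 -> (forall i a, P a -> P (munit i + a)) -> forall a, P a.
Proof.
move=> P0 PS a; have [k] := ubnP (mdeg a); elim: k a => // k IH a ak.
have [->//|] := eqVneq a 0; rewrite -mdeg_eq0 => a0.
have /existsP[i ai] : [exists i, 0 < a i]%N.
  apply/existsPn => H; move: a0; rewrite /mdeg big1 // => i _.
  by apply/eqP; rewrite -leqn0 leqNgt H.
have ea : munit i + subm a (munit i) = a by apply: submK; rewrite leqm_munit.
rewrite -ea; apply/PS/IH; have := congr1 (@mdeg I) ea.
by rewrite !mdegE wtD wt_munit /w1 in ak *; lia.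
Qed.

End Indices.

Arguments w1 {I}.

(** * The ring of formal power series *)

Section Ring.
Variables (I : finType) (K : comNzRingType).

(** The Cauchy product turns this into a ring; a distinct constant keeps it apart
    from the pointwise product of functions. *)
Definition ps := mindex I -> K.
HB.instance Definition _ := GRing.Zmodule.on ps.

Implicit Types (f g h : ps) (a b n : mindex I).

Lemma ps_addE f g n : (f + g) n = f n + g n. Proof. by []. Qed.
Lemma ps_oppE f n : (- f) n = - f n. Proof. by []. Qed.
Lemma ps_zeroE n : (0 : ps) n = 0. Proof. by []. Qed.
Lemma ps_sumE (J : Type) (r : seq J) (P : pred J) (F : J -> ps) n :
  (\sum_(j <- r | P j) F j) n = \sum_(j <- r | P j) F j n.
Proof. by elim/big_rec2: _ => // j y1 y2 _ <-. Qed.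
Lemma ps_ext f g : (forall n, f n = g n) -> f = g.
Proof. exact: funext. Qed.

Lemma big_mindices (T : nmodType) d n (F : mindex I -> T) :
  (mdeg n <= d)%N -> \sum_(a <- mindices I d | a == n) F a = F n.
Proof.
move=> nd; rewrite big_mkcond (bigD1_seq n) ?uniq_mindices ?mem_mindices //=.
by rewrite eqxx big1 ?addr0 // => a /negPf->.
Qed.

(** The cut-off of the enumeration may be any bound of the degree, which lets
    products of different indices share one range of summation. *)
Lemma fpsME_gen d f g n : (mdeg n <= d)%N ->
  fpsM f g n = \sum_(a <- mindices I d | leqm a n) f a * g (subm n a).
Proof.
have in_d e : (mdeg n <= e)%N ->
  \sum_(a <- mindices I e) \sum_(b <- mindices I e | a + b == n) f a * g b =
  \sum_(a <- mindices I e | leqm a n) f a * g (subm n a).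
  move=> ne; rewrite [RHS]big_mkcond; apply: eq_bigr => a _.
  under eq_bigl do rewrite addm_eqE.
  case: ifP => /= an; last by rewrite big_pred0.
  rewrite big_mindices // (leq_trans _ ne) //.
  by rewrite -[in X in (_ <= X)%N](submK an) !mdegE wtD leq_addl.
move=> nd; rewrite /fpsM in_d // -[LHS]big_filter -[RHS]big_filter; apply: perm_big.
apply: uniq_perm; try exact: filter_uniq (uniq_mindices _ _).
move=> a; rewrite [LHS]mem_filter [RHS]mem_filter !mem_mindices; case an: (leqm a n) => //=.
by rewrite (leqm_mdeg an) (leq_trans (leqm_mdeg an)).
Qed.

Lemma fpsME f g n :
  fpsM f g n = \sum_(a <- mindices I (mdeg n) | leqm a n) f a * g (subm n a).
Proof. exact: fpsME_gen. Qed.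

Fact fpsMC : commutative (@fpsM I K).
Proof.
move=> f g; apply/ps_ext=> n; rewrite /fpsM.
under eq_bigr do rewrite big_mkcond.
rewrite exchange_big; apply: eq_bigr => a _; rewrite [RHS]big_mkcond.
by apply: eq_bigr => b _; rewrite addrC mulrC.
Qed.

Fact fpsMDl : left_distributive (@fpsM I K) (+%R : ps -> ps -> ps).
Proof.
move=> f g h; apply/ps_ext=> n; rewrite ps_addE !fpsME -big_split.
by apply: eq_bigr => a _; rewrite mulrDl.
Qed.

Fact fpsM1l : left_id (@fps1 I K) (@fpsM I K).
Proof.
move=> f; apply/ps_ext=> n; rewrite fpsME.
have n0 : leqm 0 n by apply/forallP=> i; rewrite ffunE.
rewrite big_mkcond (bigD1_seq 0) ?uniq_mindices ?mem_mindices ?mdegE ?wt0 //=.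
rewrite n0 /fps1 eqxx mul1r big1 ?addr0 => [|a /negPf->].
  by congr f; apply/ffunP=> i; rewrite !ffunE subn0.
by rewrite mul0r if_same.
Qed.

Fact fpsMA : associative (@fpsM I K).
Proof.
move=> f g h; apply/ps_ext=> n.
pose s := mindices I (mdeg n).
pose t (a b c : mindex I) : K := if a + b + c == n then f a * g b * h c else 0.
have step (u c : mindex I) : u + c == n -> fpsM f g u * h c =
    \sum_(a <- s) \sum_(b <- s) if a + b == u then t a b c else 0.
  move=> ucn; have us : (mdeg u <= mdeg n)%N.
    by rewrite -(eqP ucn) !mdegE wtD leq_addr.
  rewrite (fpsME_gen _ _ us) mulr_suml [LHS]big_mkcond; apply: eq_bigr => a _.
  rewrite -big_mkcond; under eq_bigl do rewrite addm_eqE.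
  case: ifP => /= au; last by rewrite big_pred0.
  rewrite big_mindices ?/t ?submK ?ucn // (leq_trans _ us) //.
  by rewrite -[in X in (_ <= X)%N](submK au) !mdegE wtD leq_addl.
have step' (a u : mindex I) : a + u == n -> f a * fpsM g h u =
    \sum_(b <- s) \sum_(c <- s) if b + c == u then t a b c else 0.
  move=> aun; have us : (mdeg u <= mdeg n)%N.
    by rewrite -(eqP aun) !mdegE wtD leq_addl.
  rewrite (fpsME_gen _ _ us) mulr_sumr [LHS]big_mkcond; apply: eq_bigr => b _.
  rewrite -big_mkcond; under eq_bigl do rewrite addm_eqE.
  case: ifP => /= bu; last by rewrite big_pred0.
  rewrite big_mindices ?/t -?addrA ?submK ?aun ?mulrA // (leq_trans _ us) //.
  by rewrite -[in X in (_ <= X)%N](submK bu) !mdegE wtD leq_addl.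
transitivity (\sum_(a <- s) \sum_(b <- s) \sum_(c <- s) t a b c).
  rewrite /fpsM -/s; apply: eq_bigr => a _.
  transitivity (\sum_(u <- s) \sum_(b <- s) \sum_(c <- s)
     if a + u == n then (if b + c == u then t a b c else 0) else 0).
    rewrite big_mkcond; apply: eq_bigr => u _; case: ifP => [aun|_].
      exact: step'.
    by rewrite big1 // => b _; rewrite big1.
  rewrite exchange_big; apply: eq_bigr => b _.
  rewrite exchange_big; apply: eq_bigr => c _.
  rewrite /t; case: ifP => abc; last first.
    rewrite big1 // => u _; case: eqP => // aun; case: eqP => // bcu.
  transitivity (\sum_(u <- s | u == b + c) f a * g b * h c).
    rewrite [RHS]big_mkcond; apply: eq_bigr => u _; rewrite eq_sym.
    by rewrite [u == _]eq_sym; case: (b + c =P u) => [<-|]; rewrite ?if_same // eq_sym addrA abc.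
  rewrite big_mindices // -(eqP abc) !mdegE !wtD; lia.
symmetry; rewrite /fpsM -/s.
transitivity (\sum_(u <- s) \sum_(c <- s) \sum_(a <- s) \sum_(b <- s)
     if u + c == n then (if a + b == u then t a b c else 0) else 0).
  apply: eq_bigr => u _.
  rewrite big_mkcond; apply: eq_bigr => c _; case: ifP => [aun|_].
    exact: step.
  by rewrite big1 // => b _; rewrite big1.
under eq_bigr do rewrite exchange_big.
rewrite exchange_big; apply: eq_bigr => a _.
under eq_bigr do rewrite exchange_big.
rewrite exchange_big; apply: eq_bigr => b _.
rewrite exchange_big; apply: eq_bigr => c _.
rewrite /t; case: ifP => abc; last first.
  rewrite big1 // => u _; case: eqP => // aun; case: eqP => // bcu.
transitivity (\sum_(u <- s | u == a + b) f a * g b * h c).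
  rewrite [RHS]big_mkcond; apply: eq_bigr => u _.
  by rewrite [u == _]eq_sym; case: (a + b =P u) => [<-|]; rewrite ?if_same // abc.
rewrite big_mindices // -(eqP abc) !mdegE !wtD; lia.
Qed.

Fact ps1_neq0 : @fps1 I K != 0 :> ps.
Proof.
apply/eqP=> /(congr1 (fun f : ps => f 0)); rewrite /fps1 eqxx.
by move/eqP; rewrite oner_eq0.
Qed.

HB.instance Definition _ := GRing.Zmodule_isComNzRing.Build ps
  fpsMA fpsMC fpsM1l fpsMDl ps1_neq0.

End Ring.

(** * Filtrations by weight *)

Section Filtration.
Variables (I : finType) (K : comNzRingType).
Local Notation ps := (ps I K).
Implicit Types (f g h : ps) (a b n : mindex I) (w : I -> nat).

Lemma psME f g n :
  (f * g) n = \sum_(a <- mindices I (mdeg n) | leqm a n) f a * g (subm n a).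
Proof. exact: fpsME. Qed.

Definition psC (c : K) : ps := fun n => if n == 0 then c else 0.

Definition mon a : ps := fun n => (n == a)%:R.

Definition psX i : ps := mon (munit i).

Lemma coef_monM a f n :
  (mon a * f) n = if leqm a n then f (subm n a) else 0.
Proof.
rewrite psME /mon; case: ifP => an; last first.
  rewrite big1 // => b bn; case: eqP => [ba|_]; last by rewrite mul0r.
  by rewrite -ba bn in an.
rewrite big_mkcond (bigD1_seq a) ?uniq_mindices ?mem_mindices ?leqm_mdeg //=.
rewrite an eqxx mul1r big1 ?addr0 // => b /negPf->.
by rewrite mul0r if_same.
Qed.

Lemma coef_monMD a f n : (mon a * f) (a + n) = f n.
Proof. by rewrite coef_monM leqmDr addmK. Qed.

Lemma monD a b : mon (a + b) = mon a * mon b.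
Proof.
apply/ps_ext=> n; rewrite coef_monM /mon eq_sym addm_eqE eq_sym.
by case: (leqm a n).
Qed.

Lemma monS i a : mon (munit i + a) = psX i * mon a.
Proof. exact: monD. Qed.

Lemma mon0 : mon 0 = 1.
Proof. by []. Qed.

Lemma coef_psCM c f n : (psC c * f) n = c * f n.
Proof.
have n0 : leqm 0 n by apply/forallP=> i; rewrite ffunE.
rewrite psME big_mkcond (bigD1_seq 0) ?uniq_mindices ?mem_mindices ?mdegE ?wt0 //=.
rewrite n0 /psC eqxx big1 ?addr0 => [|a /negPf->].
  by congr (c * f _); apply/ffunP=> i; rewrite !ffunE subn0.
by rewrite mul0r if_same.
Qed.

Fact psC_zmod : zmod_morphism psC.
Proof.
by move=> c d; apply/ps_ext=> n; rewrite ps_addE ps_oppE /psC; case: eqP; rewrite ?subr0.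
Qed.

Fact psC_monoid : monoid_morphism psC.
Proof.
split=> [|c d]; apply/ps_ext=> n.
  by rewrite /psC /GRing.one /= /fps1; case: eqP.
by rewrite coef_psCM /psC; case: eqP; rewrite ?mulr0.
Qed.

HB.instance Definition _ := GRing.isZmodMorphism.Build K ps psC psC_zmod.
HB.instance Definition _ := GRing.isMonoidMorphism.Build K ps psC psC_monoid.

Lemma coef0M f g : (f * g) 0 = f 0 * g 0.
Proof.
rewrite psME big_mkcond (bigD1_seq 0) ?uniq_mindices ?mem_mindices //=.
have l0 : leqm 0 (0 : mindex I) by apply/forallP=> i.
rewrite l0 big1 ?addr0 => [|a a0]; last first.
  case: ifP => // /forallP a0'; case/eqP: a0; apply/ffunP=> i.
  by apply/eqP; rewrite ffunE -leqn0; have := a0' i; rewrite ffunE.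
by congr (_ * g _); apply/ffunP=> i; rewrite !ffunE.
Qed.

Lemma coef01 : (1 : ps) 0 = 1.
Proof. by rewrite /GRing.one /= /fps1 eqxx. Qed.

Definition Fil w k f := forall q, (wt w q < k)%N -> f q = 0.

Lemma Fil_le w k l f : (l <= k)%N -> Fil w k f -> Fil w l f.
Proof. by move=> lk fk q /leq_trans ql; apply/fk/ql. Qed.

Lemma Fil0 w k : Fil w k 0. Proof. by []. Qed.

Lemma FilD w k f g : Fil w k f -> Fil w k g -> Fil w k (f + g).
Proof. by move=> fk gk q qk; rewrite ps_addE fk // gk // addr0. Qed.

Lemma FilN w k f : Fil w k f -> Fil w k (- f).
Proof. by move=> fk q qk; rewrite ps_oppE fk // oppr0. Qed.

Lemma FilB w k f g : Fil w k f -> Fil w k g -> Fil w k (f - g).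
Proof. by move=> fk /FilN; apply: FilD. Qed.

Lemma Fil_sum w k (J : Type) (r : seq J) (P : pred J) (F : J -> ps) :
  (forall j, P j -> Fil w k (F j)) -> Fil w k (\sum_(j <- r | P j) F j).
Proof. by move=> H; elim/big_rec: _ => // j f Pj fk; apply: FilD => //; apply: H. Qed.

Lemma FilM w k l f g : Fil w k f -> Fil w l g -> Fil w (k + l) (f * g).
Proof.
move=> fk gl q qkl; rewrite psME big1 // => a /submK aq.
have [ak|ka] := ltnP (wt w a) k; first by rewrite fk ?mul0r.
by rewrite gl ?mulr0 //; have := congr1 (wt w) aq; rewrite wtD; lia.
Qed.

Lemma FilMl w k f g : Fil w k g -> Fil w k (f * g).
Proof. by move=> gk; apply: (@FilM w 0 k). Qed.

Lemma FilMr w k f g : Fil w k f -> Fil w k (f * g).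
Proof. by rewrite mulrC; apply: FilMl. Qed.

Lemma FilX w k (n : nat) f : Fil w k f -> Fil w (k * n) (f ^+ n).
Proof.
move=> fk; elim: n => [|n IH]; first by rewrite muln0.
by rewrite exprS mulnS; apply: FilM.
Qed.

Lemma FilX1 w (n : nat) f : Fil w 1 f -> Fil w n (f ^+ n).
Proof. by move=> f1; have := @FilX w 1 n f f1; rewrite mul1n. Qed.

Lemma Fil_mon w a : Fil w (wt w a) (mon a).
Proof. by move=> q; rewrite /mon; case: eqP => // ->; rewrite ltnn. Qed.

Lemma Fil_psX w i : Fil w (w i) (psX i).
Proof. by rewrite -[w i](wt_munit w); apply: Fil_mon. Qed.

(** The filtrations are separated; equalities of series are proved order by
    order with this. *)
Lemma Fil_eq0 w f : (forall k, Fil w k f) -> f = 0.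
Proof. by move=> H; apply/ps_ext=> q; apply: (H (wt w q).+1). Qed.

Lemma Fil_eq w f g : (forall k, Fil w k (f - g)) -> f = g.
Proof. by move=> H; apply/eqP; rewrite -subr_eq0; apply/eqP/(Fil_eq0 H). Qed.

Lemma FilB_M w k f f' g g' : Fil w k (f - f') -> Fil w k (g - g') ->
  Fil w k (f * g - f' * g').
Proof.
move=> ff gg; have -> : f * g - f' * g' = (f - f') * g + f' * (g - g') by ring.
by apply: FilD; [apply: FilMr | apply: FilMl].
Qed.

Lemma FilB_X w k (n : nat) f f' : Fil w k (f - f') -> Fil w k (f ^+ n - f' ^+ n).
Proof.
move=> ff; elim: n => [|n IH]; first by rewrite subrr.
by rewrite !exprS; apply: FilB_M.
Qed.

Lemma FilB_trans w k f g h : Fil w k (f - g) -> Fil w k (g - h) -> Fil w k (f - h).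
Proof. by move=> fg gh; rewrite -(subrK g f) -addrA; apply: FilD. Qed.

Lemma FilB_sym w k f g : Fil w k (f - g) -> Fil w k (g - f).
Proof. by rewrite -opprB => /FilN; rewrite opprK. Qed.

Lemma Fil1_coef0 f : f 0 = 0 <-> Fil w1 1 f.
Proof.
split=> [f0 q|fk]; last by apply: fk; rewrite wt0.
by rewrite -mdegE ltnS leqn0 mdeg_eq0 => /eqP ->.
Qed.

Lemma Fil1_near_psX i g : Fil w1 2 (g - psX i) -> Fil w1 1 g.
Proof.
move=> g2; rewrite -(subrK (psX i) g); apply: FilD; first exact: Fil_le g2.
exact: Fil_psX.
Qed.

(** Truncation at total degree d, written as a polynomial so that algebraic
    identities checked on monomials transfer to it. *)
Definition psT d f : ps := \sum_(a <- mindices I d) psC (f a) * mon a.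

Lemma coef_psT d f n : psT d f n = if (mdeg n <= d)%N then f n else 0.
Proof.
rewrite /psT ps_sumE.
under eq_bigr do rewrite coef_psCM /mon.
case: ifP => nd; last first.
  rewrite big_seq big1 // => a; rewrite mem_mindices.
  by case: eqP => [<-|]; rewrite ?nd ?mulr0.
rewrite (bigD1_seq n) ?uniq_mindices ?mem_mindices //= eqxx mulr1 big1 ?addr0 //.
by move=> a /negPf; rewrite eq_sym => ->; rewrite mulr0.
Qed.

Lemma psT_Fil d f : Fil w1 d.+1 (f - psT d f).
Proof.
by move=> q; rewrite -mdegE ltnS ps_addE ps_oppE coef_psT => ->; rewrite subrr.
Qed.

Lemma psTK d f : psT d f + (f - psT d f) = f.
Proof. by rewrite addrC subrK. Qed.

End Filtration.

Arguments psC {I K}.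
Arguments psX {I K}.
Arguments mon {I K}.

(** If the values of [Psi f] at height k only depend on those of f at smaller
    heights, the iterates of [Psi] stabilize at each index.  All the recursive
    constructions of series below are instances. *)
Lemma contraction_fixpoint (T X : Type) (x0 : X) (ht : T -> nat)
    (Psi : (T -> X) -> T -> X) :
  (forall k f g, (forall q, (ht q < k)%N -> f q = g q) ->
     forall q, (ht q < k.+1)%N -> Psi f q = Psi g q) ->
  exists f, forall q, f q = Psi f q.
Proof.
move=> contr; pose F k := iter k Psi (fun=> x0).
have stab k l q : (ht q < k)%N -> (k <= l)%N -> F k q = F l q.
  elim: k l q => // k IH [|l] q qk kl //=.
  by apply: (contr k) => // r rk; apply: IH.
exists (fun q => F (ht q).+1 q) => q.
rewrite [LHS]/F iterS -/(F (ht q)).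
by apply: (contr (ht q)) => // r rq; symmetry; apply: stab.
Qed.

Section Unipotent.
Variables (I : finType) (K : comNzRingType).
Local Notation ps := (ps I K).
Implicit Types (f g h : ps) (w : I -> nat).

(** As f = U f - (U f - f), a bound on the weight of U f passes to f, one unit at a
    time. *)
Lemma unipotent_Fil (w : I -> nat) (U : ps -> ps) :
  (forall f g, U (f - g) = U f - U g) ->
  (forall k f, Fil w k f -> Fil w k.+1 (U f - f)) ->
  forall k f, Fil w k (U f) -> Fil w k f.
Proof.
move=> UB Uu k f Uf.
suff H j : (j <= k)%N -> Fil w j f by apply: (H k).
elim: j => // j IH jk.
have -> : f = U f - (U f - f) by rewrite subKr.
apply: FilB; first exact: Fil_le Uf.
by apply/Uu/IH/ltnW.
Qed.

(** The inverse image of g is the fixed point of f = g - (U f - f). *)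
Lemma unipotent_bij (U : ps -> ps) :
  (forall f g, U (f - g) = U f - U g) ->
  (forall k f, Fil w1 k f -> Fil w1 k.+1 (U f - f)) ->
  exists V, cancel U V /\ cancel V U.
Proof.
move=> UB Uu.
have inj f g : U f = U g -> f = g.
  move=> Ufg; apply: (@Fil_eq _ _ w1) => k; apply: (unipotent_Fil UB Uu).
  by rewrite UB Ufg subrr.
have surj g : exists f, U f = g.
  have [|f fE] := @contraction_fixpoint _ K 0 (@mdeg I)
    (fun (f : ps) q => (g - (U f - f)) q).
    move=> k f f' ff' q qk.
    have ffk : Fil w1 k (f - f').
      by move=> r; rewrite -mdegE => rk; rewrite ps_addE ps_oppE ff' // subrr.
    have := Uu _ _ ffk q; rewrite -mdegE => /(_ qk) /eqP.
    rewrite UB !(ps_addE, ps_oppE) => /eqP e.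
    apply/eqP; rewrite -subr_eq0 -[X in _ == X]oppr0 -e; apply/eqP; ring.
  exists f; have e : f = g - (U f - f) by apply/ps_ext.
  apply/eqP; rewrite -subr_eq0.
  have -> : U f - g = f - (g - (U f - f)) by ring.
  by rewrite -e subrr.
have [V VK] := choice surj.
by exists V; split=> // f; apply: inj; rewrite VK.
Qed.

Lemma Fil_unit_cancel w k (u f : ps) :
  Fil w 1 (u - 1) -> Fil w k (u * f) -> Fil w k f.
Proof.
move=> u1 uf; apply: (@unipotent_Fil w (fun f => u * f)) uf => [g h|l g gl].
  by rewrite mulrBr.
have -> : u * g - g = (u - 1) * g by ring.
by apply: FilM u1 gl.
Qed.

Lemma psV_exists (u : ps) : u 0 = 1 -> exists v, u * v = 1 /\ v 0 = 1.
Proof.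
move=> u0; have u1 : Fil w1 1 (u - 1).
  by apply/Fil1_coef0; rewrite ps_addE ps_oppE u0 coef01 subrr.
have [V [_ VK]] : exists V, cancel (fun f => u * f) V /\ cancel V (fun f => u * f).
  apply: unipotent_bij => [f g|k f fk]; first by rewrite mulrBr.
  have -> : u * f - f = (u - 1) * f by ring.
  by apply: FilM u1 fk.
exists (V 1); split; first exact: VK.
have := congr1 (fun f : ps => f 0) (VK 1).
by rewrite coef0M u0 mul1r coef01.
Qed.

Lemma mon_lreg (a : mindex I) : injective (fun f : ps => mon a * f).
Proof.
move=> f g fg; apply/ps_ext=> n; rewrite -(coef_monMD a f) -(coef_monMD a g).
by congr (_ _).
Qed.

Lemma psX_lreg i : injective (fun f : ps => psX i * f).
Proof. exact: mon_lreg. Qed.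

End Unipotent.

(** * Filtered morphisms and derivations *)

Section Morphisms.
Variables (I J : finType) (K L : comNzRingType) (io : {rmorphism K -> L}).
Implicit Types (phi : ps I K -> ps J L).

(** Substitutions, flows, conjugation and the liftings of series in fewer
    variables are all morphisms of this kind.  The condition [cmF] is continuity
    for the topology of total degree; [io] is the action on coefficients. *)
Record cmor phi : Prop := Cmor {
  cmB : {morph phi : f g / f - g};
  cmM : {morph phi : f g / f * g};
  cmC : forall c, phi (psC c) = psC (io c);
  cmF : forall k f, Fil w1 k f -> Fil w1 k (phi f)
}.

Section Theory.
Variables (phi : ps I K -> ps J L) (phiP : cmor phi).

Lemma cm0 : phi 0 = 0.
Proof. by rewrite -(subrr 0) (cmB phiP) subrr. Qed.
Lemma cmN : {morph phi : f / - f}.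
Proof. by move=> f; rewrite -sub0r (cmB phiP) cm0 sub0r. Qed.
Lemma cmD : {morph phi : f g / f + g}.
Proof. by move=> f g; rewrite -[g in LHS]opprK (cmB phiP) cmN opprK. Qed.
Lemma cm1 : phi 1 = 1.
Proof. by rewrite -(rmorph1 psC) (cmC phiP) !rmorph1. Qed.
Lemma cmX (n : nat) : {morph phi : f / f ^+ n}.
Proof. by move=> f; elim: n => [|n IH]; rewrite ?cm1 // !exprS (cmM phiP) IH. Qed.
Lemma cm_sum (T : Type) (r : seq T) (P : pred T) (F : T -> ps I K) :
  phi (\sum_(i <- r | P i) F i) = \sum_(i <- r | P i) phi (F i).
Proof. exact: (big_morph phi cmD cm0). Qed.

Lemma cm_coef0 f : phi f 0 = io (f 0).
Proof.
have f0 : Fil w1 1 (f - psC (f 0)).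
  by apply/Fil1_coef0; rewrite ps_addE ps_oppE /psC eqxx subrr.
have /Fil1_coef0 := cmF phiP f0.
rewrite (cmB phiP) (cmC phiP) ps_addE ps_oppE /psC eqxx => /eqP.
by rewrite subr_eq0 => /eqP.
Qed.

End Theory.

(** Congruences between morphisms need only be checked on the variables, for
    whatever weight: they propagate to monomials by multiplicativity, and to
    series because [cmF] makes the tail of high degree irrelevant. *)
Lemma cmor_congr w k phi psi : cmor phi -> cmor psi ->
  (forall i, Fil w k (phi (psX i) - psi (psX i))) ->
  forall f, Fil w k (phi f - psi f).
Proof.
move=> phiP psiP H f.
have Hmon a : Fil w k (phi (mon a) - psi (mon a)).
  elim/mindex_ind: a => [|i a IH].
    by rewrite mon0 (cm1 phiP) (cm1 psiP) subrr; apply: Fil0.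
  by rewrite monS (cmM phiP) (cmM psiP); apply: FilB_M; [exact: H|].
move=> q qk; rewrite -(psTK (mdeg q) f) (cmD phiP) (cmD psiP).
have fr := @psT_Fil _ _ (mdeg q) f.
rewrite !(ps_addE, ps_oppE) (cmF phiP fr) ?(cmF psiP fr) -?mdegE //.
rewrite !addr0 -ps_oppE -ps_addE.
suff: Fil w k (phi (psT (mdeg q) f) - psi (psT (mdeg q) f)) by apply.
rewrite /psT (cm_sum phiP) (cm_sum psiP) -sumrB; apply: Fil_sum => a _.
by rewrite (cmM phiP) (cmM psiP) (cmC phiP) (cmC psiP) -mulrBr; apply: FilMl.
Qed.

Lemma cmor_ext phi psi : cmor phi -> cmor psi ->
  (forall i, phi (psX i) = psi (psX i)) -> forall f, phi f = psi f.
Proof.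
move=> phiP psiP H f; apply: (@Fil_eq _ _ w1) => k.
by apply: cmor_congr => // i; rewrite H subrr.
Qed.

(** Multiplicativity on monomials suffices, again by truncation. *)
Lemma cmor_of_mon phi :
  {morph phi : f g / f - g} ->
  (forall c f, phi (psC c * f) = psC (io c) * phi f) ->
  (forall k f, Fil w1 k f -> Fil w1 k (phi f)) ->
  phi 1 = 1 -> (forall a b, phi (mon (a + b)) = phi (mon a) * phi (mon b)) ->
  cmor phi.
Proof.
move=> phiB phiZ phiF phi1 phiM.
have phi0 : phi 0 = 0 by rewrite -(subrr 0) phiB subrr.
have phiD : {morph phi : f g / f + g}.
  by move=> f g; rewrite -[g in LHS]opprK phiB -sub0r phiB phi0 sub0r opprK.
have phiS T (r : seq T) (P : pred T) (F : T -> ps I K) :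
    phi (\sum_(i <- r | P i) F i) = \sum_(i <- r | P i) phi (F i).
  exact: (big_morph phi phiD phi0).
split=> // [f g|c]; last by rewrite -[psC c]mulr1 phiZ phi1 mulr1.
apply/ps_ext=> q; set d := mdeg q.
apply/eqP; rewrite -subr_eq0 -ps_oppE -ps_addE; apply/eqP.
suff: Fil w1 d.+1 (phi (f * g) - phi f * phi g) by apply; rewrite -mdegE.
have fr := @psT_Fil _ _ d f; have gr := @psT_Fil _ _ d g.
apply: (@FilB_trans _ _ _ _ _ (phi (psT d f * psT d g))).
  by rewrite -phiB; apply/phiF/FilB_M.
apply: (@FilB_trans _ _ _ _ _ (phi (psT d f) * phi (psT d g))); last first.
  by apply/FilB_sym/FilB_M; rewrite -phiB; apply: phiF.
have -> : phi (psT d f * psT d g) = phi (psT d f) * phi (psT d g).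
  rewrite /psT mulr_suml !phiS mulr_suml; apply: eq_bigr => a _.
  rewrite mulr_sumr phiS mulr_sumr; apply: eq_bigr => b _.
  by rewrite mulrACA -rmorphM /= !phiZ -monD phiM !rmorphM /=; ring.
by rewrite subrr; apply: Fil0.
Qed.

(** Derivations along phi.  Besides vector fields this covers differences such as
    [D \o phi - phi \o D], whose vanishing expresses that phi commutes with D. *)
Record cder phi (de : ps I K -> ps J L) : Prop := Cder {
  cdB : {morph de : f g / f - g};
  cdM : forall f g, de (f * g) = de f * phi g + phi f * de g;
  cdC : forall c, de (psC c) = 0;
  cdF : forall k f, Fil w1 k.+1 f -> Fil w1 k (de f)
}.

Section DerTheory.
Variables (phi de : ps I K -> ps J L) (phiP : cmor phi) (deP : cder phi de).

Lemma cd0 : de 0 = 0.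
Proof. by rewrite -(subrr 0) (cdB deP) subrr. Qed.
Lemma cdN : {morph de : f / - f}.
Proof. by move=> f; rewrite -sub0r (cdB deP) cd0 sub0r. Qed.
Lemma cdD : {morph de : f g / f + g}.
Proof. by move=> f g; rewrite -[g in LHS]opprK (cdB deP) cdN opprK. Qed.
Lemma cd1 : de 1 = 0.
Proof. by rewrite -(rmorph1 psC) (cdC deP). Qed.
Lemma cd_sum (T : Type) (r : seq T) (P : pred T) (F : T -> ps I K) :
  de (\sum_(i <- r | P i) F i) = \sum_(i <- r | P i) de (F i).
Proof. exact: (big_morph de cdD cd0). Qed.
Lemma cdZ c f : de (psC c * f) = psC (io c) * de f.
Proof. by rewrite (cdM deP) (cdC deP) mul0r add0r (cmC phiP). Qed.
Lemma cdX (n : nat) f : de (f ^+ n) = (phi f ^+ n.-1 * de f) *+ n.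
Proof.
elim: n => [|n IH]; first by rewrite expr0 cd1 mulr0n.
rewrite exprS (cdM deP) IH (cmX phiP) /=; case: n {IH} => [|n].
  by rewrite !expr0 mulr0n mulr0 addr0 mulr1 mul1r.
by rewrite mulrnAr mulrA -exprS [RHS]mulrS [de f * _]mulrC.
Qed.

(** Induction on the degree by the Leibniz rule. *)
Lemma cder_mon_ind (S : ps J L -> Prop) (S0 : S 0)
    (SD : forall f g, S f -> S g -> S (f + g))
    (SM : forall f g, S g -> S (f * g)) :
  (forall i, S (de (psX i))) -> forall a, S (de (mon a)).
Proof.
move=> H; elim/mindex_ind => [|i a IH]; first by rewrite mon0 cd1.
rewrite monS (cdM deP); apply: SD; last exact: SM.
by rewrite mulrC; apply: SM.
Qed.

Lemma cder_Fil w k :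
  (forall i, Fil w k (de (psX i))) -> forall f, Fil w k (de f).
Proof.
move=> H f q qk; rewrite -(psTK (mdeg q).+1 f) cdD ps_addE.
have fr := @psT_Fil _ _ (mdeg q).+1 f.
rewrite (cdF deP fr) -?mdegE // addr0.
suff: Fil w k (de (psT (mdeg q).+1 f)) by apply.
rewrite /psT cd_sum; apply: Fil_sum => a _; rewrite cdZ; apply: FilMl.
apply: (cder_mon_ind (S := Fil w k)) => //; first exact: FilD.
by move=> *; apply: FilMl.
Qed.

(** A derivation raising the degree of the variables by k raises every degree by
    k: by the Leibniz rule one variable of each monomial is replaced. *)
Lemma cder_raise k : (forall i, Fil w1 k.+1 (de (psX i))) ->
  forall j f, Fil w1 j f -> Fil w1 (j + k) (de f).
Proof.
move=> H; have Hmon a : Fil w1 (mdeg a + k) (de (mon a)).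
  elim/mindex_ind: a => [|i a IH]; first by rewrite mon0 cd1; apply: Fil0.
  have -> : (mdeg (munit i + a)%R + k = k.+1 + mdeg a)%N.
    by rewrite !mdegE wtD wt1_munit; lia.
  rewrite monS (cdM deP); apply: FilD.
    by apply: FilM => //; apply: cmF => //; rewrite mdegE; apply: Fil_mon.
  have -> : (k.+1 + mdeg a = 1 + (mdeg a + k))%N by lia.
  by apply: FilM => //; apply: cmF => //; apply: Fil_psX.
move=> j f fj q qk; rewrite -(psTK (mdeg q).+1 f) cdD ps_addE.
have fr := @psT_Fil _ _ (mdeg q).+1 f.
rewrite (cdF deP fr) -?mdegE // addr0.
suff: Fil w1 (j + k) (de (psT (mdeg q).+1 f)) by apply.
rewrite /psT cd_sum; apply: Fil_sum => a _; rewrite cdZ.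
have [aj|ja] := ltnP (mdeg a) j.
  by rewrite fj -?mdegE // rmorph0 rmorph0 mul0r.
by apply: FilMl; apply: Fil_le (Hmon a); rewrite leq_add2r.
Qed.

End DerTheory.

Lemma cder_sub phi de de' : cder phi de -> cder phi de' ->
  cder phi (fun f => de f - de' f).
Proof.
move=> deP deP'; split=> [f g|f g|c|k f fk].
- by rewrite (cdB deP) (cdB deP'); ring.
- by rewrite (cdM deP) (cdM deP'); ring.
- by rewrite (cdC deP) (cdC deP') subrr.
- by apply: FilB; [apply: (cdF deP)|apply: (cdF deP')].
Qed.

Lemma cder_ext phi de de' : cmor phi -> cder phi de -> cder phi de' ->
  (forall i, de (psX i) = de' (psX i)) -> forall f, de f = de' f.
Proof.
move=> phiP deP deP' H f; apply: (@Fil_eq _ _ w1) => k.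
apply: (cder_Fil phiP (cder_sub deP deP')) => i.
by rewrite H subrr.
Qed.

Lemma cder_mul phi de c : cder phi de -> cder phi (fun f => c * de f).
Proof.
move=> deP; split=> [f g|f g|d|k f fk].
- by rewrite (cdB deP) mulrBr.
- by rewrite (cdM deP); ring.
- by rewrite (cdC deP) mulr0.
- by apply: FilMl; apply: (cdF deP).
Qed.

Lemma cder_add phi de de' : cder phi de -> cder phi de' ->
  cder phi (fun f => de f + de' f).
Proof.
move=> deP deP'; split=> [f g|f g|c|k f fk].
- by rewrite (cdB deP) (cdB deP'); ring.
- by rewrite (cdM deP) (cdM deP'); ring.
- by rewrite (cdC deP) (cdC deP') addr0.
- by apply: FilD; [apply: (cdF deP)|apply: (cdF deP')].
Qed.

End Morphisms.

Lemma cmor_id (I : finType) (K : comNzRingType) :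
  cmor idfun (fun f : ps I K => f).
Proof. by []. Qed.

Lemma cmor_comp (I J J' : finType) (K L M : comNzRingType)
  (io : {rmorphism K -> L}) (io' : {rmorphism L -> M})
  (phi : ps I K -> ps J L) (psi : ps J L -> ps J' M) :
  cmor io phi -> cmor io' psi -> cmor (io' \o io) (psi \o phi).
Proof.
move=> P Q; split=> [f g|f g|c|k f fk] /=.
- by rewrite (cmB P) (cmB Q).
- by rewrite (cmM P) (cmM Q).
- by rewrite (cmC P) (cmC Q).
- by apply: (cmF Q); apply: (cmF P).
Qed.

Lemma cmor_io (I J : finType) (K L : comNzRingType)
  (io io' : {rmorphism K -> L}) (phi : ps I K -> ps J L) :
  io =1 io' -> cmor io phi -> cmor io' phi.
Proof. by move=> e [? ? C ?]; split=> // c; rewrite C e. Qed.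

Lemma cder_postcomp (I J J' : finType) (K L M : comNzRingType)
  (io' : {rmorphism L -> M})
  (phi de : ps I K -> ps J L) (psi : ps J L -> ps J' M) :
  cder phi de -> cmor io' psi -> cder (psi \o phi) (psi \o de).
Proof.
move=> P Q; split=> [f g|f g|c|k f fk] /=.
- by rewrite (cdB P) (cmB Q).
- by rewrite (cdM P) (cmD Q) !(cmM Q).
- by rewrite (cdC P) (cm0 Q).
- by apply: (cmF Q); apply: (cdF P).
Qed.

Lemma cder_precomp (I J J' : finType) (K L M : comNzRingType)
  (io : {rmorphism K -> L})
  (phi : ps I K -> ps J L) (psi de : ps J L -> ps J' M) :
  cmor io phi -> cder psi de -> cder (psi \o phi) (de \o phi).
Proof.
move=> Q P; split=> [f g|f g|c|k f fk] /=.
- by rewrite (cmB Q) (cdB P).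
- by rewrite (cmM Q) (cdM P).
- by rewrite (cmC Q) (cdC P).
- by apply: (cdF P); apply: (cmF Q).
Qed.

Lemma cmor_unipotent (I : finType) (K : comNzRingType) (phi : ps I K -> ps I K) :
  cmor idfun phi -> (forall i, Fil w1 2 (phi (psX i) - psX i)) ->
  forall k f, Fil w1 k f -> Fil w1 k.+1 (phi f - f).
Proof.
move=> P H k f fk.
have Hmon a : Fil w1 (mdeg a).+1 (phi (mon a) - mon a).
  elim/mindex_ind: a => [|i a IH]; first by rewrite mon0 (cm1 P) subrr.
  have -> : ((mdeg (munit i + a)%R).+1 = 2 + mdeg a)%N.
    by rewrite !mdegE wtD wt1_munit; lia.
  rewrite monS (cmM P).
  have -> : phi (psX i) * phi (mon a) - psX i * mon a =
    (phi (psX i) - psX i) * phi (mon a) + psX i * (phi (mon a) - mon a) by ring.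
  apply: FilD.
    by apply: FilM => //; apply: (cmF P); rewrite mdegE; apply: Fil_mon.
  have -> : (2 + mdeg a = 1 + (mdeg a).+1)%N by lia.
  by apply: FilM => //; apply: Fil_psX.
move=> q qk; rewrite -(psTK (mdeg q) f) (cmD P).
have fr := @psT_Fil _ _ (mdeg q) f.
rewrite opprD addrACA ps_addE -[RHS]addr0; congr (_ + _); last first.
  suff: Fil w1 (mdeg q).+1 (phi (f - psT (mdeg q) f) - (f - psT (mdeg q) f)).
    by apply; rewrite -mdegE.
  by apply: FilB => //; apply: (cmF P).
suff: Fil w1 k.+1 (phi (psT (mdeg q) f) - psT (mdeg q) f) by apply.
rewrite /psT (cm_sum P) -sumrB; apply: Fil_sum => a _.
rewrite (cmM P) (cmC P) -mulrBr.
have [ak|ka] := ltnP (mdeg a) k; first by rewrite fk -?mdegE // rmorph0 mul0r.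
by apply: FilMl; apply: Fil_le (Hmon a).
Qed.

(** The formal inverse function theorem, for changes of variables tangent to the
    identity. *)
Lemma cmor_inv (I : finType) (K : comNzRingType) (phi : ps I K -> ps I K) :
  cmor idfun phi -> (forall i, Fil w1 2 (phi (psX i) - psX i)) ->
  exists psi, [/\ cmor idfun psi, cancel phi psi & cancel psi phi].
Proof.
move=> P H; have U := cmor_unipotent P H.
have [V [UV VU]] := unipotent_bij (cmB P) U.
exists V; split=> //; split=> [f g|f g|c|k f fk].
- by apply: (can_inj UV); rewrite (cmB P) !VU.
- by apply: (can_inj UV); rewrite (cmM P) !VU.
- by apply: (can_inj UV); rewrite VU (cmC P).
- by apply: (unipotent_Fil (cmB P) U); rewrite VU.
Qed.

(** * Partial derivatives and substitutions *)

Section PartialDerivative.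
Variables (I : finType) (K : comNzRingType).
Implicit Types (f g : ps I K) (i : I).

Definition pd i f : ps I K := fpsD i f.

Lemma pd_psX_mul i f n : (psX i * pd i f) n = (n i)%:R * f n.
Proof.
rewrite coef_monM leqm_munit lt0n; case: eqP => [->|/eqP]; first by rewrite mul0r.
rewrite -lt0n -leqm_munit => ni; rewrite /pd /fpsD addrC submK //.
congr (_%:R * _); rewrite leqm_munit in ni.
by rewrite /subm /munit !ffunE eqxx subn1 prednK.
Qed.

Lemma cder_pd i : cder (fun f => f) (pd i).
Proof.
have pdB : {morph pd i : f g / f - g}.
  move=> f g; apply/ps_ext=> n.
  by rewrite /pd /fpsD !(ps_addE, ps_oppE) mulrBr.
split=> // [f g|c|k f fk q qk].
- apply: (@psX_lreg _ _ i); rewrite /= mulrDr.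
  apply/ps_ext=> n; rewrite pd_psX_mul.
  have -> : psX i * (f * pd i g) = f * (psX i * pd i g) by ring.
  rewrite mulrA ps_addE !psME mulr_sumr -big_split.
  apply: eq_bigr => a /submK an; rewrite !pd_psX_mul.
  have -> : (n i)%:R = (a i)%:R + (subm n a i)%:R :> K.
    by rewrite -{1}an ffunE -natrD.
  by rewrite /=; ring.
- apply/ps_ext=> n; rewrite /pd /fpsD /psC addm_eq0 (negPf (munit_neq0 i)).
  by rewrite andbF mulr0.
- rewrite /pd /fpsD fk ?mulr0 // wtD wt1_munit; lia.
Qed.

Lemma pd_psX i j : pd i (psX j) = if i == j then 1 else 0.
Proof.
apply/ps_ext=> n; rewrite /pd /fpsD /psX /mon.
have [<-|ij] := eqVneq i j.
  rewrite -{2}[munit i]add0r; have [n0|n0] := eqVneq (n + _) _.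
    have {n0}-> : n = 0 by apply: (@addmI _ (munit i)); rewrite addrC n0 addrC.
    by rewrite ffunE mulr1 coef01.
  rewrite mulr0 /GRing.one /= /fps1; case: eqP => // n0'.
  by rewrite n0' eqxx in n0.
case: eqP => [/(congr1 (fun a : mindex I => a i))|]; last by rewrite mulr0.
by rewrite !ffunE eqxx (negPf ij) => /eqP; rewrite addn_eq0 andbF.
Qed.

End PartialDerivative.

Section Substitution.
Variables (I J : finType) (K : comNzRingType) (G : I -> ps J K).
Hypothesis G1 : forall i, Fil w1 1 (G i).

Definition sub (f : ps I K) : ps J K := fpscomp f G.

Definition monG (a : mindex I) : ps J K := \prod_i G i ^+ a i.

Lemma fpsXE (f : ps J K) k : fpsX f k = f ^+ k.
Proof. by elim: k => // k IH; rewrite exprS -IH. Qed.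

Lemma monGE (a : mindex I) :
  \big[@fpsM J K/@fps1 J K]_(i : I) fpsX (G i) (a i) = monG a.
Proof. by apply: eq_bigr => i _; rewrite fpsXE. Qed.

Lemma Fil_monG (a : mindex I) : Fil w1 (mdeg a) (monG a).
Proof.
rewrite /monG /mdeg; elim/big_rec2: _ => [|i k f _ IH]; first by move=> q.
by apply: FilM => //; apply: FilX1.
Qed.

(** Since the [G i] have no constant term, monomials of degree larger than that of
    n do not contribute, and the range of summation may be enlarged at will. *)
Lemma coef_sub f n d : (mdeg n <= d)%N ->
  sub f n = \sum_(a <- mindices I d) f a * monG a n.
Proof.
move=> nd; rewrite /sub /fpscomp.
transitivity (\sum_(a <- mindices I d | (mdeg a <= mdeg n)%N) f a * monG a n).
  under eq_bigr do rewrite monGE; rewrite -[RHS]big_filter; apply: perm_big.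
  apply: uniq_perm; rewrite ?uniq_mindices //.
    exact: filter_uniq (uniq_mindices _ _).
  move=> a; rewrite [RHS]mem_filter !mem_mindices.
  by case: leqP => // an; rewrite (leq_trans an nd).
rewrite big_mkcond; apply: eq_bigr => a _; case: leqP => // na.
by rewrite Fil_monG ?mulr0 // -mdegE.
Qed.

Lemma sub_mon a : sub (mon a) = monG a.
Proof.
apply/ps_ext=> n; rewrite (@coef_sub _ _ (maxn (mdeg n) (mdeg a))) ?leq_maxl //.
rewrite (bigD1_seq a) ?uniq_mindices ?mem_mindices ?leq_maxr //=.
by rewrite /mon eqxx mul1r big1 ?addr0 // => b /negPf->; rewrite mul0r.
Qed.

Lemma sub_psX i : sub (psX i) = G i.
Proof.
rewrite /psX sub_mon /monG (bigD1 i) //= ffunE eqxx expr1 big1 ?mulr1 //.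
by move=> j /negPf ji; rewrite ffunE ji expr0.
Qed.

Lemma cmor_sub : cmor idfun sub.
Proof.
apply: cmor_of_mon => [f g|c f|k f fk q qk||a b].
- apply/ps_ext=> n; rewrite ps_addE ps_oppE !(@coef_sub _ n (mdeg n)) //.
  by rewrite -sumrB; apply: eq_bigr => a _; rewrite !(ps_addE, ps_oppE) mulrBl.
- apply/ps_ext=> n; rewrite coef_psCM !(@coef_sub _ n (mdeg n)) // mulr_sumr.
  by apply: eq_bigr => a _; rewrite coef_psCM mulrA.
- rewrite (@coef_sub _ q (mdeg q)) // big1_seq // => a; rewrite mem_mindices.
  move=> /= aq; rewrite fk ?mul0r // -mdegE (leq_ltn_trans aq) //.
  by rewrite mdegE.
- transitivity (monG 0); first exact: (sub_mon 0).
  by rewrite /monG big1 // => i _; rewrite ffunE; apply: expr0.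
- rewrite !sub_mon /monG -big_split; apply: eq_bigr => i _.
  by rewrite ffunE; apply: exprD.
Qed.

End Substitution.

(** * Exponentials of derivations *)

Section Exponential.
Variables (I : finType) (K : numFieldType).
Local Notation ps := (ps I K).
Implicit Types (f g : ps).

Lemma cauchy_sum (t : nat -> nat -> ps) (M : nat) :
  \sum_(l < M) \sum_(i < l.+1) t i (l - i)%N =
  \sum_(i < M) \sum_(j < M - i) t i j.
Proof.
elim: M => [|M IH]; first by rewrite !big_ord0.
rewrite big_ord_recr /= IH [RHS]big_ord_recr /= subSnn big_ord1.
rewrite big_ord_recr /= subnn addrA; congr (_ + _).
rewrite -big_split; apply: eq_bigr => i _ /=.
by rewrite subSn 1?ltnW // big_ord_recr.
Qed.

(** The square exceeds the triangle by terms with i + j >= M only. *)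
Lemma cauchy_Fil (t : nat -> nat -> ps) (M : nat) :
  (forall i j, Fil w1 (i + j) (t i j)) ->
  Fil w1 M (\sum_(i < M) \sum_(j < M) t i j -
            \sum_(l < M) \sum_(i < l.+1) t i (l - i)%N).
Proof.
move=> tF; rewrite cauchy_sum -sumrB; apply: Fil_sum => i _.
have lM : (M - i <= M)%N by lia.
rewrite -(big_mkord xpredT (t i)) -(big_mkord xpredT (t i)).
rewrite (big_cat_nat (leq0n _) lM) /= [X in X - _]addrC addrK big_nat_cond.
apply: Fil_sum => j; rewrite andbT => /andP[Mj _].
by apply: Fil_le (tF i j); lia.
Qed.

Section OneOperator.
Variable D : ps -> ps.
Hypothesis DD : cder (fun f => f) D.
Hypothesis Dup : forall k f, Fil w1 k f -> Fil w1 k.+1 (D f).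

Let D0 := cd0 DD.
Let DZ c f : D (psC c * f) = psC c * D f.
Proof. exact: (cdZ (cmor_id I K) DD). Qed.

(** The exponential of an operator that raises the degree: the coefficient of
    index q of the series only involves the first [mdeg q] powers, which is the
    cut-off in [expD]. *)
Definition dexp (l : nat) f : ps := psC (l`!%:R)^-1 * iter l D f.

Definition expD f : ps := fun q => (\sum_(l < (mdeg q).+1) dexp l f) q.

Lemma dexp0 f : dexp 0 f = f.
Proof. by rewrite /dexp fact0 invr1 rmorph1 mul1r. Qed.

Lemma dexpS l f : psC l.+1%:R * dexp l.+1 f = D (dexp l f).
Proof.
rewrite /dexp iterS DZ mulrA -rmorphM; congr (psC _ * _).
by rewrite factS natrM invfM mulrA divff ?mul1r // pnatr_eq0.
Qed.

Lemma dexpSr l f : psC l.+1%:R * dexp l.+1 f = dexp l (D f).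
Proof.
rewrite /dexp iterSr mulrA -rmorphM; congr (psC _ * _).
by rewrite factS natrM invfM mulrA divff ?mul1r // pnatr_eq0.
Qed.

Lemma dexpB l : {morph dexp l : f g / f - g}.
Proof.
move=> f g; rewrite /dexp -mulrBr; congr (_ * _).
by elim: l => //= l ->; rewrite (cdB DD).
Qed.

Lemma dexpZ l c f : dexp l (psC c * f) = psC c * dexp l f.
Proof.
rewrite /dexp mulrCA; congr (_ * _).
by elim: l => //= l ->; rewrite DZ.
Qed.

Lemma Fil_dexp l k f : Fil w1 k f -> Fil w1 (k + l) (dexp l f).
Proof.
move=> fk; apply: FilMl; elim: l => [|l IH]; first by rewrite addn0.
by rewrite addnS; apply: Dup.
Qed.

Lemma natC_inj (n : nat) f g : psC n.+1%:R * f = psC n.+1%:R * g -> f = g.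
Proof.
move=> e; apply/ps_ext=> q; have := congr1 (fun h : ps => h q) e.
by rewrite !coef_psCM; apply: mulfI; rewrite pnatr_eq0.
Qed.

(** Leibniz rule for divided powers; it makes the exponential multiplicative. *)
Lemma dexpM l f g :
  dexp l (f * g) = \sum_(i < l.+1) dexp i f * dexp (l - i) g.
Proof.
elim: l => [|l IH]; first by rewrite big_ord1 !dexp0.
apply: (@natC_inj l); rewrite dexpS IH (cd_sum DD) mulr_sumr.
under eq_bigr => i _ do rewrite (cdM DD) -!dexpS.
rewrite big_split /=.
transitivity (\sum_(i < l.+2) (psC (i : nat)%:R + psC (l.+1 - i)%:R) *
    (dexp i f * dexp (l.+1 - i) g)); last first.
  apply: eq_bigr => i _; congr (_ * _); rewrite -rmorphD -natrD subnKC //.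
  by rewrite -ltnS.
under [RHS]eq_bigr do rewrite mulrDl.
rewrite big_split /=; congr (_ + _).
  rewrite [RHS]big_ord_recl /= !rmorph0 mul0r add0r; apply: eq_bigr => i _.
  by rewrite /= subSS mulrA.
rewrite [RHS]big_ord_recr /= subnn rmorph0 mul0r addr0; apply: eq_bigr => i _.
by rewrite subSn -1?ltnS // mulrCA.
Qed.

Lemma expD_approx L f : Fil w1 L.+1 (expD f - \sum_(l < L.+1) dexp l f).
Proof.
move=> q; rewrite ltnS -mdegE => qL; rewrite ps_addE ps_oppE /expD.
have Lq : ((mdeg q).+1 <= L.+1)%N by [].
rewrite -(big_mkord xpredT (dexp^~ f)) -(big_mkord xpredT (dexp^~ f)).
rewrite (big_cat_nat (leq0n _) Lq) /= ps_addE opprD addrA subrr add0r.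
rewrite -ps_oppE; suff: Fil w1 (mdeg q).+1 (- \sum_((mdeg q).+1 <= i < L.+1) dexp i f).
  by apply; rewrite -mdegE.
apply: FilN; rewrite big_nat_cond; apply: Fil_sum => l.
rewrite andbT => /andP[ql _].
by apply: (@Fil_le _ _ _ (0 + l)) => //; apply: Fil_dexp.
Qed.

Lemma cmor_expD : cmor idfun expD.
Proof.
split.
- move=> f g; apply/ps_ext => q; rewrite /expD ps_addE ps_oppE !ps_sumE -sumrB.
  by apply: eq_bigr => l _; rewrite dexpB.
- move=> f g; apply: (@Fil_eq _ _ w1) => L; apply: (@Fil_le _ _ _ L.+1) => //.
  apply: FilB_trans (@expD_approx L (f * g)) _.
  apply: FilB_trans _ (FilB_sym (FilB_M (@expD_approx L f) (@expD_approx L g))).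
  apply: FilB_sym; rewrite mulr_suml.
  under eq_bigr do rewrite mulr_sumr.
  under [X in _ - X]eq_bigr do rewrite dexpM.
  apply: (@cauchy_Fil (fun i j => dexp i f * dexp j g)) => i j.
  apply: FilM; [apply: (@Fil_dexp i 0) | apply: (@Fil_dexp j 0)] => //.
- move=> c; apply/ps_ext=> q; rewrite /expD big_ord_recl dexp0 big1 ?addr0 //.
  move=> i _; rewrite /dexp iterSr (cdC DD).
  have -> : iter i D 0 = 0 by elim: (nat_of_ord i) => //= j ->.
  exact: mulr0.
- move=> k f fk q qk; rewrite /expD ps_sumE big1 // => l _.
  by apply: (Fil_dexp fk); apply: leq_trans qk _; apply: leq_addr.
Qed.

Section Conjugation.
Variable V : ps -> ps.
Hypothesis VB : {morph V : f g / f - g}.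
Hypothesis VZ : forall c f, V (psC c * f) = psC c * V f.
Hypothesis VF : forall k f, Fil w1 k f -> Fil w1 k (V f).

(** Iterated commutators of V with D, divided by l! in [eV].  Together they form
    exp (- D) V exp D, computed without inverting exp D. *)
Fixpoint adV (l : nat) f : ps :=
  if l is l'.+1 then adV l' (D f) - D (adV l' f) else V f.

Definition eV l f : ps := psC (l`!%:R)^-1 * adV l f.

Lemma Fil_adV l k f : Fil w1 k f -> Fil w1 (k + l) (adV l f).
Proof.
elim: l k f => [|l IH] k f fk /=; first by rewrite addn0; apply: VF.
apply: FilB; first by rewrite addnS -addSn; apply/IH/Dup.
by rewrite addnS; apply/Dup/IH.
Qed.

Lemma V0 : V 0 = 0. Proof. by rewrite -{1}(subrr 0) VB subrr. Qed.
Lemma VD : {morph V : f g / f + g}.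
Proof. by move=> f g; rewrite -[g in LHS]opprK VB -sub0r VB V0 sub0r opprK. Qed.

Lemma eVS l f : eV l (D f) = D (eV l f) + psC l.+1%:R * eV l.+1 f.
Proof.
rewrite /eV DZ [psC l.+1%:R * _]mulrA -rmorphM factS natrM invfM mulrA.
by rewrite divff ?pnatr_eq0 // mul1r /=; ring.
Qed.

Lemma V_dexp n f : V (dexp n f) = \sum_(l < n.+1) dexp (n - l) (eV l f).
Proof.
elim: n f => [|n IH] f.
  by rewrite big_ord1 !dexp0 /eV fact0 invr1 rmorph1 mul1r.
apply: (@natC_inj n); rewrite -VZ dexpSr IH mulr_sumr.
have dexpD k : {morph dexp k : f g / f + g}.
  by move=> g h; rewrite /dexp -mulrDr; congr (_ * _); elim: k => //= k ->; rewrite (cdD DD).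
under eq_bigr => l _ do rewrite eVS dexpD dexpZ -dexpSr.
rewrite big_split /=.
transitivity (\sum_(l < n.+2) (psC (n.+1 - l)%:R + psC (l : nat)%:R) *
    dexp (n.+1 - l) (eV l f)); last first.
  apply: eq_bigr => i _; congr (_ * _); rewrite -rmorphD -natrD subnK //.
  by rewrite -ltnS.
under [RHS]eq_bigr do rewrite mulrDl.
rewrite big_split /=; congr (_ + _).
  rewrite [RHS]big_ord_recr /= subnn rmorph0 mul0r addr0; apply: eq_bigr => i _.
  by rewrite subSn // -ltnS.
rewrite [RHS]big_ord_recl /= !rmorph0 mul0r add0r; apply: eq_bigr => i _.
by rewrite /= subSS.
Qed.

Definition conjV f : ps := fun q => (\sum_(l < (mdeg q).+1) eV l f) q.

(** Intertwining relation V exp D = exp D (exp (- D) V exp D).  Both sides are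
    double sums over powers of D and commutators, summed over a triangle on the
    left and over a square on the right. *)
Lemma V_expD f : V (expD f) = expD (conjV f).
Proof.
have Vsum n (F : nat -> ps) : V (\sum_(l < n) F l) = \sum_(l < n) V (F l).
  exact: (big_morph V VD V0).
have eVF l : Fil w1 l (eV l f) by apply: FilMl; apply: (@Fil_adV l 0).
have conj_approx L : Fil w1 L.+1 (conjV f - \sum_(l < L.+1) eV l f).
  move=> q; rewrite ltnS -mdegE => qL; rewrite ps_addE ps_oppE /conjV.
  have Lq : ((mdeg q).+1 <= L.+1)%N by [].
  rewrite -(big_mkord xpredT (eV^~ f)) -(big_mkord xpredT (eV^~ f)).
  rewrite (big_cat_nat (leq0n _) Lq) /= ps_addE opprD addrA subrr add0r.
  rewrite -ps_oppE; suff: Fil w1 (mdeg q).+1 (- \sum_((mdeg q).+1 <= i < L.+1) eV i f).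
    by apply; rewrite -mdegE.
  apply: FilN; rewrite big_nat_cond; apply: Fil_sum => l.
  by rewrite andbT => /andP[ql _]; apply: Fil_le (eVF l).
apply: (@Fil_eq _ _ w1) => L; apply: (@Fil_le _ _ _ L.+1) => //.
apply: (@FilB_trans _ _ _ _ _ (V (\sum_(l < L.+1) dexp l f))).
  by rewrite -VB; apply/VF/(@expD_approx L).
apply/FilB_sym.
apply: (@FilB_trans _ _ _ _ _ (expD (\sum_(l < L.+1) eV l f))).
  by rewrite -(cmB cmor_expD); apply: (cmF cmor_expD) (conj_approx L).
apply: FilB_trans (@expD_approx L _) _.
have dexp_sum k n (F : nat -> ps) :
    dexp k (\sum_(l < n) F l) = \sum_(l < n) dexp k (F l).
  have dexp_0 : dexp k 0 = 0 by rewrite -{1}(subrr 0) dexpB subrr.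
  apply: (big_morph (dexp k)) => // g h.
  by rewrite -[h in LHS]opprK dexpB -[- h]sub0r dexpB dexp_0 sub0r opprK.
under eq_bigr => i _ do rewrite (dexp_sum i _ (eV^~ f)).
rewrite (Vsum _ (dexp^~ f)).
under [X in _ - X]eq_bigr do rewrite V_dexp.
rewrite exchange_big.
apply: (@cauchy_Fil (fun l i => dexp i (eV l f))) => l i.
exact: Fil_dexp.
Qed.

End Conjugation.
End OneOperator.
End Exponential.

(** * Indices in the phase variables *)

Lemma ord2_cases (s : 'I_2) : s = ord0 \/ s = ord_max.
Proof. by case: s => [[|[|]]] // i; [left|right]; apply/val_inj. Qed.

Section PhaseIndices.
Variable m : nat.
Implicit Types (q : mindex (pvar m)) (n : mindex 'I_m).
Implicit Types (b : mindex (option 'I_m)).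

Lemma pvar_ind (P : pvar m -> Prop) :
  P (pz m) -> P (pw m) -> (forall k, P (inr k)) -> forall i, P i.
Proof.
move=> Pz Pw Pmu [s|//]; case: (ord2_cases s) => ->; [exact: Pz|exact: Pw].
Qed.

Lemma zdeg_mi j k n : zdeg (mi j k n) = j. Proof. by rewrite /zdeg ffunE. Qed.
Lemma wdeg_mi j k n : wdeg (mi j k n) = k. Proof. by rewrite /wdeg ffunE. Qed.
Lemma mupart_mi j k n : mupart (mi j k n) = n.
Proof. by apply/ffunP=> i; rewrite !ffunE. Qed.

Definition miE := (zdeg_mi, wdeg_mi, mupart_mi).

Lemma miK q : mi (zdeg q) (wdeg q) (mupart q) = q.
Proof.
by apply/ffunP; elim/pvar_ind => [||k]; rewrite ?ffunE //=; rewrite ffunE.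
Qed.

Lemma mi_ext q q' : zdeg q = zdeg q' -> wdeg q = wdeg q' ->
  mupart q = mupart q' -> q = q'.
Proof. by move=> e1 e2 e3; rewrite -(miK q) e1 e2 e3 miK. Qed.

Lemma zdegD q q' : zdeg (q + q') = (zdeg q + zdeg q')%N.
Proof. by rewrite /zdeg ffunE. Qed.
Lemma wdegD q q' : wdeg (q + q') = (wdeg q + wdeg q')%N.
Proof. by rewrite /wdeg ffunE. Qed.
Lemma mupartD q q' : mupart (q + q') = mupart q + mupart q'.
Proof. by apply/ffunP=> i; rewrite !ffunE. Qed.
Lemma zdeg0 : zdeg (0 : mindex (pvar m)) = 0%N. Proof. by rewrite /zdeg ffunE. Qed.
Lemma wdeg0 : wdeg (0 : mindex (pvar m)) = 0%N. Proof. by rewrite /wdeg ffunE. Qed.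
Lemma mupart0 : mupart (0 : mindex (pvar m)) = 0.
Proof. by apply/ffunP=> i; rewrite !ffunE. Qed.

Lemma zdeg_munit i : zdeg (munit i : mindex (pvar m)) = (i == pz m).
Proof. by rewrite /zdeg ffunE eq_sym. Qed.
Lemma wdeg_munit i : wdeg (munit i : mindex (pvar m)) = (i == pw m).
Proof. by rewrite /wdeg ffunE eq_sym. Qed.
Lemma mupart_munit_inl s : mupart (munit (inl s) : mindex (pvar m)) = 0.
Proof. by apply/ffunP=> i; rewrite !ffunE. Qed.
Lemma mupart_munit_inr k : mupart (munit (inr k) : mindex (pvar m)) = munit k.
Proof. by apply/ffunP=> i; rewrite !ffunE. Qed.

Lemma wt_pvar (w : pvar m -> nat) q :
  wt w q = (w (pz m) * zdeg q + w (pw m) * wdeg q +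
            wt (fun k => w (inr k)) (mupart q))%N.
Proof.
rewrite /wt big_sumType /= !big_ord_recl big_ord0 addn0 /=.
have -> : lift ord0 ord0 = ord_max :> 'I_2 by apply/val_inj.
by congr (_ + _)%N; apply: eq_bigr => k _; rewrite ffunE.
Qed.

Lemma mdeg_pvar q : mdeg q = (zdeg q + wdeg q + mdeg (mupart q))%N.
Proof. by rewrite !mdegE wt_pvar !mul1n. Qed.

Lemma swapzwK : involutive (@swapzw m).
Proof. by move=> q; rewrite /swapzw !miE miK. Qed.

Lemma swapzwD q q' : swapzw (q + q') = swapzw q + swapzw q'.
Proof.
by apply: mi_ext; rewrite ?(zdegD, wdegD, mupartD) !miE ?(zdegD, wdegD, mupartD).
Qed.

Lemma mdeg_swap q : mdeg (swapzw q) = mdeg q.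
Proof. by rewrite !mdeg_pvar !miE [(wdeg q + _)%N]addnC. Qed.

Lemma zdeg_swap q : zdeg (swapzw q) = wdeg q. Proof. exact: zdeg_mi. Qed.
Lemma wdeg_swap q : wdeg (swapzw q) = zdeg q. Proof. exact: wdeg_mi. Qed.
Lemma mupart_swap q : mupart (swapzw q) = mupart q. Proof. exact: mupart_mi. Qed.

Lemma Ldom_swap q : Ldom (swapzw q) = Ldom q.
Proof. by rewrite /Ldom zdeg_swap wdeg_swap mupart_swap [(wdeg q + _)%N]addnC. Qed.

(** Indices of series in rho (the variable [None]) and the parameters. *)
Definition bi (j : nat) n : mindex (option 'I_m) :=
  [ffun i => if i is Some k then n k else j].
Definition bmu (b : mindex (option 'I_m)) : mindex 'I_m := [ffun k => b (Some k)].

Lemma biK b : bi (b None) (bmu b) = b.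
Proof. by apply/ffunP=> -[k|]; rewrite !ffunE. Qed.
Lemma bi_None j n : bi j n None = j. Proof. by rewrite ffunE. Qed.
Lemma bmu_bi j n : bmu (bi j n) = n.
Proof. by apply/ffunP=> k; rewrite !ffunE. Qed.
Lemma biD j n j' n' : bi (j + j') (n + n') = bi j n + bi j' n'.
Proof. by apply/ffunP=> -[k|]; rewrite !ffunE. Qed.
Lemma bmuD b b' : bmu (b + b') = bmu b + bmu b'.
Proof. by apply/ffunP=> k; rewrite !ffunE. Qed.

Lemma wt_bi (w : option 'I_m -> nat) b :
  wt w b = (w None * b None + wt (fun k => w (Some k)) (bmu b))%N.
Proof.
rewrite /wt (bigD1 None) //= (reindex_omap Some id) /=; last by case.
congr (_ + _)%N; apply: eq_big => [k|k _]; last by rewrite ffunE.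
by rewrite eqxx.
Qed.

Lemma mdeg_bi b : mdeg b = (b None + mdeg (bmu b))%N.
Proof. by rewrite !mdegE wt_bi mul1n. Qed.

End PhaseIndices.

(** * Conjugation, rotation and radial series *)

Section PhaseRing.
Variables (R : realType) (m : nat).
Local Notation C := R[i].
Local Notation A := (ps (pvar m) C).
Local Notation B := (ps (option 'I_m) R).
Local Notation Mu := (ps 'I_m R).
Local Notation rc := (real_complex R).
Implicit Types (f g h : A) (q : mindex (pvar m)) (n : mindex 'I_m).

Definition zv : A := psX (pz m).
Definition wv : A := psX (pw m).
Definition muv (k : 'I_m) : A := psX (inr k).
Definition dz : A -> A := pd (pz m).
Definition dw : A -> A := pd (pw m).

Lemma zvE : zv = mon (munit (pz m)). Proof. by []. Qed.
Lemma muvE k : muv k = mon (munit (inr k)). Proof. by []. Qed.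
Lemma psX_pz : psX (pz m) = zv. Proof. by []. Qed.
Lemma psX_pw : psX (pw m) = wv. Proof. by []. Qed.
Lemma psX_inr k : psX (inr k) = muv k. Proof. by []. Qed.
Lemma coef_dz f q : dz f q = (q (pz m)).+1%:R * f (q + munit (pz m)).
Proof. by []. Qed.

Lemma cder_dz : cder id dz. Proof. exact: cder_pd. Qed.
Lemma cder_dw : cder id dw. Proof. exact: cder_pd. Qed.

Lemma dz_z : dz zv = 1. Proof. by rewrite /dz pd_psX eqxx. Qed.
Lemma dz_w : dz wv = 0. Proof. by rewrite /dz pd_psX. Qed.
Lemma dz_mu k : dz (muv k) = 0. Proof. by rewrite /dz pd_psX. Qed.
Lemma dw_z : dw zv = 0. Proof. by rewrite /dw pd_psX. Qed.
Lemma dw_w : dw wv = 1. Proof. by rewrite /dw pd_psX eqxx. Qed.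
Lemma dw_mu k : dw (muv k) = 0. Proof. by rewrite /dw pd_psX. Qed.

(** Complex conjugation of series, w being read as the conjugate of z. *)
Definition Jc f : A := fun q => conjc (f (swapzw q)).

Lemma JcE f q : Jc f q = conjc (f (swapzw q)). Proof. by []. Qed.

Lemma cmor_Jc : cmor (@conjc R) Jc.
Proof.
have Jmon a : Jc (mon a) = mon (swapzw a).
  apply/ps_ext=> q; rewrite /Jc /mon conjc_nat; congr (_%:R).
  by rewrite -(inj_eq (can_inj (@swapzwK m))) swapzwK.
apply: cmor_of_mon => [f g|c f|k f fk q qk||a b].
- by apply/ps_ext=> q; rewrite /Jc !(ps_addE, ps_oppE) rmorphB.
- by apply/ps_ext=> q; rewrite /Jc !coef_psCM rmorphM.
- rewrite /Jc fk ?conjc0 //; rewrite -mdegE in qk.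
  by rewrite -mdegE mdeg_swap.
- rewrite -mon0 Jmon; congr mon.
  by apply: mi_ext; rewrite !miE ?zdeg0 ?wdeg0.
- by rewrite !Jmon swapzwD monD.
Qed.

Lemma JcK : involutive Jc.
Proof. by move=> f; apply/ps_ext=> q; rewrite /Jc swapzwK conjcK. Qed.

Lemma Jc_mon a : Jc (mon a) = mon (swapzw a).
Proof.
apply/ps_ext=> q; rewrite /Jc /mon conjc_nat; congr (_%:R).
by rewrite -(inj_eq (can_inj (@swapzwK m))) swapzwK.
Qed.

Lemma Jc_z : Jc zv = wv.
Proof.
rewrite Jc_mon; congr mon; apply: mi_ext; rewrite !miE;
by rewrite ?zdeg_munit ?wdeg_munit ?mupart_munit_inl.
Qed.
Lemma Jc_w : Jc wv = zv. Proof. by rewrite -Jc_z JcK. Qed.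
Lemma Jc_mu k : Jc (muv k) = muv k.
Proof.
rewrite Jc_mon; congr mon; apply: mi_ext; rewrite !miE;
by rewrite ?zdeg_munit ?wdeg_munit ?mupart_munit_inr.
Qed.

Lemma cder_conjJ (de : A -> A) : cder id de -> cder id (Jc \o de \o Jc).
Proof.
move=> P; split=> [f g|f g|c|k f fk] /=.
- by rewrite (cmB cmor_Jc) (cdB P) (cmB cmor_Jc).
- by rewrite (cmM cmor_Jc) (cdM P) (cmD cmor_Jc) !(cmM cmor_Jc) !JcK.
- by rewrite (cmC cmor_Jc) (cdC P) (cm0 cmor_Jc).
- by apply/(cmF cmor_Jc)/(cdF P)/(cmF cmor_Jc).
Qed.

Lemma Jc_dz f : Jc (dz f) = dw (Jc f).
Proof.
rewrite -{1}(JcK f); apply: (@cder_ext _ _ _ _ _ _ (Jc \o dz \o Jc) dw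
  (cmor_id _ _) (cder_conjJ cder_dz) cder_dw _ (Jc f)).
elim/pvar_ind => [||k] /=.
- by rewrite -/zv Jc_z dz_w (cm0 cmor_Jc) dw_z.
- by rewrite -/wv Jc_w dz_z (cm1 cmor_Jc) dw_w.
- by rewrite -/(muv k) Jc_mu dz_mu (cm0 cmor_Jc) dw_mu.
Qed.

Lemma Jc_dw f : Jc (dw f) = dz (Jc f).
Proof. by rewrite -[RHS]JcK Jc_dz JcK. Qed.

Lemma cmor_mulift : cmor rc (@mulift R m).
Proof.
have muliftB : {morph (@mulift R m : Mu -> A) : f g / f - g}.
  move=> f g; apply/ps_ext=> q; rewrite ps_addE ps_oppE /mulift.
  by case: ifP; rewrite ?subr0 // !(ps_addE, ps_oppE) rmorphB.
have muliftmon a : mulift (mon a : Mu) = mon (mi 0 0 a) :> A.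
  apply/ps_ext=> q; rewrite /mulift /mon.
  have [->|nq] := eqVneq q (mi 0 0 a); first by rewrite !miE !eqxx.
  case: andP => // -[/eqP qz /eqP qw]; case: eqP => [qa|_]; last exact: rmorph0.
  by case/eqP: nq; apply: mi_ext; rewrite !miE.
apply: cmor_of_mon => [//|c f|k f fk q qk||a b].
- apply/ps_ext=> q; rewrite /mulift !coef_psCM.
  by case: ifP; rewrite ?mulr0 // ?coef_psCM rmorphM.
- rewrite /mulift; case: andP => // -[/eqP qz /eqP qw].
  rewrite fk ?rmorph0 //; move: qk; rewrite -!mdegE mdeg_pvar; lia.
- rewrite -[1 in LHS]mon0 muliftmon -mon0; congr mon.
  by apply: mi_ext; rewrite !miE ?zdeg0 ?wdeg0 ?mupart0.
- rewrite !muliftmon -monD; congr mon.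
  by apply: mi_ext; rewrite ?(zdegD, wdegD, mupartD) !miE.
Qed.

Lemma mulift_psX k : mulift (psX k : Mu) = muv k.
Proof.
apply/ps_ext=> q; rewrite /mulift /muv /psX /mon.
have [->|nq] := eqVneq q _.
  by rewrite zdeg_munit wdeg_munit mupart_munit_inr !eqxx.
case: andP => // -[/eqP qz /eqP qw]; case: eqP => [qa|_]; last exact: rmorph0.
case/eqP: nq; apply: mi_ext; rewrite ?zdeg_munit ?wdeg_munit //.
by rewrite mupart_munit_inr.
Qed.

Lemma Jc_mulift (u : Mu) : Jc (mulift u) = mulift u.
Proof.
apply/ps_ext=> q; rewrite /Jc /mulift zdeg_swap wdeg_swap mupart_swap andbC.
by case: ifP; rewrite ?conjc0 ?conjc_real.
Qed.

Lemma dz_mulift (u : Mu) : dz (mulift u) = 0.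
Proof.
apply/ps_ext=> q; rewrite /dz /pd /fpsD /mulift.
by rewrite -!/(zdeg _) zdegD zdeg_munit eqxx addn1 /=; apply: mulr0.
Qed.

(** The substitution of z w for rho in a real series. *)
Definition rlift (u : B) : A := fun q =>
  if zdeg q == wdeg q then (u (bi (zdeg q) (mupart q)))%:C%C else 0.

Definition rho : A := zv * wv.

Lemma rhoE : rho = zv * wv. Proof. by []. Qed.

Lemma rlift_mon a : rlift (mon a) = mon (mi (a None) (a None) (bmu a)).
Proof.
apply/ps_ext=> q; rewrite /rlift /mon.
have [->|nq] := eqVneq q (mi _ _ _).
  by rewrite !miE eqxx biK eqxx rmorph1.
case: eqP => // qz; case: eqP => [qa|_]; last exact: rmorph0.
by case/eqP: nq; rewrite -qa bi_None bmu_bi; apply: mi_ext; rewrite !miE.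
Qed.

Lemma cmor_rlift : cmor rc rlift.
Proof.
apply: cmor_of_mon => [f g|c f|k f fk q qk||a b].
- apply/ps_ext=> q; rewrite ps_addE ps_oppE /rlift.
  by case: ifP; rewrite ?subr0 // !(ps_addE, ps_oppE) rmorphB.
- apply/ps_ext=> q; rewrite /rlift !coef_psCM.
  by case: ifP; rewrite ?mulr0 // ?coef_psCM rmorphM.
- rewrite /rlift; case: eqP => // qz; rewrite fk ?rmorph0 //.
  by move: qk; rewrite -!mdegE mdeg_pvar mdeg_bi bi_None bmu_bi; lia.
- rewrite -[1 in LHS]mon0 rlift_mon -mon0; congr mon.
  apply: mi_ext; rewrite !miE ?zdeg0 ?wdeg0 ?mupart0 ?ffunE //.
  by apply/ffunP=> k; rewrite !ffunE.
- rewrite !rlift_mon -monD; congr mon.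
  by apply: mi_ext; rewrite ?(zdegD, wdegD, mupartD) !miE ?ffunE ?bmuD.
Qed.

Lemma rlift_rho : rlift (psX None) = rho.
Proof.
rewrite rlift_mon /rho -monD; congr mon.
apply: mi_ext; rewrite ?(zdegD, wdegD, mupartD) !miE ?ffunE;
  rewrite ?zdeg_munit ?wdeg_munit ?mupart_munit_inl //.
by apply/ffunP=> k; rewrite !ffunE.
Qed.

Lemma Jc_rlift u : Jc (rlift u) = rlift u.
Proof.
apply/ps_ext=> q; rewrite /Jc /rlift zdeg_swap wdeg_swap mupart_swap eq_sym.
by case: eqP => [->|]; rewrite ?conjc0 ?conjc_real.
Qed.

Lemma coef_rlift u j n : rlift u (mi j j n) = (u (bi j n))%:C%C.
Proof. by rewrite /rlift !miE eqxx. Qed.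

Lemma rlift_inj : injective rlift.
Proof.
move=> u u' e; apply/ps_ext=> b; rewrite -(biK b).
by apply: (@complexI R); rewrite -!coef_rlift e.
Qed.

Definition radial f := forall q, zdeg q != wdeg q -> f q = 0.

Lemma radial_rlift u : radial (rlift u).
Proof. by move=> q /negPf; rewrite /rlift => ->. Qed.

Lemma Re_fixed (x : C) : conjc x = x -> (complex.Re x)%:C%C = x.
Proof.
case: x => a b /= /eqP; rewrite eq_complex /= eqxx /= => /eqP bb.
have b0 : b = 0.
  have /eqP : b + b = 0 by rewrite -{1}bb addNr.
  by rewrite -mulr2n mulrn_eq0 => /eqP.
by rewrite b0.
Qed.

(** Rotation invariance leaves the monomials (z w)^j mu^n, and invariance under
    conjugation makes their coefficients real. *)
Lemma rlift_surj f : radial f -> Jc f = f -> exists u, f = rlift u.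
Proof.
move=> rf Jf.
exists (fun b : mindex (option 'I_m) => complex.Re (f (mi (b None) (b None) (bmu b)))).
apply/ps_ext=> q; rewrite /rlift; case: eqP => [qz|/eqP/rf//].
rewrite bi_None bmu_bi; have -> : mi (zdeg q) (zdeg q) (mupart q) = q.
  by rewrite {2}qz miK.
apply/esym/Re_fixed; rewrite -{2}Jf /Jc; congr (conjc (f _)).
by apply: mi_ext; rewrite ?zdeg_swap ?wdeg_swap ?mupart_swap.
Qed.

Lemma coef_zdz f q : (zv * dz f) q = (zdeg q)%:R * f q.
Proof. exact: pd_psX_mul. Qed.
Lemma coef_wdw f q : (wv * dw f) q = (wdeg q)%:R * f q.
Proof. exact: pd_psX_mul. Qed.

Opaque zv wv muv dz dw.

(** The derivation z d/dz - w d/dw, which is the infinitesimal rotation up to the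
    factor i.  A monomial is an eigenvector whose eigenvalue is the difference of
    its degrees in z and w. *)
Definition rotd f : A := zv * dz f - wv * dw f.

Lemma coef_rotd f q : rotd f q = ((zdeg q)%:R - (wdeg q)%:R) * f q.
Proof. by rewrite /rotd ps_addE ps_oppE coef_zdz coef_wdw mulrBl. Qed.

Lemma cder_rotd : cder id rotd.
Proof. exact: cder_sub (cder_mul _ cder_dz) (cder_mul _ cder_dw). Qed.

Lemma rotdE f : rotd f = zv * dz f - wv * dw f. Proof. by []. Qed.

Lemma rotd_z : rotd zv = zv.
Proof. by rewrite rotdE dz_z dw_z mulr0 subr0 mulr1. Qed.
Lemma rotd_w : rotd wv = - wv.
Proof. by rewrite rotdE dz_w dw_w mulr0 mulr1 sub0r. Qed.
Lemma rotd_mu k : rotd (muv k) = 0.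
Proof. by rewrite rotdE dz_mu dw_mu !mulr0 subrr. Qed.

Lemma Jc_rotd f : Jc (rotd f) = - rotd (Jc f).
Proof. by rewrite !rotdE (cmB cmor_Jc) !(cmM cmor_Jc) Jc_z Jc_w Jc_dz Jc_dw opprB. Qed.

Lemma rotd_eig_coef f (c : C) q : rotd f = psC c * f ->
  (zdeg q)%:R - (wdeg q)%:R != c -> f q = 0.
Proof.
move=> e nc; have := congr1 (fun h : A => h q) e.
rewrite coef_rotd coef_psCM => /eqP; rewrite -subr_eq0 -mulrBl mulf_eq0.
by rewrite subr_eq0 (negPf nc) => /eqP.
Qed.

Lemma radialP f : radial f <-> rotd f = 0.
Proof.
split=> [rf|rf q qn].
  apply/ps_ext=> q; rewrite coef_rotd; have [->|/rf->] := eqVneq (zdeg q) (wdeg q).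
    by rewrite subrr mul0r.
  by rewrite mulr0.
apply: (@rotd_eig_coef _ 0); first by rewrite rf rmorph0 mul0r.
by rewrite subr_eq0 eqr_nat.
Qed.

(** Chain rule for rho = z w. *)
Lemma zdz_rlift u : zv * dz (rlift u) = rlift (psX None * pd None u).
Proof.
apply/ps_ext=> q; rewrite coef_zdz /rlift.
case: eqP => qz; last by rewrite mulr0.
by rewrite pd_psX_mul bi_None rmorphM rmorph_nat.
Qed.

Lemma wdw_rlift u : wv * dw (rlift u) = rlift (psX None * pd None u).
Proof.
rewrite -zdz_rlift; apply/ps_ext=> q.
rewrite coef_zdz coef_wdw.
have [->//|/radial_rlift->] := eqVneq (zdeg q) (wdeg q).
by rewrite !mulr0.
Qed.

(** Eigenvalue 1 forces one more factor z than w in each monomial. *)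
Lemma rotd_eig1 f : rotd f = f -> exists2 h, f = zv * h & radial h.
Proof.
move=> e; exists (fun q => f (munit (pz m) + q)) => [|q qn].
  apply/ps_ext=> q; rewrite coef_monM leqm_munit; case: ifP => qz.
    by rewrite submK // leqm_munit.
  apply: (@rotd_eig_coef _ 1); first by rewrite rmorph1 mul1r.
  have -> : zdeg q = 0%N by apply/eqP; rewrite eqn0Ngt; apply/negbT.
  rewrite -subr_eq0 sub0r -opprD oppr_eq0 -[1]/(1%:R) -natrD pnatr_eq0; lia.
apply: (@rotd_eig_coef _ 1); first by rewrite rmorph1 mul1r.
rewrite zdegD wdegD zdeg_munit wdeg_munit /= natrD [1%:R + _]addrC -addrA.
by rewrite add0n addrCA -subr_eq0 [1%:R + _]addrC addrK subr_eq0 eqr_nat.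
Qed.

Transparent zv wv muv dz dw.

Lemma gen_ind (Q : A -> Prop) :
  Q zv -> Q wv -> (forall k, Q (muv k)) -> forall i, Q (psX i).
Proof. move=> Qz Qw Qm; elim/pvar_ind; [exact: Qz | exact: Qw | exact: Qm]. Qed.

Lemma Fil_zv : Fil w1 1 zv. Proof. exact: Fil_psX. Qed.
Lemma Fil_wv : Fil w1 1 wv. Proof. exact: Fil_psX. Qed.
Lemma zv_lreg : injective (fun f : A => zv * f). Proof. exact: psX_lreg. Qed.
Lemma wv_lreg : injective (fun f : A => wv * f). Proof. exact: psX_lreg. Qed.

End PhaseRing.

Global Opaque zv wv muv dz dw.

(** * Vector fields and their flows *)

Section VectorFields.
Variables (R : realType) (m : nat).
Local Notation C := R[i].
Local Notation A := (ps (pvar m) C).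
Local Notation vf := (vfield R m).
Local Notation zv := (@zv R m).
Local Notation wv := (@wv R m).
Local Notation muv := (@muv R m).
Local Notation dz := (@dz R m).
Local Notation dw := (@dw R m).
Implicit Types (f g h : A) (q : mindex (pvar m)) (u v S : vf).

Definition vz v : A := v ord0.
Definition vw v : A := v ord_max.

Lemma vf_ext u v : vz u = vz v -> vw u = vw v -> u = v.
Proof. by move=> e1 e2; apply/funext=> c; case: (ord2_cases c) => ->. Qed.

(** The derivation along a field.  The components of a field are recovered as its
    values at z and w, so identities between fields are identities between
    derivations. *)
Definition Dv v f : A := vz v * dz f + vw v * dw f.

Lemma cder_Dv v : cder id (Dv v).
Proof. exact: cder_add (cder_mul _ (cder_dz R m)) (cder_mul _ (cder_dw R m)). Qed.

Lemma Dv_z v : Dv v zv = vz v.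
Proof. by rewrite /Dv dz_z dw_z mulr1 mulr0 addr0. Qed.
Lemma Dv_w v : Dv v wv = vw v.
Proof. by rewrite /Dv dz_w dw_w mulr1 mulr0 add0r. Qed.
Lemma Dv_mu v k : Dv v (muv k) = 0.
Proof. by rewrite /Dv dz_mu dw_mu !mulr0 addr0. Qed.

Definition FilV k v := Fil w1 k (vz v) /\ Fil w1 k (vw v).

Lemma Dv_Fil d v k f : FilV d.+1 v -> Fil w1 k f -> Fil w1 (k + d) (Dv v f).
Proof.
move=> [v0 v1]; apply: (cder_raise (cmor_id _ _) (cder_Dv v)).
apply: (gen_ind (Q := fun x => Fil w1 d.+1 (Dv v x))) => [||j];
  by rewrite ?Dv_z ?Dv_w ?Dv_mu.
Qed.

Lemma bracketE u v c :
  bracket u v c = Dv v (u c : A) - Dv u (v c : A) :> A.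
Proof.
rewrite /bracket !big_ord_recl big_ord0 addr0.
have -> : lift ord0 ord0 = ord_max :> 'I_2 by apply/val_inj.
transitivity ((dz (u c) * vz v - dz (v c) * vz u) +
  (dw (u c) * vw v - dw (v c) * vw u)); first by [].
have aux (a b c' d a1 b1 c1 d1 : A) :
    a * c' - b * d + (a1 * c1 - b1 * d1) = c' * a + c1 * a1 - (d * b + d1 * b1).
  by ring.
exact: aux.
Qed.

(** With the sign convention u'v - v'u, the bracket goes to the commutator in the
    opposite order. *)
Lemma Dv_bracket u v f : FilV 1 u -> FilV 1 v ->
  Dv (bracket u v) f = Dv v (Dv u f) - Dv u (Dv v f).
Proof.
move=> u1 v1; have P := cder_Dv v; have Q := cder_Dv u.
have comm : cder id (fun f => Dv v (Dv u f) - Dv u (Dv v f)).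
  split=> [g h|g h|c|k g gk].
  - by rewrite (cdB Q g h) (cdB P g h) (cdB P (Dv u g)) (cdB Q (Dv v g)); ring.
  - rewrite (cdM P g h) (cdM Q g h) (cdD P (Dv u g * h)) (cdD Q (Dv v g * h)).
    rewrite (cdM P (Dv u g) h) (cdM P g (Dv u h)) (cdM Q (Dv v g) h).
    by rewrite (cdM Q g (Dv v h)); ring.
  - by rewrite (cdC P) (cdC Q) (cd0 P) (cd0 Q) subrr.
  - have FP w k' g' : FilV 1 w -> Fil w1 k' g' -> Fil w1 k' (Dv w g').
      by move=> w1 /(Dv_Fil w1); rewrite addn0.
    by apply: FilB; apply: (cdF (cder_Dv _)); apply: FP.
apply: (cder_ext (cmor_id _ _) (cder_Dv _) comm).
apply: (gen_ind (Q := fun x =>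
  Dv (bracket u v) x = Dv v (Dv u x) - Dv u (Dv v x))) => [||j];
  rewrite ?Dv_z ?Dv_w ?Dv_mu.
- exact: bracketE.
- exact: bracketE.
- by rewrite (cd0 P) (cd0 Q) subrr.
Qed.

Lemma FilV_bracket d k u v : FilV d.+1 u -> FilV k.+1 v ->
  FilV (d + k).+1 (bracket u v).
Proof.
move=> du kv; suff H c : Fil w1 (d + k).+1 (bracket u v c : A) by split; apply: H.
rewrite bracketE; have [u0 u1] := du; have [v0 v1] := kv.
have uc : Fil w1 d.+1 (u c : A) by case: (ord2_cases c) => ->.
have vc : Fil w1 k.+1 (v c : A) by case: (ord2_cases c) => ->.
apply: FilB; first by rewrite -addSn; apply: Dv_Fil.
by rewrite addnC -addSn; apply: Dv_Fil.
Qed.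

Section Flow.
Variables S v : vf.
Hypotheses (S2 : FilV 2 S) (v1 : FilV 1 v).

(** Composition with the time-one flow of S. *)
Definition flow : A -> A := expD (Dv S).

Lemma DvS_up k f : Fil w1 k f -> Fil w1 k.+1 (Dv S f).
Proof. by move=> fk; have := Dv_Fil S2 fk; rewrite addn1. Qed.

Lemma cmor_flow : cmor idfun flow.
Proof. exact: cmor_expD (cder_Dv S) DvS_up. Qed.

Lemma FilV_iter l : FilV l.+1 (iter l (bracket S) v).
Proof. by elim: l => //= l IH; exact: (FilV_bracket S2 IH). Qed.

Lemma adV_iter l f : adV (Dv S) (Dv v) l f = Dv (iter l (bracket S) v) f.
Proof.
elim: l f => //= l IH f; rewrite !IH Dv_bracket //.
  by split; apply: (@Fil_le _ _ _ 2) => //; case: S2.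
by split; apply: (@Fil_le _ _ _ l.+1) => //; case: (FilV_iter l).
Qed.

Lemma conjV_comp c (x : A) : (forall w, Dv w x = w c :> A) ->
  conjV (Dv S) (Dv v) x = phiS S v c.
Proof.
move=> xE; apply/ps_ext=> q; rewrite /conjV /phiS ps_sumE; apply: eq_bigr => l _.
by rewrite /eV coef_psCM adV_iter xE.
Qed.

(** exp (ad S) is conjugation by the flow: the components of [phiS S v] are the
    values of exp (- S) v exp S at the coordinate functions. *)
Lemma phiS_gen c (x : A) : (forall w, Dv w x = w c :> A) ->
  Dv v (flow x) = flow (phiS S v c).
Proof.
move=> xE; rewrite -(conjV_comp xE); apply: V_expD.
- exact: cder_Dv.
- exact: DvS_up.
- exact: cdB (cder_Dv v).
- by move=> a f; rewrite (cdZ (cmor_id _ _) (cder_Dv v)).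
- by move=> k f fk; have := Dv_Fil v1 fk; rewrite addn0.
Qed.

Lemma flow_mu k : flow (muv k) = muv k.
Proof.
apply/ps_ext=> q; rewrite /flow /expD big_ord_recl dexp0 big1 ?addr0 // => i _.
rewrite /dexp iterSr Dv_mu; have -> : iter i (Dv S) 0 = 0.
  by elim: (nat_of_ord i) => //= j ->; rewrite (cd0 (cder_Dv S)).
exact: mulr0.
Qed.

Lemma Dv_flow f : Dv v (flow f) = flow (Dv (phiS S v) f).
Proof.
have PF := cmor_flow.
apply: (@cder_ext _ _ _ _ _ flow (Dv v \o flow) (flow \o Dv (phiS S v)) PF).
- exact: (cder_precomp PF (cder_Dv v)).
- exact: (cder_postcomp (cder_Dv _) PF).
apply: (gen_ind (Q := fun x =>
  Dv v (flow x) = flow (Dv (phiS S v) x))) => [||j]; rewrite ?Dv_z ?Dv_w ?Dv_mu.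
- by apply: phiS_gen => w; apply: Dv_z.
- by apply: phiS_gen => w; apply: Dv_w.
- by rewrite flow_mu Dv_mu (cm0 PF).
Qed.

Lemma flow_gen2 (x : A) : Fil w1 2 (Dv S x) -> Fil w1 2 (flow x - x).
Proof.
move=> D2; apply: (FilB_trans (Fil_le _ (@expD_approx _ _ _ DvS_up 1 x))) => //.
rewrite !big_ord_recl big_ord0 dexp0 addr0 addrC addKr.
exact: FilMl.
Qed.

Lemma flow_z2 : Fil w1 2 (flow zv - zv).
Proof. by apply: flow_gen2; rewrite Dv_z; case: S2. Qed.

Lemma flow_w2 : Fil w1 2 (flow wv - wv).
Proof. by apply: flow_gen2; rewrite Dv_w; case: S2. Qed.

Lemma flow_psX2 i : Fil w1 2 (flow (psX i) - psX i).
Proof.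
move: i; apply: (gen_ind (Q := fun x => Fil w1 2 (flow x - x))) => [||k].
- exact: flow_z2.
- exact: flow_w2.
by rewrite flow_mu subrr; apply: Fil0.
Qed.

End Flow.
End VectorFields.

(** * The state space *)

Section StateSpace.
Variables (R : realType) (m : nat).
Local Notation C := R[i].
Local Notation A := (ps (pvar m) C).
Local Notation vf := (vfield R m).
Local Notation zv := (@zv R m).
Local Notation wv := (@wv R m).
Local Notation Jc := (@Jc R m).
Implicit Types (f g h : A) (q : mindex (pvar m)) (u v S : vf).

(** Fields with real coefficients in the basis of the X and Y. *)
Definition symm v := vw v = Jc (vz v).

Lemma fsXz (P : pred (mindex (pvar m))) x q :
  vz (formal_sum P x (@Xq R m)) q = if P q then (x q)%:C%C else 0.
Proof.
rewrite /vz /formal_sum /Xq /=; case Pq: (P q); last first.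
  rewrite big1 // => p Pp; case: eqP => [e|]; last by rewrite mulr0.
  by rewrite -e Pq in Pp.
rewrite big_mkcond (bigD1_seq q) ?uniq_mindices ?mem_mindices //=.
rewrite Pq eqxx mulr1 big1 ?addr0 // => p /negPf pq.
by rewrite eq_sym pq mulr0 if_same.
Qed.

Lemma fsYz (P : pred (mindex (pvar m))) x q :
  vz (formal_sum P x (@Yq R m)) q = if P q then 'i%C * (x q)%:C%C else 0.
Proof.
rewrite /vz /formal_sum /Yq /=; case Pq: (P q); last first.
  rewrite big1 // => p Pp; case: eqP => [e|]; last by rewrite !mulr0.
  by rewrite -e Pq in Pp.
rewrite big_mkcond (bigD1_seq q) ?uniq_mindices ?mem_mindices //=.
rewrite Pq eqxx mulr1 mulrC big1 ?addr0 // => p /negPf pq.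
by rewrite eq_sym pq !mulr0 if_same.
Qed.

Lemma symm_Xq q : symm (@Xq R m q).
Proof.
apply/ps_ext=> p; rewrite /vw /vz /Xq !JcE /= conjc_nat; congr (_%:R).
by rewrite (can2_eq (@swapzwK m) (@swapzwK m)).
Qed.

Lemma conjc_Mnat (x : C) (k : nat) : conjc (x * k%:R) = conjc x * k%:R.
Proof. by rewrite rmorphM /= conjc_nat. Qed.

Lemma conjcRM (a : R) (x : C) : conjc (a%:C%C * x) = a%:C%C * conjc x.
Proof. by rewrite rmorphM; congr (_ * _); apply: conjc_real. Qed.

Lemma conj_i : conjc ('i%C : C) = - 'i%C.
Proof. by apply/eqP; rewrite eq_complex /= oppr0 !eqxx. Qed.

Lemma symm_Yq q : symm (@Yq R m q).
Proof.
apply/ps_ext=> p; rewrite /vw /vz /Yq !JcE [ord_max == _]/= conjc_Mnat conj_i.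
by congr (_ * _%:R); rewrite (can2_eq (@swapzwK m) (@swapzwK m)).
Qed.

Lemma symm_fs (P : pred (mindex (pvar m))) x (Bq : mindex (pvar m) -> vf) :
  (forall q, symm (Bq q)) -> symm (formal_sum P x Bq).
Proof.
move=> Bs; apply/ps_ext=> p; rewrite /vw /vz /formal_sum !JcE rmorph_sum mdeg_swap.
apply: eq_bigr => q _; rewrite [RHS]conjcRM; congr (_ * _).
by have := congr1 (fun f : A => f p) (Bs q); rewrite /vw /vz !JcE.
Qed.

Lemma symmD u v : symm u -> symm v -> symm (u + v).
Proof.
move=> us vs; rewrite /symm /vz /vw -[(u + v) ord0]/(vz u + vz v).
by rewrite (cmD (cmor_Jc R m)) -us -vs.
Qed.

Lemma symmZ (a : R) v : symm v -> symm (a%:C%C *: v).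
Proof.
move=> vs; rewrite /symm; apply/ps_ext=> q.
rewrite -[RHS]/(conjc (a%:C%C * vz v (swapzw q))) conjcRM.
by have := congr1 (fun f : A => a%:C%C * f q) vs.
Qed.

Lemma mi100 : mi 1 0 0 = munit (pz m).
Proof. by apply: mi_ext; rewrite !miE ?zdeg_munit ?wdeg_munit ?mupart_munit_inl. Qed.

Lemma Ldom_mi100 : Ldom (mi 1 0 0 : mindex (pvar m)) = false.
Proof. by rewrite /Ldom !miE mdegE wt0. Qed.

(** Membership in the state space, read off the z-component: the w-component is
    determined by it, and X and Y coefficients are real and imaginary parts. *)
Lemma inL_form v : inL v -> [/\ symm v,
  forall q, ~~ Ldom q -> q != mi 1 0 0 -> vz v q = 0
  & complex.Re (vz v (mi 1 0 0)) = 0].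
Proof.
move=> [a [x [y ->]]].
have E q : vz (a%:C%C *: Yjk R 1 0 0 + formal_sum (@Ldom m) x (@Xq R m) +
   formal_sum (@Ldom m) y (@Yq R m)) q =
   a%:C%C * ('i%C * (q == mi 1 0 0)%:R) +
   (if Ldom q then (x q)%:C%C else 0) + (if Ldom q then 'i%C * (y q)%:C%C else 0).
  by rewrite -fsXz -fsYz.
split.
- apply: symmD; last exact: symm_fs symm_Yq.
  by apply: symmD; [apply/symmZ/symm_Yq | apply: symm_fs symm_Xq].
- by move=> q nq /negPf nq'; rewrite E nq' (negPf nq) !mulr0 !addr0.
- by rewrite E Ldom_mi100 eqxx !addr0 mulr1 /= !mul0r mulr0 subr0.
Qed.

Lemma inL_intro v : symm v ->
  (forall q, ~~ Ldom q -> q != mi 1 0 0 -> vz v q = 0) ->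
  complex.Re (vz v (mi 1 0 0)) = 0 -> inL v.
Proof.
move=> vs v0 v1; pose a := complex.Im (vz v (mi 1 0 0)).
pose x q := complex.Re (vz v q); pose y q := complex.Im (vz v q).
exists a, x, y; set u := _ + _.
have us : symm u.
  apply: symmD; last exact: symm_fs symm_Yq.
  by apply: symmD; [apply/symmZ/symm_Yq | apply: symm_fs symm_Xq].
suff uv : vz v = vz u by apply: vf_ext => //; rewrite vs us uv.
apply/ps_ext=> q; have -> : vz u q = a%:C%C * ('i%C * (q == mi 1 0 0)%:R) +
   (if Ldom q then (x q)%:C%C else 0) + (if Ldom q then 'i%C * (y q)%:C%C else 0).
  by rewrite -fsXz -fsYz.
have [->|nq] := eqVneq q (mi 1 0 0).
  rewrite Ldom_mi100 !addr0 mulr1 [vz v _]complexE v1 add0r.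
  by rewrite mulrC.
rewrite !mulr0 add0r; case: ifP => Lq; last by rewrite addr0 v0 ?Lq.
by rewrite -complexE.
Qed.

Definition wzw : pvar m -> nat := fun i => if i is inl _ then 1%N else 0%N.

Lemma wt_wzw q : wt wzw q = (zdeg q + wdeg q)%N.
Proof.
rewrite wt_pvar /= !mul1n -[RHS]addn0; congr (_ + _)%N.
by rewrite /wt big1 // => k _; rewrite mul0n.
Qed.

Lemma Ldom_supp f :
  (forall q, ~~ Ldom q -> f q = 0) <-> Fil w1 2 f /\ Fil wzw 1 f.
Proof.
split=> [H|[f2 f1] q].
  split=> q; rewrite -?mdegE ?mdeg_pvar ?wt_wzw => qk; apply: H; rewrite /Ldom; lia.
rewrite negb_and -!ltnNge => /orP[] Hq; first by rewrite f1 // wt_wzw.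
by rewrite f2 // -mdegE mdeg_pvar.
Qed.

Section Grade.
Variable alpha : nat.
Hypothesis alpha_gt0 : (0 < alpha)%N.

Lemma Ldom_grade q : Ldom q -> (1 <= gradeL alpha q)%N.
Proof.
rewrite /Ldom /gradeL => /andP[q1 q2].
case: (posnP (mdeg (mupart q))) => [mu0|mu1].
  by rewrite mu0 in q2 *; lia.
have : (0 < alpha * mdeg (mupart q))%N by rewrite muln_gt0 alpha_gt0.
lia.
Qed.

Lemma FL1_form S : FL alpha 1 S -> symm S /\ (forall q, ~~ Ldom q -> vz S q = 0).
Proof.
move=> [/inL_form[Ss S0 _] Sg]; split=> // q nq.
have [->|] := eqVneq q (mi 1 0 0); last exact: S0.
by apply: Sg; rewrite /gradeL !miE mdegE wt0 muln0.
Qed.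

Lemma FL1_intro S : symm S -> (forall q, ~~ Ldom q -> vz S q = 0) -> FL alpha 1 S.
Proof.
move=> Ss S0; split.
  apply: inL_intro => // [q nq _|]; first exact: S0.
  by rewrite S0 // Ldom_mi100.
move=> c q qg; have nq : ~~ Ldom q by apply/negP => /Ldom_grade; lia.
case: (ord2_cases c) => ->; first exact: S0.
rewrite -/(vw S q) Ss !JcE S0 ?conjc0 //; by rewrite Ldom_swap.
Qed.

Lemma FL1_FilV S : FL alpha 1 S -> FilV 2 S.
Proof.
move=> /FL1_form[Ss S0]; have [S2 _] := (Ldom_supp (vz S)).1 S0.
by split=> //; rewrite Ss; apply: (cmF (cmor_Jc R m)).
Qed.

End Grade.

Lemma Dv_Jc v f : symm v -> Jc (Dv v f) = Dv v (Jc f).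
Proof.
move=> vs; rewrite /Dv (cmD (cmor_Jc R m)) (cmM (cmor_Jc R m) (vz v)).
rewrite (cmM (cmor_Jc R m) (vw v)) Jc_dz Jc_dw -vs.
have -> : Jc (vw v) = vz v by rewrite vs JcK.
exact: addrC.
Qed.

Lemma symm_bracket u v : symm u -> symm v -> symm (bracket u v).
Proof.
move=> us vs; rewrite /symm /vw /vz !bracketE (cmB (cmor_Jc R m)) !Dv_Jc //.
by rewrite -[u ord_max]/(vw u) -[v ord_max]/(vw v) us vs.
Qed.

Lemma flow_Jc S f : symm S -> Jc (flow S f) = flow S (Jc f).
Proof.
move=> Ss; apply/ps_ext=> q; rewrite !JcE /flow /expD mdeg_swap !ps_sumE rmorph_sum.
apply: eq_bigr => l _; rewrite /dexp !coef_psCM rmorphM; congr (_ * _).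
  by rewrite fmorphV rmorph_nat.
rewrite -[LHS]/(Jc (iter l (Dv S) f) q); congr (_ q).
by elim: (nat_of_ord l) => //= k <-; rewrite Dv_Jc.
Qed.

(** An arbitrary series, made into a field of the state space by dropping the
    terms that do not belong there.  The unknown of the next fixed point problem
    is then an unconstrained series. *)
Definition maskS (s : A) : A := fun q => if Ldom q then s q else 0.
Definition mkS (s : A) : vf := fun c => if c == ord0 then maskS s else Jc (maskS s).

Lemma mkS_Ldom s q : ~~ Ldom q -> vz (mkS s) q = 0.
Proof. by rewrite /vz /mkS /= /maskS => /negPf->. Qed.

Lemma mkS_FilV s : FilV 2 (mkS s).
Proof. by apply: (@FL1_FilV 1) => //; apply: FL1_intro => //; apply: mkS_Ldom. Qed.

(** Every power of S beyond the first acts with a delay: altering S from degree k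
    on alters S^(l+1) z from degree k + l on. *)
Lemma iter_Dv_cong k s s' l : (forall q, (mdeg q < k)%N -> s q = s' q) ->
  Fil w1 (maxn k 2 + l)
    (iter l.+1 (Dv (mkS s)) zv - iter l.+1 (Dv (mkS s')) zv).
Proof.
move=> ss; set K := maxn k 2.
have KS : FilV K (mkS s - mkS s').
  have Kz : Fil w1 K (maskS s - maskS s').
    move=> q; rewrite -mdegE leq_max => /orP[qk|q2].
      by rewrite ps_addE ps_oppE /maskS ss // subrr.
    rewrite ps_addE ps_oppE /maskS; have -> : Ldom q = false.
      by move: q2; rewrite mdeg_pvar /Ldom; lia.
    by rewrite subrr.
  split; first exact: Kz.
  have -> : vw (mkS s - mkS s') = Jc (maskS s - maskS s').
    by rewrite (cmB (cmor_Jc R m)).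
  exact: (cmF (cmor_Jc R m)).
have DS f : Dv (mkS s) f - Dv (mkS s') f = Dv (mkS s - mkS s') f.
  rewrite /Dv -[vz (_ - _)]/(vz (mkS s) - vz (mkS s')).
  by rewrite -[vw (_ - _)]/(vw (mkS s) - vw (mkS s')); ring.
have K0 : K = K.-1.+1 by rewrite prednK // leq_max orbT.
elim: l => [|l IH] /=; first by rewrite !Dv_z addn0; case: KS.
set x := Dv _ (iter l _ _) in IH *; set y := Dv _ (iter l _ zv) in IH *.
have -> : Dv (mkS s) x - Dv (mkS s') y =
    Dv (mkS s - mkS s') x + Dv (mkS s') (x - y).
  by rewrite -DS (cdB (cder_Dv (mkS s'))); ring.
have xF : Fil w1 l.+2 x.
  have itF j : Fil w1 j.+1 (iter j (Dv (mkS s)) zv).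
    elim: j => [|j]; first exact: Fil_zv.
    by move=> /(DvS_up (mkS_FilV s)).
  exact: (itF l.+1).
apply: FilD; last by rewrite addnS; apply: DvS_up => //; apply: mkS_FilV.
rewrite K0 in KS; apply: Fil_le (Dv_Fil KS xF); rewrite {1}K0; lia.
Qed.

Lemma flow_split S q : FilV 2 S ->
  flow S zv q = zv q + vz S q +
    (\sum_(l < mdeg q) psC ((l.+2)`!%:R)^-1 * iter l.+2 (Dv S) zv : A) q.
Proof.
move=> S2.
have := @expD_approx _ _ _ (DvS_up S2) (mdeg q).+1 zv q.
rewrite -mdegE => /(_ (leqnSn _)); rewrite ps_addE ps_oppE => /eqP.
rewrite subr_eq0 /flow => /eqP ->; rewrite !big_ord_recl dexp0.
rewrite !ps_addE addrA; congr (_ + _ q + _).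
transitivity (dexp (Dv S) 1 zv); first by [].
by rewrite /dexp (_ : 1`! = 1)%N // invr1 rmorph1 mul1r /= Dv_z.
Qed.

(** Changes of variables tangent to the identity and preserving z = w = 0 are
    time-one flows.  As exp S z = z + S z + higher powers, the z-component of S solves the fixed point
    equation s = Phi - exp S z + s, a contraction by [iter_Dv_cong]. *)
Lemma flow_log (Phi : A) : (forall q, ~~ Ldom q -> (Phi - zv) q = 0) ->
  exists S, [/\ symm S, forall q, ~~ Ldom q -> vz S q = 0,
    flow S zv = Phi & flow S wv = Jc Phi].
Proof.
move=> PhiL.
have [k s s' ss q qk|s sE] := @contraction_fixpoint _ C 0 (@mdeg (pvar m))
  (fun s q => (Phi - flow (mkS s) zv + vz (mkS s)) q).
  rewrite !(ps_addE, ps_oppE) !flow_split; try exact: mkS_FilV.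
  have -> : (\sum_(l < mdeg q) psC ((l.+2)`!%:R)^-1 *
      iter l.+2 (Dv (mkS s)) zv : A) q =
    (\sum_(l < mdeg q) psC ((l.+2)`!%:R)^-1 *
      iter l.+2 (Dv (mkS s')) zv : A) q.
    apply/eqP; rewrite -subr_eq0 -ps_oppE -ps_addE -sumrB; apply/eqP.
    suff: Fil w1 k.+1 (\sum_(l < mdeg q)
       (psC ((l.+2)`!%:R)^-1 * iter l.+2 (Dv (mkS s)) zv -
        psC ((l.+2)`!%:R)^-1 * iter l.+2 (Dv (mkS s')) zv)).
      by apply; rewrite -mdegE.
    apply: Fil_sum => l _; rewrite -mulrBr; apply: FilMl.
    by apply: Fil_le (@iter_Dv_cong k s s' l.+1 ss); lia.
  ring.
have S2 := mkS_FilV s.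
have flow_z : flow (mkS s) zv = Phi.
  apply/ps_ext=> q; case Lq: (Ldom q); last first.
    transitivity (zv q); last first.
      have := PhiL q; rewrite Lq => /(_ isT) /eqP; rewrite ps_addE ps_oppE subr_eq0.
      by move=> /eqP.
    rewrite flow_split // mkS_Ldom ?Lq // addr0.
    suff -> : (\sum_(l < mdeg q) psC ((l.+2)`!%:R)^-1 *
      iter l.+2 (Dv (mkS s)) zv : A) q = 0 by rewrite addr0.
    rewrite ps_sumE big1 // => l _; rewrite coef_psCM.
    suff -> : iter l.+2 (Dv (mkS s)) zv q = 0 by rewrite mulr0.
    have [Sz2 Sz1] := (Ldom_supp _).1 (@mkS_Ldom s).
    have itF j : Fil w1 j.+1 (iter j (Dv (mkS s)) zv).
      elim: j => [|j]; first exact: Fil_zv.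
      by move=> /(DvS_up (mkS_FilV s)).
    have Jz1 : Fil wzw 1 (Jc (maskS s)).
      move=> p; rewrite wt_wzw => p0; rewrite !JcE [maskS s _]Sz1 ?conjc0 //.
      by rewrite wt_wzw zdeg_swap wdeg_swap addnC.
    apply: (Ldom_supp _).2; last by rewrite Lq.
    split; first by apply: Fil_le (itF l.+2).
    by rewrite iterS /Dv; apply: FilD; apply: FilMr.
  have := sE q; rewrite ps_addE ps_addE ps_oppE => /eqP.
  rewrite /vz /mkS /= {3}/maskS Lq -subr_eq0 opprD addrA addrC addrA addNr sub0r.
  by rewrite oppr_eq0 subr_eq0 => /eqP ->.
exists (mkS s); split=> //; first exact: mkS_Ldom.
by rewrite -flow_z flow_Jc // Jc_z.
Qed.

End StateSpace.

(** * Substitutions of the parameters *)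

Section ParameterSubstitutions.
Variables (R : realType) (m : nat).
Local Notation C := R[i].
Local Notation A := (ps (pvar m) C).
Local Notation B := (ps (option 'I_m) R).
Local Notation Mu := (ps 'I_m R).
Local Notation rc := (real_complex R).
Local Notation vf := (vfield R m).
Local Notation zv := (@zv R m).
Local Notation wv := (@wv R m).
Local Notation muv := (@muv R m).
Local Notation dz := (@dz R m).
Local Notation dw := (@dw R m).
Local Notation Jc := (@Jc R m).
Implicit Types (f : A) (v : vf).

(** What the formal, the linear and the composed substitutions of parameters have
    in common. *)
Record paramor (tau : A -> A) : Prop := Paramor {
  pm_cmor : cmor idfun tau;
  pm_z : tau zv = zv;
  pm_w : tau wv = wv;
  pm_dz : forall f, tau (dz f) = dz (tau f);
  pm_dw : forall f, tau (dw f) = dw (tau f);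
  pm_Jc : forall f, tau (Jc f) = Jc (tau f)
}.

Lemma paramor_comp tau tau' : paramor tau -> paramor tau' -> paramor (tau' \o tau).
Proof.
move=> P Q; split=> [||||f|f] /=.
- exact: cmor_io (cmor_comp (pm_cmor P) (pm_cmor Q)).
- by rewrite (pm_z P) (pm_z Q).
- by rewrite (pm_w P) (pm_w Q).
- by move=> f; rewrite (pm_dz P) (pm_dz Q).
- by rewrite (pm_dw P) (pm_dw Q).
- by rewrite (pm_Jc P) (pm_Jc Q).
Qed.

Lemma paramor_inv tau tau' : paramor tau -> cmor idfun tau' ->
  cancel tau tau' -> cancel tau' tau -> paramor tau'.
Proof.
move=> P Q K K'; split=> // [||f|f|f].
- by rewrite -{1}(pm_z P) K.
- by rewrite -{1}(pm_w P) K.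
- by rewrite -{1}(K' f) -(pm_dz P) K.
- by rewrite -{1}(K' f) -(pm_dw P) K.
- by rewrite -{1}(K' f) -(pm_Jc P) K.
Qed.

Section OneSubstitution.
Variable g : 'I_m -> Mu.
Hypothesis g1 : forall k, Fil w1 1 (g k).

Definition tau_images : pvar m -> A := fun i =>
  match i with inl s => psX (inl s) | inr k => mulift (g k) end.

Lemma tau_images_Fil i : Fil w1 1 (tau_images i).
Proof.
case: i => [s|k] /=; first exact: Fil_psX.
exact: (cmF (cmor_mulift R m)).
Qed.

Definition tau : A -> A := sub tau_images.

Lemma tau_mu k : tau (muv k) = mulift (g k).
Proof. exact: sub_psX tau_images_Fil (inr k). Qed.

Lemma dw_mulift (u : Mu) : dw (mulift u) = 0.
Proof. by rewrite -(Jc_mulift u) -Jc_dz dz_mulift (cm0 (cmor_Jc R m)). Qed.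

Lemma paramor_tau : paramor tau.
Proof.
have P : cmor idfun tau by apply: cmor_sub tau_images_Fil.
have tz : tau zv = zv by apply: (sub_psX tau_images_Fil (pz m)).
have tw : tau wv = wv by apply: (sub_psX tau_images_Fil (pw m)).
have PJ := cmor_Jc R m.
have tdz f : tau (dz f) = dz (tau f).
  apply: (@cder_ext _ _ _ _ _ tau (tau \o dz) (dz \o tau) P).
  - exact: (cder_postcomp (cder_dz R m) P).
  - exact: (cder_precomp P (cder_dz R m)).
  apply: (gen_ind (Q := fun x => tau (dz x) = dz (tau x))) => [||k].
  - by rewrite tz dz_z (cm1 P).
  - by rewrite tw dz_w (cm0 P).
  - by rewrite tau_mu dz_mu (cm0 P) dz_mulift.
have tdw f : tau (dw f) = dw (tau f).
  apply: (@cder_ext _ _ _ _ _ tau (tau \o dw) (dw \o tau) P).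
  - exact: (cder_postcomp (cder_dw R m) P).
  - exact: (cder_precomp P (cder_dw R m)).
  apply: (gen_ind (Q := fun x => tau (dw x) = dw (tau x))) => [||k].
  - by rewrite tz dw_z (cm0 P).
  - by rewrite tw dw_w (cm1 P).
  - by rewrite tau_mu dw_mu (cm0 P) dw_mulift.
have tJ f : tau (Jc f) = Jc (tau f).
  apply: (@cmor_ext _ _ _ _ (@conjc R) (tau \o Jc) (Jc \o tau)).
  - exact: cmor_io (cmor_comp PJ P).
  - exact: cmor_io (cmor_comp P PJ).
  apply: (gen_ind (Q := fun x => tau (Jc x) = Jc (tau x))) => [||k].
  - by rewrite Jc_z tz tw [RHS]Jc_z.
  - by rewrite Jc_w tz tw [RHS]Jc_w.
  - by rewrite Jc_mu tau_mu Jc_mulift.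
exact: Paramor.
Qed.

Lemma tau_mulift (u : Mu) : tau (mulift u) = mulift (sub g u).
Proof.
apply: (@cmor_ext _ _ _ _ rc (tau \o @mulift R m) (@mulift R m \o sub g)).
- exact: cmor_io (cmor_comp (cmor_mulift R m) (pm_cmor paramor_tau)).
- exact: cmor_io (cmor_comp (cmor_sub g1) (cmor_mulift R m)).
by move=> k /=; rewrite mulift_psX tau_mu sub_psX.
Qed.

End OneSubstitution.

Lemma tau_unipotent (g : 'I_m -> Mu) :
  (forall k, Fil w1 2 (g k - psX k)) ->
  (forall i, Fil w1 2 (tau g (psX i) - psX i)).
Proof.
move=> g2; have g1 k : Fil w1 1 (g k) := Fil1_near_psX (g2 k).
have P := paramor_tau g1.
apply: (gen_ind (Q := fun x => Fil w1 2 (tau g x - x))) => [||k].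
- by rewrite (pm_z P) subrr; apply: Fil0.
- by rewrite (pm_w P) subrr; apply: Fil0.
- rewrite tau_mu // -mulift_psX -(cmB (cmor_mulift R m)).
  exact: (cmF (cmor_mulift R m)).
Qed.

Lemma tau_inv (g : 'I_m -> Mu) : (forall k, Fil w1 2 (g k - psX k)) ->
  exists tau', [/\ paramor tau', cancel (tau g) tau' & cancel tau' (tau g)].
Proof.
move=> g2; have g1 k : Fil w1 1 (g k) := Fil1_near_psX (g2 k).
have P := paramor_tau g1.
have [t' [Q K K']] := cmor_inv (pm_cmor P) (tau_unipotent g2).
by exists t'; split=> //; apply: paramor_inv P Q K K'.
Qed.

Definition glin (M : 'M[R]_m) : 'I_m -> Mu :=
  fun i => \sum_(j < m) psC (M i j) * psX j.

Lemma glin1 M k : Fil w1 1 (glin M k).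
Proof. by apply: Fil_sum => j _; apply: FilMl; apply: Fil_psX. Qed.

Lemma glinE M i : glin M i = (fun n => \sum_(j < m) M i j * fpsvar R j n).
Proof.
apply/ps_ext=> n; rewrite /glin ps_sumE; apply: eq_bigr => j _.
by rewrite coef_psCM.
Qed.

Lemma sub_glin (M : 'M[R]_m) (g : 'I_m -> Mu) i : (forall k, Fil w1 1 (g k)) ->
  sub g (glin M i) = \sum_(j < m) psC (M i j) * g j.
Proof.
move=> g1; have P := cmor_sub g1; rewrite /glin (cm_sum P).
by apply: eq_bigr => j _; rewrite (cmM P) (cmC P) sub_psX.
Qed.

Lemma sub_glin2 (M N : 'M[R]_m) i : sub (glin N) (glin M i) = glin (M *m N) i.
Proof.
rewrite sub_glin; last exact: glin1.
rewrite /glin; under eq_bigr do rewrite mulr_sumr.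
rewrite exchange_big; apply: eq_bigr => k _ /=.
rewrite mxE rmorph_sum mulr_suml; apply: eq_bigr => j _.
by rewrite mulrA -rmorphM.
Qed.

Lemma glin_id i : glin 1%:M i = psX i.
Proof.
rewrite /glin (bigD1 i) //= mxE eqxx rmorph1 mul1r big1 ?addr0 // => j /negPf ji.
by rewrite mxE eq_sym ji rmorph0 mul0r.
Qed.

Lemma tau_glinK (M N : 'M[R]_m) : M *m N = 1%:M -> cancel (tau (glin M)) (tau (glin N)).
Proof.
move=> MN f; have P := paramor_tau (glin1 M); have Q := paramor_tau (glin1 N).
apply: (@cmor_ext _ _ _ _ _ (tau (glin N) \o tau (glin M)) id) => [||i].
- exact: cmor_comp (pm_cmor P) (pm_cmor Q).
- exact: cmor_io (cmor_id _ _).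
move: i; apply: (gen_ind (Q := fun x => tau (glin N) (tau (glin M) x) = x)) => [||k].
- by rewrite (pm_z P) (pm_z Q).
- by rewrite (pm_w P) (pm_w Q).
- rewrite tau_mu; last exact: glin1.
  by rewrite tau_mulift ?sub_glin2 ?MN ?glin_id ?mulift_psX //; exact: glin1.
Qed.

Lemma phiME M v c : phiM M v c = tau (glin M) (v c) :> A.
Proof.
rewrite /phiM; suff -> : (fun i n => \sum_(j < m) M i j * fpsvar R j n) = glin M by [].
by apply/funext=> i; rewrite glinE.
Qed.

Definition gpar (P : 'I_m -> Mu) : 'I_m -> Mu := fun k => psX k + P k.

Lemma phiPE P v c : phiP P v c = tau (gpar P) (v c) :> A.
Proof. by []. Qed.

Lemma phiTE (T : timespace R m) v c :
  phiT T v c = (1 + (tlift T : A)) * (v c : A) :> A.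
Proof.
have aux (x y : A) : (1 + x) * y = y + x * y by rewrite mulrDl mul1r.
by symmetry; apply: (aux (tlift T) (v c)).
Qed.

Lemma tliftE (T : timespace R m) :
  tlift T = rlift (fun b : mindex (option 'I_m) => T (b None) (bmu b)).
Proof. by apply/ps_ext=> q; rewrite /tlift /rlift bi_None bmu_bi. Qed.

(** A term mu^n e_k has grade alpha (|n| - 1), so F^1 means degree at least two
    for every positive alpha. *)
Lemma FP_Fil alpha (P : paramspace R m) : (0 < alpha)%N ->
  FP alpha 1 P <-> (forall k, Fil w1 2 (gpar P k - psX k)).
Proof.
move=> a0; have e k : gpar P k - psX k = P k by rewrite /gpar addrC addKr.
split=> [H k q|H k q qa].
  rewrite e -mdegE => q2; apply: H.
  by rewrite add1n ltnS -[X in (_ <= X)%N]muln1 leq_pmul2l.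
rewrite -e H // -mdegE; move: qa; rewrite add1n ltnS -[X in (_ <= X)%N]muln1.
by rewrite leq_pmul2l.
Qed.

Lemma FR_coef alpha (T : timespace R m) : (0 < alpha)%N ->
  FR alpha 1 T <-> T 0%N 0 = 0.
Proof.
move=> a0; split=> [H|T0 k q]; first by apply: H; rewrite mdegE wt0 !muln0.
rewrite ltnS leqn0 addn_eq0 !muln_eq0 /= mdeg_eq0.
by rewrite (gtn_eqF a0) => /andP[/eqP -> /eqP ->].
Qed.

(** In a transformation, both substitutions of parameters compose to one invertible
    tau, acting last on a field rescaled by a unit. *)
Lemma transforms_elim alpha v u : (0 < alpha)%N -> transforms alpha v u ->
  exists (S : vf) (t : B) (tau tau' : A -> A),
  [/\ FL alpha 1 S, t 0 = 0, paramor tau /\ paramor tau',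
      cancel tau tau' /\ cancel tau' tau &
      forall c, u c = tau ((1 + rlift t) * (phiS S v c : A)) :> A].
Proof.
move=> a0 [M [P [T [S [MU [PF TF SF] ->]]]]].
exists S, (fun b : mindex (option 'I_m) => T (b None) (bmu b)).
have /(FP_Fil _ a0) P2 := PF.
have [t' [Q K K']] := tau_inv P2.
have P1 k : Fil w1 1 (gpar P k) := Fil1_near_psX (P2 k).
exists (tau (glin M) \o tau (gpar P)), (t' \o tau (glin (invmx M))).
have PM := paramor_tau (glin1 M).
have PM' := paramor_tau (glin1 (invmx M)).
have MK := tau_glinK (mulmxV MU); have MK' := tau_glinK (mulVmx MU).
split=> //.
- have -> : bmu (0 : mindex (option 'I_m)) = 0 by apply/ffunP=> k; rewrite !ffunE.
  by rewrite ffunE; apply: (FR_coef T a0).1.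
- by split; apply: paramor_comp => //; apply: paramor_tau.
- by split; apply: can_comp.
- by move=> c; rewrite phiME phiPE phiTE tliftE.
Qed.

End ParameterSubstitutions.

(** * Series in the squared radius and the parameters *)

Section RadialSeries.
Variables (K : numFieldType) (m N : nat).
Local Notation B := (ps (option 'I_m) K).
Implicit Types (f g h u e r : B) (b : mindex (option 'I_m)) (n : mindex 'I_m).

(** The weight of rho is 1 and that of each parameter N + 1.  A series in the
    parameters without constant term thus weighs more than rho^N, and rho^N
    is the dominant term of the radial part. *)
Definition wB : option 'I_m -> nat := fun i => if i is Some _ then N.+1 else 1%N.
Local Notation FB := (Fil wB).

Definition xB : B := psX None.
Definition dB : B -> B := pd None.

Lemma cder_dB : cder id dB. Proof. exact: cder_pd. Qed.
Lemma dB_x : dB xB = 1. Proof. by rewrite /dB pd_psX eqxx. Qed.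

Lemma wt_wB b : wt wB b = (b None + N.+1 * mdeg (bmu b))%N.
Proof.
rewrite wt_bi mul1n; congr (_ + _)%N.
by rewrite /wt /mdeg big_distrr.
Qed.

Lemma wt_bB j n : wt wB (bi j n) = (j + N.+1 * mdeg n)%N.
Proof. by rewrite wt_wB bi_None bmu_bi. Qed.

Lemma bi_eq0 j n : (bi j n == 0) = (j == 0%N) && (n == 0).
Proof.
rewrite -mdeg_eq0 mdeg_bi bi_None bmu_bi addn_eq0 mdeg_eq0 //.
Qed.

Lemma FB_x : FB 1 xB. Proof. exact: (@Fil_psX _ _ wB None). Qed.

Lemma FB_coef0 f : f 0 = 0 -> FB 1 f.
Proof.
move=> f0 b; rewrite wt_wB ltnS leqn0 addn_eq0 muln_eq0 /= mdeg_eq0 => /andP[b0 bm0].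
by rewrite -(biK b) (eqP b0) (eqP bm0) (_ : bi 0 0 = 0) //; apply/eqP; rewrite bi_eq0 !eqxx.
Qed.

Lemma xBX j : xB ^+ j = mon (bi j 0).
Proof.
elim: j => [|j IH]; first by rewrite expr0 -mon0; congr mon; apply/esym/eqP; rewrite bi_eq0 !eqxx.
rewrite exprS IH /xB /psX -monD; congr mon.
have -> : munit None = bi 1 0 :> mindex (option 'I_m).
  by apply/ffunP=> -[k|]; rewrite !ffunE.
by rewrite -biD addr0.
Qed.

Lemma coef_xM j f i n :
  (xB ^+ j * f) (bi i n) = if (j <= i)%N then f (bi (i - j) n) else 0.
Proof.
rewrite xBX coef_monM; case: ifP => [/forallP/(_ None)|].
  rewrite !ffunE => ->; congr f.
  by apply/ffunP=> -[k|]; rewrite !ffunE // subn0.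
case: leqP => // ji /negP[]; apply/forallP=> -[k|]; rewrite !ffunE //.
Qed.

Lemma coef_xMD j f i n : (xB ^+ j * f) (bi (i + j) n) = f (bi i n).
Proof. by rewrite coef_xM leq_addl addnK. Qed.

Lemma coef_xd f b : (xB * dB f) b = (b None)%:R * f b.
Proof. exact: pd_psX_mul. Qed.

Lemma Fil_xd w k f : Fil w k f -> Fil w k (xB * dB f).
Proof. by move=> fk b bk; rewrite coef_xd fk ?mulr0. Qed.

Lemma Fil_dB k f : FB k.+1 f -> FB k (dB f).
Proof.
move=> fk b bk; rewrite /dB /pd /fpsD fk ?mulr0 // wtD wt_munit /= addn1 ltnS.
exact: bk.
Qed.

Definition muonly f := forall b, b None != 0%N -> f b = 0.

Lemma muonly_dB f : muonly f -> dB f = 0.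
Proof.
move=> fm; apply/ps_ext=> b; rewrite /dB /pd /fpsD fm ?mulr0 // !ffunE eqxx.
by rewrite addn_eq0 andbF.
Qed.

Lemma muonly_FB f : muonly f -> f 0 = 0 -> FB N.+1 f.
Proof.
move=> fm f0 b; have [b0|/fm//] := eqVneq (b None) 0%N.
rewrite wt_wB b0 add0n -{2}[N.+1]muln1 ltn_mul2l /= ltnS leqn0 mdeg_eq0 => /eqP bm.
by rewrite -(biK b) b0 bm (_ : bi 0 0 = 0) //; apply/eqP; rewrite bi_eq0 !eqxx.
Qed.

(** A factor with dominant term c rho^M takes up exactly M units of weight. *)
Lemma lead_cancel c M f g om : c != 0 -> FB M.+1 (f - psC c * xB ^+ M) ->
  FB om (f * g) -> forall d, (d + M <= om)%N -> FB d g.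
Proof.
move=> c0 fM fg; elim=> [//|d IH] dM.
have gd : FB d g by apply: IH; lia.
have : FB (d.+1 + M) (psC c * (xB ^+ M * g)).
  have -> : psC c * (xB ^+ M * g) = f * g - (f - psC c * xB ^+ M) * g by ring.
  apply: FilB; first exact: Fil_le fg.
  by apply: Fil_le (FilM fM gd); lia.
move=> H b bd.
have Hb : (wt wB (bi (b None + M) (bmu b)) < d.+1 + M)%N.
  by rewrite wt_bB addnAC ltn_add2r -wt_wB.
have /eqP := H _ Hb.
by rewrite coef_psCM coef_xMD biK mulf_eq0 (negPf c0) => /eqP.
Qed.

(** Taylor's formula with a remainder whose weight is controlled. *)
Lemma taylor2 u e k : FB 1 u -> FB 1 e -> exists2 c, FB (k - 2) c &
  (u + e) ^+ k = u ^+ k + k%:R * u ^+ k.-1 * e + e ^+ 2 * c.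
Proof.
move=> u1 e1; elim: k => [|k [c ck IH]].
  by exists 0 => //; rewrite !expr0; ring.
exists (k%:R * u ^+ k.-1 + (u + e) * c).
  case: k ck {IH} => [|[|k]] ck //.
  apply: FilD; first by apply: FilMl; apply: Fil_le (@FilX1 _ _ _ k.+1 _ u1); lia.
  by apply: Fil_le (FilM (FilD u1 e1) ck); lia.
rewrite exprS IH; case: k {ck IH} => [|k]; first by rewrite /= !expr0 expr1; ring.
by rewrite /= !exprS -!natr1; ring.
Qed.

(** The equation of motion of the normal form in the radial variable, up to a
    factor 2, and the derivative of its right-hand side. *)
Definition Ff (a : K) (psi : 'I_N -> B) (be : B) (X : B) : B :=
  psC a * X ^+ N.+1 + \sum_(k < N) psi k * X ^+ k.+1 + be * X ^+ (2 * N).+1.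

Definition Ff' (a : K) (psi : 'I_N -> B) (be : B) (X : B) : B :=
  N.+1%:R * psC a * X ^+ N + \sum_(k < N) k.+1%:R * psi k * X ^+ k
  + (2 * N).+1%:R * be * X ^+ (2 * N).

Section Ff.
Variables (a : K) (psi : 'I_N -> B) (be : B).
Hypothesis N_gt0 : (0 < N)%N.
Hypotheses (psi_mu : forall k, muonly (psi k)) (be_mu : muonly be).
Hypothesis (psi0 : forall k, psi k 0 = 0).

Lemma FB_psi k : FB N.+1 (psi k).
Proof. exact: muonly_FB. Qed.

Lemma Ff_lead X : FB 1 X -> FB N.+2 (Ff a psi be X - psC a * X ^+ N.+1).
Proof.
move=> X1; rewrite /Ff.
have -> : forall s t v : B, s + t + v - s = t + v by move=> *; ring.
apply: FilD.
  apply: Fil_sum => k _.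
  by apply: Fil_le (FilM (FB_psi k) (@FilX1 _ _ _ k.+1 _ X1)); lia.
by apply: FilMl; apply: Fil_le (@FilX1 _ _ _ _ _ X1); lia.
Qed.

Lemma Ff'_lead X : FB 1 X -> FB N.+1 (Ff' a psi be X - N.+1%:R * psC a * X ^+ N).
Proof.
move=> X1; rewrite /Ff'.
have -> : forall s t v : B, s + t + v - s = t + v by move=> *; ring.
apply: FilD.
  apply: Fil_sum => k _; rewrite -mulrA; apply: FilMl.
  by apply: FilMr; apply: FB_psi.
by apply: FilMl; apply: Fil_le (@FilX1 _ _ _ _ _ X1); lia.
Qed.

Lemma FB_Ff X : FB 1 X -> FB N.+1 (Ff a psi be X).
Proof.
move=> X1; rewrite -(subrK (psC a * X ^+ N.+1) (Ff _ _ _ _)).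
apply: FilD; first exact: Fil_le (Ff_lead X1).
by apply: FilMl; apply: FilX1.
Qed.

Lemma dB_Ff : dB (Ff a psi be xB) = Ff' a psi be xB.
Proof.
have D := cder_dB; rewrite /Ff /Ff' !(cdD D) (cd_sum D).
have dX j : dB (xB ^+ j.+1) = j.+1%:R * xB ^+ j.
  by rewrite (cdX (cmor_id _ _) D) dB_x mulr1 mulr_natl.
congr (_ + _ + _).
- by rewrite (cdM D) (cdC D) dX; ring.
- by apply: eq_bigr => k _; rewrite (cdM D) dX muonly_dB //; ring.
- by rewrite (cdM D) dX muonly_dB //; ring.
Qed.

Lemma Ff_taylor u e : FB 1 u -> FB 1 e -> exists2 c, FB N.-1 c &
  Ff a psi be (u + e) = Ff a psi be u + Ff' a psi be u * e + e ^+ 2 * c.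
Proof.
move=> u1 e1.
have H k : exists c, FB (k - 2) c /\
  (u + e) ^+ k = u ^+ k + k%:R * u ^+ k.-1 * e + e ^+ 2 * c.
  by have [c] := taylor2 k u1 e1; exists c.
have [c cH] := choice H.
exists (psC a * c N.+1 + \sum_(k < N) psi k * c k.+1 + be * c (2 * N).+1).
  apply: FilD; last by apply: FilMl; apply: Fil_le (cH _).1; lia.
  apply: FilD; first by apply: FilMl; apply: Fil_le (cH _).1; lia.
  by apply: Fil_sum => k _; apply: FilMr; apply: Fil_le (FB_psi k); lia.
rewrite /Ff /Ff' (cH N.+1).2 (cH (2 * N).+1).2.
under eq_bigr do rewrite (cH _).2.
have -> : \sum_(k < N) psi k * (u ^+ k.+1 + k.+1%:R * u ^+ k.+1.-1 * e + e ^+ 2 * c k.+1)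
  = \sum_(k < N) psi k * u ^+ k.+1 + (\sum_(k < N) k.+1%:R * psi k * u ^+ k) * e
    + e ^+ 2 * \sum_(k < N) psi k * c k.+1.
  rewrite mulr_suml mulr_sumr -!big_split; apply: eq_bigr => k _ /=; ring.
rewrite /=; ring.
Qed.

End Ff.
End RadialSeries.

(** * Uniqueness for the radial conjugacy equation *)

Section RadialUniqueness.
Variables (K : numFieldType) (m N : nat).
Hypothesis N_gt0 : (0 < N)%N.
Local Notation B := (ps (option 'I_m) K).
Local Notation FB := (Fil (@wB m N)).
Local Notation x := (@xB K m).
Local Notation dB := (@dB K m).
Variables (a1 a2 : K) (psi1 psi2 : 'I_N -> B) (be1 be2 H ka : B).
Hypotheses (a1_neq0 : a1 != 0).
Hypotheses (psi1_mu : forall k, muonly (psi1 k)) (psi2_mu : forall k, muonly (psi2 k)).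
Hypotheses (be1_mu : muonly be1) (be2_mu : muonly be2).
Hypotheses (psi1_0 : forall k, psi1 k 0 = 0) (psi2_0 : forall k, psi2 k 0 = 0).
Hypothesis H0 : H 0 = 1.
Local Notation y := (x * H).
Implicit Types (b : mindex (option 'I_m)) (n : mindex 'I_m).
Local Notation F := (Ff a1 psi1 be1 x).
Hypothesis conj_eq : Ff a2 psi2 be2 y * (1 + ka * F) = F * dB y.

Let x1 : FB 1 x := @FB_x K m N.
Let F_lead : FB N.+2 (F - psC a1 * x ^+ N.+1) := Ff_lead a1 be1 N_gt0 psi1_mu psi1_0 x1.
Let F1 : FB N.+1 F := FB_Ff a1 be1 N_gt0 psi1_mu psi1_0 x1.

Lemma H_sub1 : FB 1 (H - 1).
Proof. by apply: FB_coef0; rewrite ps_addE ps_oppE H0 coef01 subrr. Qed.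

Lemma y_lead : FB 2 (y - x).
Proof.
have -> : y - x = x * (H - 1) by ring.
exact: FilM x1 H_sub1.
Qed.

Lemma FB_y : FB 1 y. Proof. exact: FilMr. Qed.

(** Both sides of [conj_eq] have dominant term rho^(N+1), with coefficients a2 and
    a1. *)
Lemma radial_lead_unique : a1 = a2.
Proof.
have dy1 : FB 1 (dB y - 1).
  have -> : dB y - 1 = dB (y - x) by rewrite (cdB (cder_dB _ _)) dB_x.
  exact: Fil_dB y_lead.
have e1 : FB N.+2 (F * dB y - psC a1 * x ^+ N.+1).
  have -> : F * dB y - psC a1 * x ^+ N.+1 =
    F * (dB y - 1) + (F - psC a1 * x ^+ N.+1) by ring.
  by apply: FilD => //; apply: Fil_le (FilM F1 dy1); lia.
have F2 := FB_Ff a2 be2 N_gt0 psi2_mu psi2_0 FB_y.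
have e2 : FB N.+2 (F * dB y - psC a2 * x ^+ N.+1).
  rewrite -conj_eq.
  have -> : Ff a2 psi2 be2 y * (1 + ka * F) - psC a2 * x ^+ N.+1 =
    (Ff a2 psi2 be2 y - psC a2 * y ^+ N.+1) + Ff a2 psi2 be2 y * ka * F +
    psC a2 * x ^+ N.+1 * (H ^+ N.+1 - 1) by rewrite exprMn; ring.
  apply: FilD; first (apply: FilD).
  - exact: Ff_lead FB_y.
  - by apply: Fil_le (FilM (FilMr ka F2) F1); lia.
  - have h1 : FB 1 (H ^+ N.+1 - 1).
      by rewrite -(expr1n _ N.+1); apply: FilB_X H_sub1.
    by apply: Fil_le (FilM (FilMl (psC a2) (@FilX1 _ _ _ N.+1 _ x1)) h1); lia.
have := FilB e1 e2; have -> : forall s t v : B, s - t - (s - v) = v - t.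
  by move=> *; ring.
rewrite -mulrBl -rmorphB => /(_ (bi (0 + N.+1) 0)).
rewrite wt_bB mdeg0 muln0 addn0 add0n => /(_ (ltnSn _)).
rewrite coef_psCM; have := @coef_xMD K m N.+1 1 0 0; rewrite mulr1 add0n => ->.
have -> : bi 0 0 = 0 :> mindex (option 'I_m) by apply/eqP; rewrite bi_eq0 !eqxx.
by rewrite coef01 mulr1 => /eqP; rewrite subr_eq0 => /eqP.
Qed.

(** Division with remainder by F, whose dominant term has degree N + 1 in rho.  The
    quotient g accounts for the conjugacies obtained by following F itself, which
    do not alter the normal form; the remainder r will be shown to vanish. *)
Lemma division_by_F : exists g r : B, [/\ y = x + g * F + r,
  forall b, b None = 0%N -> r b = 0 & forall b, (N < b None)%N -> r b = 0].
Proof.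
pose F' := F - psC a1 * x ^+ N.+1.
have [k g g' gg b bk|g gE] := @contraction_fixpoint _ K 0 (wt (@wB m N))
  (fun (g : B) (b : mindex (option 'I_m)) => a1^-1 * (y - x - g * F' : B) (bi (b None + N.+1) (bmu b))).
  have gF : FB (k + N.+2) (((g : B) - (g' : B)) * F').
    by apply: (FilM _ F_lead) => q qk; rewrite ps_addE ps_oppE gg // subrr.
  have /eqP : (((g : B) - (g' : B)) * F') (bi (b None + N.+1) (bmu b)) = 0.
    by apply: gF; rewrite wt_bB addnAC -wt_wB; lia.
  rewrite mulrBl !(ps_addE, ps_oppE) subr_eq0 => /eqP gF'.
  by rewrite gF'.
have [{}g {}gE] : exists g : B, forall b,
  g b = a1^-1 * (y - x - g * F' : B) (bi (b None + N.+1) (bmu b)) by exists g.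
exists g, (y - x - g * F); split.
- by ring.
- move=> b b0; have -> : y - x - g * F = x ^+ 1 *
      (H - 1 - g * (psC a1 * x ^+ N + \sum_(k < N) psi1 k * x ^+ k + be1 * x ^+ (2 * N))).
    rewrite /Ff expr1.
    have -> : \sum_(k < N) psi1 k * x ^+ k.+1 = x * \sum_(k < N) psi1 k * x ^+ k.
      by rewrite mulr_sumr; apply: eq_bigr => k _; rewrite exprS; ring.
    by rewrite !exprS; ring.
  by rewrite -(biK b) coef_xM b0.
- move=> b bN; pose c : mindex (option 'I_m) := bi (b None - N.+1) (bmu b).
  have bc : b = bi (c None + N.+1) (bmu c) by rewrite bi_None bmu_bi subnK ?biK.
  have -> : y - x - g * F = (y - x - g * F') - psC a1 * (x ^+ N.+1 * g).
    by rewrite /F'; ring.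
  rewrite ps_addE ps_oppE coef_psCM {2}bc coef_xMD biK gE -bc.
  by rewrite mulrA divff // mul1r subrr.
Qed.

(** Let p_k and db be the differences of the coefficients of the normal forms.
    After a Taylor expansion at y = rho + g F + r, [conj_eq] becomes, modulo
    products of small quantities,
      a1^2 rho^(2N+2) G + a1 rho^N ((N+1) r - rho dr/drho)
        + sum_k p_k rho^(k+1) + db rho^(2N+1) = 0
    for some series G.  Since r only has the powers rho^1, .., rho^N, the summands
    live in the disjoint ranges of degrees > 2N+1, [N+1, 2N], [1, N] and 2N+1, and
    the factor N + 1 - i at rho^i in r is nonzero.  Induction on the weight then
    gives r = 0, p_k = 0 and db = 0. *)
Lemma radial_coefs_unique : (forall k, psi1 k = psi2 k) /\ be1 = be2.
Proof.
have [g [r [yE r0 rN]]] := division_by_F.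
pose p k := psi2 k - psi1 k; pose db := be2 - be1.
pose Del X := \sum_(k < N) p k * X ^+ k.+1 + db * X ^+ (2 * N).+1.
have F2E X : Ff a2 psi2 be2 X = Ff a1 psi1 be1 X + Del X.
  rewrite /Ff /Del -radial_lead_unique /p /db.
  have -> : \sum_(k < N) (psi2 k - psi1 k) * X ^+ k.+1 =
    \sum_(k < N) psi2 k * X ^+ k.+1 - \sum_(k < N) psi1 k * X ^+ k.+1.
    by rewrite -sumrB; apply: eq_bigr => k _; rewrite mulrBl.
  by ring.
have gF1 : FB N.+1 (g * F) by apply: FilMl.
have r2 : FB 2 r.
  have -> : r = (y - x) - g * F by rewrite yE; ring.
  by apply: FilB; [exact: y_lead | apply: Fil_le gF1; lia].
have gF1' : FB 1 (g * F) by apply: Fil_le gF1.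
have u1 : FB 1 (x + g * F) by apply: FilD.
have r1 : FB 1 r by apply: Fil_le r2.
have [c cF Fy] := Ff_taylor a1 be1 N_gt0 psi1_mu psi1_0 u1 r1.
have [c' _ Fu] := Ff_taylor a1 be1 N_gt0 psi1_mu psi1_0 x1 gF1'.
pose G := c' * g ^+ 2 + ka * (1 + Ff' a1 psi1 be1 x * g + c' * g ^+ 2 * F) - dB g.
have dF : dB F = Ff' a1 psi1 be1 x := dB_Ff a1 psi1_mu be1_mu.
have dy : dB y = 1 + (dB g * F + g * Ff' a1 psi1 be1 x) + dB r.
  have D := cder_dB K m.
  by rewrite yE !(cdD D) dB_x (cdM D) dF.
(* The terms of first order in g cancel: F flows along itself. *)
have mainE : F ^+ 2 * G + (Ff' a1 psi1 be1 (x + g * F) * r + r ^+ 2 * c + Del y)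
    * (1 + ka * F) - F * dB r = 0.
  have := conj_eq; rewrite F2E dy {1}yE Fy Fu => /eqP; rewrite -subr_eq0 => /eqP <-.
  by rewrite /G; ring.
have F2lead : FB (2 * N).+3 (F ^+ 2 - psC (a1 ^+ 2) * x ^+ (2 * N).+2).
  have -> : F ^+ 2 - psC (a1 ^+ 2) * x ^+ (2 * N).+2 =
    (F - psC a1 * x ^+ N.+1) * (F + psC a1 * x ^+ N.+1).
    rewrite rmorphXn /= -[(2 * N).+2]/((2 * N).+1.+1).
    have -> : (2 * N).+2 = (N.+1 * 2)%N by lia.
    by rewrite exprM; ring.
  have s1 : FB N.+1 (F + psC a1 * x ^+ N.+1).
    by apply: FilD => //; apply/FilMl/FilX1.
  by apply: Fil_le (FilM F_lead s1); lia.
have F'lead := Ff'_lead a1 be1 N_gt0 psi1_mu psi1_0 u1.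
(* One unit of weight is gained at a time, simultaneously for r, the p k and db. *)
have step j : FB (j + 2) r ->
    (forall k : 'I_N, FB (N.+2 + j) (p k * x ^+ k.+1)) ->
    FB (N.+2 + j) (db * x ^+ (2 * N).+1) ->
  [/\ FB (j.+1 + 2) r, forall k : 'I_N, FB (N.+2 + j.+1) (p k * x ^+ k.+1) &
    FB (N.+2 + j.+1) (db * x ^+ (2 * N).+1)].
  move=> rF pF dbF; set om := (N.+2 + j)%N in pF dbF *.
  have DelF : FB om.+1 (Del y - Del x).
    have yk (q : B) (k : nat) : FB om (q * x ^+ k) -> FB om.+1 (q * y ^+ k - q * x ^+ k).
      move=> qF; have -> : q * y ^+ k - q * x ^+ k = q * x ^+ k * (H ^+ k - 1).
        by rewrite exprMn; ring.
      have h1 : FB 1 (H ^+ k - 1).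
        by rewrite -(expr1n _ k); apply: FilB_X H_sub1.
      by apply: Fil_le (FilM qF h1); lia.
    have -> : Del y - Del x = \sum_(k < N) (p k * y ^+ k.+1 - p k * x ^+ k.+1) +
      (db * y ^+ (2 * N).+1 - db * x ^+ (2 * N).+1) by rewrite sumrB /Del; ring.
    by apply: FilD; [apply: Fil_sum => k _|]; apply: yk.
  have DelxF : FB om (Del x) by apply: FilD => //; apply: Fil_sum => k _.
  have F'r : FB om.+1 (Ff' a1 psi1 be1 (x + g * F) * r - N.+1%:R * psC a1 * x ^+ N * r).
    have -> : Ff' a1 psi1 be1 (x + g * F) * r - N.+1%:R * psC a1 * x ^+ N * r =
      (Ff' a1 psi1 be1 (x + g * F) - N.+1%:R * psC a1 * (x + g * F) ^+ N) * r +
      N.+1%:R * psC a1 * ((x + g * F) ^+ N - x ^+ N) * r by ring.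
    have pw : FB N.+1 ((x + g * F) ^+ N - x ^+ N).
      have [c2 _ ->] := taylor2 N x1 gF1'.
      have -> : x ^+ N + N%:R * x ^+ N.-1 * (g * F) + (g * F) ^+ 2 * c2 - x ^+ N =
         (N%:R * x ^+ N.-1 + (g * F) * c2) * (g * F) by ring.
      exact: FilMl.
    apply: FilD; first by apply: Fil_le (FilM F'lead rF); rewrite /om; lia.
    by apply: Fil_le (FilM (FilMl _ pw) rF); rewrite /om; lia.
  have r2F : FB om.+1 (r ^+ 2 * c).
    by apply: Fil_le (FilM (FilM rF rF) cF); rewrite /om; lia.
  have Nr : FB om (N.+1%:R * psC a1 * x ^+ N * r).
    by apply: Fil_le (FilM (FilMl _ (@FilX1 _ _ _ N _ x1)) rF); rewrite /om; lia.
  have sumF : FB om (Ff' a1 psi1 be1 (x + g * F) * r + r ^+ 2 * c + Del y).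
    have -> : Ff' a1 psi1 be1 (x + g * F) * r + r ^+ 2 * c + Del y =
      (Ff' a1 psi1 be1 (x + g * F) * r - N.+1%:R * psC a1 * x ^+ N * r) +
      r ^+ 2 * c + (Del y - Del x) + N.+1%:R * psC a1 * x ^+ N * r + Del x by ring.
    apply: (FilD (FilD (FilD (FilD _ _) _) Nr) DelxF).
    - exact: Fil_le F'r.
    - exact: Fil_le r2F.
    - exact: Fil_le DelF.
  have drF : FB j.+1 (dB r) by apply: Fil_dB; rewrite -addn2.
  have Fdr : FB om.+1 (F * dB r - psC a1 * x ^+ N.+1 * dB r).
    by rewrite -mulrBl; apply: Fil_le (FilM F_lead drF); rewrite /om; lia.
  have xdr : FB om (psC a1 * x ^+ N.+1 * dB r).
    by apply: Fil_le (FilM (FilMl _ (@FilX1 _ _ _ N.+1 _ x1)) drF); rewrite /om; lia.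
  have E : FB om.+1 (F ^+ 2 * G + (N.+1%:R * psC a1 * x ^+ N * r) + Del x
      - psC a1 * x ^+ N.+1 * dB r).
    have -> : F ^+ 2 * G + (N.+1%:R * psC a1 * x ^+ N * r) + Del x
      - psC a1 * x ^+ N.+1 * dB r =
      0 - (Ff' a1 psi1 be1 (x + g * F) * r - N.+1%:R * psC a1 * x ^+ N * r)
      - r ^+ 2 * c - (Del y - Del x)
      - (Ff' a1 psi1 be1 (x + g * F) * r + r ^+ 2 * c + Del y) * (ka * F)
      + (F * dB r - psC a1 * x ^+ N.+1 * dB r).
      by rewrite -mainE; ring.
    apply: FilD => //; apply: FilB.
      by apply: FilB => //; apply: FilB => //; apply: FilB => //; apply: Fil0.
    by apply: Fil_le (FilM sumF (FilMl ka F1)); lia.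
  have F2G : FB om (F ^+ 2 * G).
    have -> : F ^+ 2 * G = (F ^+ 2 * G + (N.+1%:R * psC a1 * x ^+ N * r) + Del x
      - psC a1 * x ^+ N.+1 * dB r) - N.+1%:R * psC a1 * x ^+ N * r - Del x
      + psC a1 * x ^+ N.+1 * dB r by ring.
    apply: FilD => //; apply: FilB => //; apply: FilB => //.
    exact: Fil_le E.
  have a12 : a1 ^+ 2 != 0 by rewrite expf_neq0.
  have GF d : (d + (2 * N).+2 <= om)%N -> FB d G.
    exact: (lead_cancel a12 F2lead F2G).
  have F2G' : FB om.+1 (F ^+ 2 * G - psC (a1 ^+ 2) * (x ^+ (2 * N).+2 * G)).
    rewrite mulrA -mulrBl.
    have [le|lt] := leqP (2 * N).+2 om.
      have := GF (om - (2 * N).+2)%N; rewrite subnK // => /(_ (leqnn _)) GF'.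
      by apply: Fil_le (FilM F2lead GF'); lia.
    by apply: FilMr; apply: Fil_le F2lead; lia.
  pose W := psC (a1 ^+ 2) * (x ^+ (2 * N).+2 * G) +
    psC a1 * (x ^+ N * (N.+1%:R * r - x * dB r)) + Del x.
  have WF : FB om.+1 W.
    have -> : W = (F ^+ 2 * G + (N.+1%:R * psC a1 * x ^+ N * r) + Del x
      - psC a1 * x ^+ N.+1 * dB r) -
      (F ^+ 2 * G - psC (a1 ^+ 2) * (x ^+ (2 * N).+2 * G)).
      by rewrite /W [x ^+ N.+1]exprS; ring.
    exact: FilB.
  have pcoef k i n : (p k * x ^+ k.+1) (bi i n) = if i == k.+1 then p k (bi 0 n) else 0.
    rewrite mulrC coef_xM; have pm : muonly (p k).
      by move=> b b0; rewrite /p ps_addE ps_oppE psi1_mu // psi2_mu // subrr.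
    case: eqP => [->|ik]; first by rewrite leqnn subnn.
    case: leqP => // ki; apply: pm; rewrite bi_None subn_eq0; apply/negP => ik'.
    by apply: ik; apply/eqP; rewrite eqn_leq ik'.
  have dbcoef i n : (db * x ^+ (2 * N).+1) (bi i n) =
      if i == (2 * N).+1 then db (bi 0 n) else 0.
    rewrite mulrC coef_xM; have pm : muonly db.
      by move=> b b0; rewrite /db ps_addE ps_oppE be1_mu // be2_mu // subrr.
    case: eqP => [->|ik]; first by rewrite leqnn subnn.
    case: leqP => // ki; apply: pm; rewrite bi_None subn_eq0; apply/negP => ik'.
    by apply: ik; apply/eqP; rewrite eqn_leq ik'.
  have rterm i n : (x ^+ N * (N.+1%:R * r - x * dB r)) (bi i n) =
     if (N <= i)%N then (N.+1%:R - (i - N)%:R) * r (bi (i - N) n) else 0.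
    rewrite coef_xM; case: leqP => // Ni.
    rewrite ps_addE ps_oppE coef_xd bi_None mulrBl; congr (_ - _).
    by rewrite -[N.+1%:R](rmorph_nat psC) coef_psCM.
  (* The displayed identity, at a monomial of the critical weight. *)
  have Wc i n : (i + N.+1 * mdeg n = om)%N ->
      a1 ^+ 2 * (if ((2 * N).+2 <= i)%N then G (bi (i - (2 * N).+2) n) else 0) +
      a1 * (if (N <= i)%N then (N.+1%:R - (i - N)%:R) * r (bi (i - N) n) else 0) +
      (\sum_(k < N) (if i == k.+1 then p k (bi 0 n) else 0) +
        (if i == (2 * N).+1 then db (bi 0 n) else 0)) = 0.
    move=> iom; have := WF (bi i n); rewrite wt_bB iom ltnSn => /(_ isT) W0.
    rewrite -[RHS]W0.
    rewrite /W /Del !ps_addE !coef_psCM rterm coef_xM dbcoef ps_sumE.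
    by congr (_ + (_ + _)); apply: eq_bigr => k _; rewrite pcoef.
  have rzero i n : (i + N + N.+1 * mdeg n = om)%N -> r (bi i n) = 0.
    move=> iom; have [i0|ipos] := posnP i; first by apply: r0; rewrite bi_None.
    have [iN|Ni] := leqP i N; last by apply: rN; rewrite bi_None.
    have := Wc _ _ iom; rewrite leq_addl addnK.
    rewrite (_ : _ <= _ = false)%N; last by apply/negbTE; rewrite -ltnNge; lia.
    rewrite mulr0 add0r big1; last by move=> k _; case: eqP => // e; have := ltn_ord k; lia.
    rewrite (_ : (i + N)%N == _ = false); last by apply/negbTE/eqP; lia.
    rewrite !addr0 => /eqP; rewrite !mulf_eq0 (negPf a1_neq0) subr_eq0 eqr_nat.
    by rewrite (_ : _ == i = false) => [/eqP|]; last by apply/negbTE/eqP; lia.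
  split.
  - move=> b; rewrite addSn ltnS leq_eqVlt => /orP[/eqP be|bl]; last exact: rF.
    by rewrite -(biK b); apply: rzero; move: be; rewrite wt_wB /om; lia.
  - move=> k b; rewrite addnS ltnS leq_eqVlt => /orP[/eqP be|bl]; last exact: pF.
    rewrite -(biK b) pcoef; case: eqP => // bk.
    have iom : (b None + N.+1 * mdeg (bmu b) = om)%N by rewrite -wt_wB.
    have kN := ltn_ord k.
    have := Wc _ _ iom; rewrite (_ : _ <= _ = false)%N; last first.
      by apply/negbTE; rewrite -ltnNge bk; lia.
    have -> : (if (N <= b None)%N then (N.+1%:R - (b None - N)%:R) *
         r (bi (b None - N) (bmu b)) else 0) = 0.
      case: leqP => // Nb; rewrite r0 ?mulr0 // bi_None bk.
      by apply/eqP; rewrite subn_eq0.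
    rewrite (bigD1 k) //= bk eqxx big1; last first.
      move=> i ik; case: eqP => // e; case/eqP: ik; apply/val_inj => /=; lia.
    rewrite (_ : k.+1 == _ = false); last by apply/negbTE/eqP; lia.
    by rewrite !mulr0 !add0r !addr0.
  - move=> b; rewrite addnS ltnS leq_eqVlt => /orP[/eqP be|bl]; last exact: dbF.
    rewrite -(biK b) dbcoef; case: eqP => // bk.
    have iom : (b None + N.+1 * mdeg (bmu b) = om)%N by rewrite -wt_wB.
    have := Wc _ _ iom; rewrite (_ : _ <= _ = false)%N; last first.
      by apply/negbTE; rewrite -ltnNge bk; lia.
    have -> : (if (N <= b None)%N then (N.+1%:R - (b None - N)%:R) *
         r (bi (b None - N) (bmu b)) else 0) = 0.
      by case: leqP => // Nb; rewrite rN ?mulr0 // bi_None bk; lia.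
    rewrite big1; last by move=> i _; rewrite bk; case: eqP => // e; have := ltn_ord i; lia.
    by rewrite bk eqxx !mulr0 !add0r.
have all j : [/\ FB (j + 2) r, forall k : 'I_N, FB (N.+2 + j) (p k * x ^+ k.+1) &
    FB (N.+2 + j) (db * x ^+ (2 * N).+1)].
  elim: j => [|j [rF pF dF']]; last exact: step.
  split=> // [k|]; last by apply: FilMl; apply: Fil_le (@FilX1 _ _ _ (2 * N).+1 _ x1); lia.
  have pF : FB N.+1 (p k) by apply: FilB; apply: muonly_FB.
  by apply: Fil_le (FilM pF (@FilX1 _ _ _ k.+1 _ x1)); lia.
have xzero (q : B) (k : nat) : (forall j, FB (N.+2 + j) (q * x ^+ k)) -> q = 0.
  move=> qF; have q0 : q * x ^+ k = 0.
    apply: (@Fil_eq0 _ _ (@wB m N)) => j; apply: Fil_le (qF j); lia.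
  apply/ps_ext=> b; rewrite -(biK b) -(@coef_xMD _ _ k) mulrC q0 //.
split=> [k|]; apply/eqP; rewrite eq_sym -subr_eq0; apply/eqP.
  by apply: (@xzero _ k.+1) => j; have [_ pF _] := all j; apply: pF.
by apply: (@xzero _ (2 * N).+1) => j; have [_ _ dF'] := all j; apply: dF'.
Qed.

End RadialUniqueness.

(** * Solving the radial normal form equation *)

Section RadialExistence.
Variables (K : numFieldType) (m N : nat).
Hypothesis N_gt0 : (0 < N)%N.
Local Notation B := (ps (option 'I_m) K).
Local Notation FB := (Fil (@wB m N)).
Local Notation x := (@xB K m).
Local Notation dB := (@dB K m).
Implicit Types (b : mindex (option 'I_m)) (n : mindex 'I_m).
Variables (a : K) (Rr : B).
Hypothesis a_neq0 : a != 0.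
Hypothesis Rr_low : forall j, (j < N)%N -> Rr (bi j 0) = 0.
Hypothesis Rr_N : Rr (bi N 0) = a.

Let x1 : FB 1 x := @FB_x K m N.

Definition binrest (M : nat) (e : B) : B := (1 + e) ^+ M - 1 - M%:R * e.

Lemma FB_binrest M e : FB 1 e -> FB 2 (binrest M e).
Proof.
move=> e1; rewrite /binrest; elim: M => [|M IH].
  by rewrite expr0 mul0r !subr0 subrr; apply: Fil0.
have -> : (1 + e) ^+ M.+1 - 1 - M.+1%:R * e =
  (1 + e) * ((1 + e) ^+ M - 1 - M%:R * e) + M%:R * (e * e).
  by rewrite exprS -natr1; ring.
by apply: FilD; [apply: FilMl | apply: FilMl; apply: (FilM e1 e1)].
Qed.

Lemma FB_binrest_diff M k (e e' : B) : FB 1 e -> FB 1 e' -> FB k (e - e') ->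
  FB k.+1 (binrest M e - binrest M e').
Proof.
move=> e1 e1' ee; elim: M => [|M IH].
  rewrite /binrest !expr0 !mul0r subrr; apply: Fil0.
have E (u : B) : binrest M.+1 u = (1 + u) * binrest M u + M%:R * (u * u).
  by rewrite /binrest exprS -natr1; ring.
rewrite !E.
have -> : (1 + e) * binrest M e + M%:R * (e * e) -
  ((1 + e') * binrest M e' + M%:R * (e' * e')) =
  (1 + e) * (binrest M e - binrest M e') + (e - e') * binrest M e' +
  M%:R * ((e - e') * (e + e')) by ring.
apply: FilD; first apply: FilD.
- exact: FilMl.
- by apply: Fil_le (FilM ee (FB_binrest M e1')); lia.
- by apply: FilMl; apply: Fil_le (FilM ee (FilD e1 e1')); lia.
Qed.

Lemma FB_Rr : FB N.+1 (Rr - psC a * x ^+ N).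
Proof.
move=> b; rewrite wt_wB => bN.
have bm : bmu b = 0.
  by apply/eqP; rewrite -mdeg_eq0; apply/eqP; case: (mdeg _) bN => //; lia.
rewrite -(biK b) bm ps_addE ps_oppE coef_psCM -[x ^+ N]mulr1 coef_xM.
case: (ltngtP (b None) N) => bN'.
- by rewrite Rr_low // mulr0 subr0.
- by move: bN; rewrite bm mdeg0 muln0 addn0 ltnS leqNgt bN'.
rewrite bN' subnn Rr_N (_ : bi 0 0 = 0) ?coef01 ?mulr1 ?subrr //.
by apply/eqP; rewrite bi_eq0 !eqxx.
Qed.

(** With h = 1 + eta, the unknowns psi, eta and beta are stored in one series s so
    that the linearized equation becomes diagonal: s holds the coefficients of
    psi_k at rho^k mu^n for k < N, those of beta at rho^(2N) mu^n, and that of eta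
    at rho^i mu^n is stored at rho^(N+i) mu^n.  As rho^N eta enters with the factor
    2 a (2N - j) at rho^j, only the place j = 2N is left free by eta, and beta takes
    it. *)
Section Decode.
Variable s : B.
Definition dec_psi (k : nat) : B := fun b =>
  if (b None == 0%N) && (bmu b != 0) then s (bi k (bmu b)) else 0.
Definition dec_eta : B := fun b =>
  if (b None != N) && (b != 0) then s (bi (b None + N) (bmu b)) else 0.
Definition dec_be : B := fun b =>
  if b None == 0%N then s (bi (2 * N) (bmu b)) else 0.

Definition dec_lin : B :=
  \sum_(k < N) x ^+ k * dec_psi k + x ^+ (2 * N) * dec_be +
  psC a * (x ^+ N * ((2 * N)%:R * dec_eta - 2%:R * (x * dB dec_eta))).

Definition dec_non : B :=
  psC a * x ^+ N * binrest (2 * N).+1 dec_eta +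
  \sum_(k < N) dec_psi k * x ^+ k * ((1 + dec_eta) ^+ (2 * k).+1 - 1) +
  dec_be * x ^+ (2 * N) * ((1 + dec_eta) ^+ (4 * N).+1 - 1) -
  (Rr - psC a * x ^+ N) * (1 + dec_eta + 2%:R * (x * dB dec_eta)).

Lemma FB_dec_eta : FB 1 dec_eta.
Proof. by apply: FB_coef0; rewrite /dec_eta eqxx andbF. Qed.

Lemma dec_psi_mu k : muonly (dec_psi k).
Proof. by move=> b /negPf b0; rewrite /dec_psi b0. Qed.

Lemma dec_psi0 k : dec_psi k 0 = 0.
Proof.
rewrite /dec_psi (_ : bmu 0 = 0) ?eqxx ?andbF //.
by apply/ffunP=> i; rewrite !ffunE.
Qed.

Lemma dec_be_mu : muonly dec_be.
Proof. by move=> b /negPf b0; rewrite /dec_be b0. Qed.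

Lemma FB_pow_eta M : FB 1 ((1 + dec_eta) ^+ M - 1).
Proof.
by rewrite -{2}(expr1n _ M); apply: FilB_X; rewrite addrC addKr; apply: FB_dec_eta.
Qed.

(** Places without an unknown: there all terms of the equation vanish for reasons
    of weight. *)
Definition dec_free b := (bmu b == 0) && (b None <= N)%N.

Definition dec_diag b : K :=
  if (b None < N)%N || (b None == 2 * N)%N then 1
  else a * (2%:R * ((2 * N)%:R - (b None)%:R)).

Lemma dec_diag_neq0 b : dec_diag b != 0.
Proof.
rewrite /dec_diag; case: ifP; first by rewrite oner_eq0.
move=> /negbT; rewrite negb_or => /andP[_ b2].
by rewrite !mulf_neq0 ?pnatr_eq0 // subr_eq0 eqr_nat eq_sym.
Qed.

Lemma coef_dec_lin b : dec_lin b = if dec_free b then 0 else dec_diag b * s b.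
Proof.
rewrite -{1}(biK b); set i := b None; set n := bmu b.
rewrite /dec_lin !ps_addE ps_sumE coef_psCM !coef_xM.
have sE : \sum_(k < N) (x ^+ k * dec_psi k) (bi i n) =
   if (i < N)%N && (n != 0) then s b else 0.
  have t (k : nat) : (x ^+ k * dec_psi k) (bi i n) =
      if (i == k) && (n != 0) then s b else 0.
    rewrite coef_xM /dec_psi bi_None bmu_bi.
    case: (ltngtP k i) => ki.
    - by rewrite subn_eq0 leqNgt ki.
    - by [].
    - rewrite ki subnn eqxx /=; case: ifP => // _.
      by rewrite /i /n biK.
  under eq_bigr do rewrite t.
  case: (ltnP i N) => iN /=; last first.
    by rewrite big1 // => k _; case: eqP => //= e; have := ltn_ord k; lia.
  rewrite (bigD1 (Ordinal iN)) //= eqxx /= big1 ?addr0 // => k ik.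
  case: eqP => //= e; case/eqP: ik; exact/val_inj.
rewrite sE; have etaE : (if (N <= i)%N then ((2 * N)%:R * dec_eta - 2%:R * (x * dB dec_eta))
    (bi (i - N) n) else 0) =
    if (N <= i)%N && ((i - N != N)%N && ~~ ((i == N) && (n == 0))) then
      (2%:R * ((2 * N)%:R - i%:R)) * s b else 0.
  case: leqP => //= Ni; rewrite ps_addE ps_oppE.
  rewrite -[(2 * N)%:R](rmorph_nat psC) -[2%:R](rmorph_nat psC) !coef_psCM coef_xd.
  rewrite bi_None /dec_eta bi_None bi_eq0 bmu_bi subnK // biK.
  have -> : (i - N == 0)%N = (i == N) by rewrite subn_eq0 eqn_leq Ni andbT.
  case: ifP => _; last by rewrite !mulr0 subrr.
  by rewrite natrB // natrM; ring.
rewrite etaE /dec_be bi_None bmu_bi /dec_free /dec_diag -/i -/n.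
have [iN|Ni] := ltnP i N => /=.
  rewrite (ltnW iN) andbT leqNgt (leq_trans iN) ?leq_pmull //= mulr0 !addr0.
  by case: (n == 0); rewrite /= ?mul1r.
have [i2|i2] := eqVneq i (2 * N)%N.
  rewrite -i2 leqnn subnn eqxx /= add0r.
  have -> : (i - N == N)%N by apply/eqP; lia.
  have -> : (i <= N)%N = false by apply/negbTE; rewrite -ltnNge; lia.
  by rewrite /= mulr0 addr0 andbF mul1r i2 /n -i2 biK.
have -> : (if (2 * N <= i)%N then
     (if (i - 2 * N)%N == 0%N then s (bi (2 * N) n) else 0) else 0) = 0.
  by case: leqP => // le; rewrite subn_eq0 leqNgt ltn_neqAle eq_sym i2 le.
have -> : (i - N != N)%N by apply/eqP => e; case/eqP: i2; lia.
have -> : (i <= N)%N = (i == N) by rewrite eqn_leq Ni andbT.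
by case: (i == N); case: (n == 0); rewrite /= !add0r ?mulr0 ?mulrA.
Qed.

Lemma FB_dec_non : FB N.+1 dec_non.
Proof.
rewrite /dec_non; apply: FilB; last by apply: FilMr; apply: FB_Rr.
apply: FilD; first apply: FilD.
- apply: Fil_le (FilM (FilMl _ (@FilX1 _ _ _ N _ x1)) (FB_binrest _ FB_dec_eta)); lia.
- apply: Fil_sum => k _; do 2!apply: FilMr.
  by apply: muonly_FB; [apply: dec_psi_mu | apply: dec_psi0].
- apply: Fil_le (FilM (FilMl _ (@FilX1 _ _ _ (2 * N) _ x1)) (FB_pow_eta (4 * N).+1)); lia.
Qed.

End Decode.

(** Every unknown occurs in the nonlinear part multiplied by something of positive
    relative weight. *)
Lemma dec_non_contraction k (s s' : B) : (forall b, (wt (@wB m N) b < k)%N -> s b = s' b) ->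
  FB k.+1 (dec_non s - dec_non s').
Proof.
move=> ss.
have eta_d : FB (k - N) (dec_eta s - dec_eta s').
  move=> b bk; rewrite ps_addE ps_oppE /dec_eta; case: ifP => _; last by rewrite subrr.
  rewrite ss ?subrr // wt_bB addnAC -wt_wB; lia.
have psi_d i : (i < N)%N -> FB k ((dec_psi s i - dec_psi s' i) * x ^+ i).
  move=> iN b bk; rewrite mulrC -(biK b) coef_xM.
  case: leqP => // ib; rewrite ps_addE ps_oppE /dec_psi bi_None bmu_bi.
  case: ifP => [/andP[/eqP e _]|_]; last by rewrite subrr.
  rewrite ss ?subrr // wt_bB; move: bk; rewrite wt_wB.
  by have -> : b None = i by apply/eqP; rewrite eqn_leq -subn_eq0 e ib.
have be_d : FB k ((dec_be s - dec_be s') * x ^+ (2 * N)).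
  move=> b bk; rewrite mulrC -(biK b) coef_xM.
  case: leqP => // ib; rewrite ps_addE ps_oppE /dec_be bi_None bmu_bi.
  case: eqP => [e|_]; last by rewrite subrr.
  rewrite ss ?subrr // wt_bB; move: bk; rewrite wt_wB.
  by have -> : b None = (2 * N)%N by apply/eqP; rewrite eqn_leq -subn_eq0 e ib.
have e1 := FB_dec_eta s; have e1' := FB_dec_eta s'.
have pow_d M : FB (k - N) ((1 + dec_eta s) ^+ M - (1 + dec_eta s') ^+ M).
  by apply: FilB_X; rewrite opprD addrACA subrr add0r.
rewrite /dec_non.
have -> : forall p q r t p' q' r' t' : B, p + q + r - t - (p' + q' + r' - t') =
  (p - p') + (q - q') + (r - r') - (t - t') by move=> *; ring.
apply: FilB; first apply: FilD; first apply: FilD.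
- rewrite -mulrBr.
  apply: Fil_le (FilM (FilMl _ (@FilX1 _ _ _ N _ x1)) (FB_binrest_diff _ e1 e1' eta_d)).
  lia.
- rewrite -sumrB; apply: Fil_sum => i _.
  have -> : forall p p' X q q' : B, p * X * q - p' * X * q' =
    (p - p') * X * q + p' * X * (q - q') by move=> *; ring.
  apply: FilD.
    by apply: Fil_le (FilM (psi_d i (ltn_ord i)) (FB_pow_eta s _)); lia.
  have p1 : FB N.+1 (dec_psi s' i).
    by apply: muonly_FB; [apply: dec_psi_mu | apply: dec_psi0].
  rewrite opprB addrA subrK.
  by apply: Fil_le (FilM (FilMr _ p1) (pow_d _)); lia.
- have -> : forall p p' X q q' : B, p * X * q - p' * X * q' =
    (p - p') * X * q + p' * X * (q - q') by move=> *; ring.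
  apply: FilD; first by apply: Fil_le (FilM be_d (FB_pow_eta s _)); lia.
  rewrite opprB addrA subrK.
  by apply: Fil_le (FilM (FilMl _ (@FilX1 _ _ _ (2 * N) _ x1)) (pow_d _)); lia.
- rewrite -mulrBr.
  have -> : forall p q p' q' : B, 1 + p + q - (1 + p' + q') = (p - p') + (q - q').
    by move=> *; ring.
  have dd : FB (k - N) (2%:R * (x * dB (dec_eta s)) - 2%:R * (x * dB (dec_eta s'))).
    rewrite -mulrBr -mulrBr -(cdB (cder_dB K m)).
    by apply: FilMl; apply: Fil_xd.
  by apply: Fil_le (FilM FB_Rr (FilD eta_d dd)); lia.
Qed.

(** The equation says that z -> z h carries the radial part Rr to
    a rho^N + sum_k psi_k rho^k + beta rho^(2N).  It has the form
    [dec_lin s + dec_non s = 0], whose linear part is diagonal and invertible outside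
    the free places. *)
Lemma radial_form_exists : exists (h : B) (psi : 'I_N -> B) (be : B),
  [/\ h 0 = 1, forall k, muonly (psi k), forall k, psi k 0 = 0, muonly be &
  h * (psC a * x ^+ N * h ^+ (2 * N) + \sum_(k < N) psi k * x ^+ k * h ^+ (2 * k)
       + be * x ^+ (2 * N) * h ^+ (4 * N)) = Rr * (h + 2%:R * (x * dB h))].
Proof.
have [k s s' ss b bk|s0 s0E] := @contraction_fixpoint _ K 0 (wt (@wB m N))
  (fun (s : B) (b : mindex (option 'I_m)) => - dec_non s b / dec_diag b).
  have /eqP := dec_non_contraction ss bk; rewrite ps_addE ps_oppE subr_eq0 => /eqP ->.
  by [].
have [s sE] : exists s : B, forall b, s b = - dec_non s b / dec_diag b by exists s0.
have eq0 : dec_lin s + dec_non s = 0.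
  apply/ps_ext=> b; rewrite ps_addE coef_dec_lin; case: ifP => bx.
    rewrite add0r; apply: FB_dec_non; move: bx; rewrite /dec_free wt_wB => /andP[/eqP -> bN].
    by rewrite mdeg0 muln0 addn0 ltnS.
  by rewrite sE mulrC divfK ?dec_diag_neq0 // addNr.
exists (1 + dec_eta s), (fun k => dec_psi s k), (dec_be s).
split.
- by rewrite ps_addE coef01 (_ : dec_eta s 0 = 0) ?addr0 // /dec_eta eqxx andbF.
- by move=> k; apply: dec_psi_mu.
- by move=> k; apply: dec_psi0.
- exact: dec_be_mu.
apply/eqP; rewrite -subr_eq0; apply/eqP; rewrite -[RHS]eq0.
set e := dec_eta s.
have -> : dB (1 + e) = dB e by rewrite (cdD (cder_dB K m)) (cd1 (cder_dB K m)) add0r.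
rewrite /dec_lin /dec_non -/e /binrest.
have -> : \sum_(k < N) dec_psi s k * x ^+ k * ((1 + e) ^+ (2 * k).+1 - 1) =
  (1 + e) * (\sum_(k < N) dec_psi s k * x ^+ k * (1 + e) ^+ (2 * k)) -
  \sum_(k < N) x ^+ k * dec_psi s k.
  rewrite mulr_sumr -sumrB; apply: eq_bigr => k _; rewrite exprS; ring.
rewrite ![(1 + e) ^+ (_).+1]exprS -[(2 * N).+1%:R]natr1.
move: ((1 + e) ^+ (2 * N)) ((1 + e) ^+ (4 * N)) (\sum_(k < N) _)
  (\sum_(k < N) _) (x ^+ (2 * N)) (x ^+ N) (dB e) => p4 p2 s1 s2 y2 y1 de.
ring.
Qed.

(** Differentiate the equation in the direction c of the parameter space and
    compare the terms of weight less than N: if c is in the kernel of the linear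
    parts of the psi_k, the derivative of the left-hand side vanishes there, and
    Rr is multiplied by a unit on the right. *)
Lemma radial_form_linear_part (h : B) (psi : 'I_N -> B) (be : B) (c : 'I_m -> K) :
  h 0 = 1 -> (forall k, muonly (psi k)) -> (forall k, psi k 0 = 0) ->
  h * (psC a * x ^+ N * h ^+ (2 * N) + \sum_(k < N) psi k * x ^+ k * h ^+ (2 * k)
       + be * x ^+ (2 * N) * h ^+ (4 * N)) = Rr * (h + 2%:R * (x * dB h)) ->
  (forall k, \sum_i c i * psi k (bi 0 (munit i)) = 0) ->
  forall j, (j < N)%N -> \sum_i c i * Rr (bi j (munit i)) = 0.
Proof.
move=> h0 psi_mu psi_0 e c0 j jN.
pose D (f : B) : B := \sum_i psC (c i) * pd (Some i) f.
have DP : cder id D.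
  have P i := cder_mul (psC (c i)) (cder_pd K (Some i : option 'I_m)).
  split=> [f g|f g|d|k f fk]; rewrite /D.
  - by rewrite -sumrB; apply: eq_bigr => i _; rewrite (cdB (P i)).
  - rewrite mulr_suml mulr_sumr -big_split; apply: eq_bigr => i _.
    by rewrite (cdM (P i)).
  - by rewrite big1 // => i _; rewrite (cdC (P i)).
  - by apply: Fil_sum => i _; apply: (cdF (P i)).
have Dx k : D (x ^+ k) = 0.
  rewrite /D big1 // => i _; rewrite (cdX (cmor_id _ _) (cder_pd K (Some i : option 'I_m))).
  by rewrite pd_psX mulr0 mul0rn mulr0.
have psiF k : FB N.+1 (psi k) by apply: muonly_FB.
have DpsiF k : FB N (D (psi k)).
  move=> b bN; have bm : bmu b = 0.
    move: bN; rewrite wt_wB => bN.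
    by apply/eqP; rewrite -mdeg_eq0; apply/eqP; case: (mdeg _) bN => //; lia.
  rewrite /D ps_sumE; under eq_bigr do rewrite coef_psCM /pd /fpsD.
  have [b0|b0] := eqVneq (b None) 0%N; last first.
    rewrite big1 // => i _; rewrite psi_mu ?mulr0 // !ffunE /=.
    by rewrite addn_eq0 negb_and b0.
  rewrite -[RHS](c0 k); apply: eq_bigr => i _; congr (_ * _).
  have -> : b = 0 by rewrite -(biK b) b0 bm; apply/eqP; rewrite bi_eq0 !eqxx.
  rewrite ffunE mul1r; congr (psi k _).
  by apply/ffunP=> -[l|]; rewrite !ffunE //= ?add0r.
have RrF : FB N Rr.
  rewrite -(subrK (psC a * x ^+ N) Rr); apply: FilD; first exact: Fil_le FB_Rr.
  by apply: FilMl; apply: FilX1.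
have xF k (u : B) : (N <= k)%N -> FB N (x ^+ k * u).
  by move=> Nk; apply: FilMr; apply: Fil_le (@FilX1 _ _ _ k _ x1).
have DL : FB N (D (h * (psC a * x ^+ N * h ^+ (2 * N) +
       \sum_(k < N) psi k * x ^+ k * h ^+ (2 * k)
       + be * x ^+ (2 * N) * h ^+ (4 * N)))).
  set u := _ + _ + _.
  have uF : FB N u.
    apply: FilD; first apply: FilD.
    - by rewrite -mulrA; apply: FilMl; apply: xF.
    - by apply: Fil_sum => k _; do 2!apply: FilMr; apply: Fil_le (psiF k).
    - by rewrite -mulrA; apply: FilMl; apply: xF; lia.
  rewrite (cdM DP); apply: FilD; first exact: FilMl.
  apply: FilMl; rewrite /u !(cdD DP) (cd_sum DP); apply: FilD; first apply: FilD.
  - rewrite -mulrA (cdM DP) (cdC DP) mul0r add0r (cdM DP) Dx mul0r add0r.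
    by apply: FilMl; apply: xF.
  - apply: Fil_sum => k _; rewrite -mulrA (cdM DP); apply: FilD.
      by apply: FilMr; apply: DpsiF.
    by apply: FilMr; apply: Fil_le (psiF k).
  - rewrite -mulrA (cdM DP) (cdM DP) Dx mul0r add0r.
    by apply: FilD; apply: FilMl; apply: xF; lia.
rewrite e (cdM DP) in DL.
have DR : FB N ((h + 2%:R * (x * dB h)) * D Rr).
  have -> : (h + 2%:R * (x * dB h)) * D Rr = (D Rr * (h + 2%:R * (x * dB h)) +
    Rr * D (h + 2%:R * (x * dB h))) - Rr * D (h + 2%:R * (x * dB h)) by ring.
  by apply: FilB => //; apply: FilMr.
have u1 : FB 1 (h + 2%:R * (x * dB h) - 1).
  have -> : h + 2%:R * (x * dB h) - 1 = (h - 1) + 2%:R * (x * dB h) by ring.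
  apply: FilD; last by apply: FilMl; apply: FilMr.
  by apply: FB_coef0; rewrite ps_addE ps_oppE h0 coef01 subrr.
have := Fil_unit_cancel u1 DR; move=> /(_ (bi j 0)); rewrite wt_bB mdeg0 muln0 addn0.
move=> /(_ jN); rewrite /D ps_sumE => E; rewrite -[RHS]E; apply: eq_bigr => i _.
rewrite coef_psCM /pd /fpsD ffunE ffunE mul1r; congr (_ * Rr _).
by apply/ffunP=> -[l|]; rewrite !ffunE ?addr0 ?add0r.
Qed.

End RadialExistence.

(** * The tangent space of the first level *)

Section LevelOne.
Variables (R : realType) (m alpha : nat).
Hypothesis alpha_gt0 : (0 < alpha)%N.
Local Notation C := R[i].
Local Notation A := (ps (pvar m) C).
Local Notation vf := (vfield R m).
Local Notation zv := (@zv R m).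
Local Notation wv := (@wv R m).
Local Notation dz := (@dz R m).
Local Notation dw := (@dw R m).
Local Notation Jc := (@Jc R m).
Local Notation rotd := (@rotd R m).
Local Notation ii := ('i%C : C).
Implicit Types (f g h : A) (q : mindex (pvar m)) (u v S : vf).

Definition mkV f : vf := fun c => if c == ord0 then f else Jc f.

Lemma mkVK v : symm v -> mkV (vz v) = v.
Proof. by move=> vs; apply: vf_ext => //; rewrite vs. Qed.

(** The grade plus one, additive under products. *)
Definition wg : pvar m -> nat := fun i => if i is inl _ then 1%N else alpha.

Lemma wt_wg q : wt wg q = (zdeg q + wdeg q + alpha * mdeg (mupart q))%N.
Proof.
rewrite wt_pvar /= !mul1n; congr (_ + _)%N.
by rewrite /wt /mdeg big_distrr.
Qed.

Lemma gradeLE q : gradeL alpha q = (wt wg q).-1.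
Proof. by rewrite wt_wg. Qed.

Lemma gradeL_swap q : gradeL alpha (swapzw q) = gradeL alpha q.
Proof. by rewrite /gradeL zdeg_swap wdeg_swap mupart_swap [(wdeg q + _)%N]addnC. Qed.

Lemma Ldom_wg f : (forall q, ~~ Ldom q -> f q = 0) -> Fil wg 2 f.
Proof.
move=> H q q2; apply: H; apply/negP => /(Ldom_grade alpha_gt0).
by rewrite gradeLE; lia.
Qed.

Lemma Fil_wg_Jc k f : Fil wg k f -> Fil wg k (Jc f).
Proof.
move=> fk q qk; rewrite !JcE fk ?conjc0 //.
by move: qk; rewrite !wt_wg zdeg_swap wdeg_swap mupart_swap [(wdeg q + _)%N]addnC.
Qed.

Lemma Fil_wg_dz k f : Fil wg k.+1 f -> Fil wg k (dz f).
Proof.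
by move=> fk q qk; rewrite coef_dz fk ?mulr0 // wtD wt_munit /= addn1.
Qed.

Lemma Fil_wg_dw k f : Fil wg k.+1 f -> Fil wg k (dw f).
Proof.
move=> fk; rewrite -(JcK f) -Jc_dz; apply/Fil_wg_Jc/Fil_wg_dz.
exact: Fil_wg_Jc.
Qed.

Definition projz (n : nat) f : A := fun q => if gradeL alpha q == n then f q else 0.

Lemma projL_mk n v : symm v -> projL alpha n v = mkV (projz n (vz v)).
Proof.
move=> vs; apply: vf_ext; first by [].
apply/ps_ext=> q; rewrite /vw /projL /mkV /= !JcE /projz gradeL_swap.
case: ifP => _; last by rewrite conjc0.
by have := congr1 (fun h : A => h q) vs.
Qed.

(** Fields with linear part Y_10. *)
Definition lin_rot v := (forall q, ~~ Ldom q -> (vz v - psC ii * zv) q = 0).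

Lemma dmap0E v (T : timespace R m) S c :
  dmap v (fun _ _ => 0) T S c = (tlift T : A) * (v c : A) + (bracket S v c : A) :> A.
Proof.
have D0 : Dmu v (fun _ _ => 0) c = 0 :> A.
  apply: (big1 (op := +%R : A -> A -> A)) => k _.
  transitivity ((fpsD (inr k) (v c) : A) * mulift (0 : ps 'I_m R)); first by [].
  by rewrite (cm0 (cmor_mulift R m)) mulr0.
transitivity ((Dmu v (fun _ _ => 0) c : A) + (tlift T : A) * (v c : A) +
  (bracket S v c : A)); first by [].
by rewrite D0 add0r.
Qed.

Lemma tlift_Jc (T : timespace R m) : Jc (tlift T) = tlift T.
Proof. by rewrite tliftE Jc_rlift. Qed.

Lemma tlift_wg n (T : timespace R m) : FR alpha n T -> Fil wg n (tlift T).
Proof.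
move=> TF q; rewrite wt_wg /tlift => qn; case: eqP => // zw.
by rewrite TF ?rmorph0 //; move: qn; rewrite -zw; lia.
Qed.

(** For T and S of grade at least n, the grade n part of T v + [S, v] only sees the linear
    part of v; the bracket with it is i (rotation - identity). *)
Lemma tangent_first_order n v (T : timespace R m) g : (0 < n)%N -> symm v -> lin_rot v ->
  FR alpha n T -> (forall q, ~~ Ldom q -> g q = 0) -> Fil wg n.+1 g ->
  tangentT alpha 1 n v
    (mkV (projz n ((tlift T : A) * (psC ii * zv) + psC ii * (rotd g - g)))).
Proof.
move=> n0 vs v10 TF gL gF.
pose S := mkV g; pose v' : vf := mkV (vz v - psC ii * zv).
have v'F : Fil wg 2 (vz v') by apply: Ldom_wg.
have v'Fw : Fil wg 2 (vw v') by apply: Fil_wg_Jc.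
have gJ : Fil wg n.+1 (Jc g) by apply: Fil_wg_Jc.
have zE : vz v = psC ii * zv + vz v' by rewrite /v' /vz /mkV /=; ring.
have wE : vw v = - (psC ii * wv) + vw v'.
  have JC (c : C) : Jc (psC c) = psC (conjc c) := cmC (cmor_Jc R m) c.
  rewrite vs zE (cmD (cmor_Jc R m)) (cmM (cmor_Jc R m)) JC Jc_z.
  by rewrite conj_i rmorphN mulNr.
have dS : vz (dmap v (fun _ _ => 0) T S) =
   (tlift T : A) * (psC ii * zv) + psC ii * (rotd g - g) +
   ((tlift T : A) * vz v' + (Dv v' g - Dv S (vz v'))).
  rewrite {1}/vz dmap0E bracketE -/(vz v) -/(vz S).
  have -> : vz S = g by [].
  rewrite [Dv v g]/Dv [Dv S (vz v)]/Dv zE wE.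
  have -> : vz S = g by [].
  rewrite (cdD (cder_dz R m) (psC ii * zv)) (cdD (cder_dw R m) (psC ii * zv)).
  rewrite (cdM (cder_dz R m)) (cdM (cder_dw R m)) dz_z dw_z (cdC (cder_dz R m)).
  rewrite (cdC (cder_dw R m)) [Dv v' g]/Dv [Dv S (vz v')]/Dv.
  have -> : vz S = g by [].
  by rewrite !rotdE; ring.
have ms : symm (dmap v (fun _ _ => 0) T S).
  rewrite /symm /vw /vz !dmap0E (cmD (cmor_Jc R m)) (cmM (cmor_Jc R m)) tlift_Jc.
  congr (_ * _ + _); first exact: vs.
  exact: (symm_bracket (u := S) (v := v)).
have [z2 zw1] := (Ldom_supp _).1 gL.
have [v2 vw1] := (Ldom_supp _).1 v10.
have SF : FilV 2 S by split=> //; apply: (cmF (cmor_Jc R m)).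
have v1 : Fil w1 1 (vz v).
  rewrite zE; apply: FilD; last exact: Fil_le v2.
  by apply: FilMl; apply: Fil_zv.
have vF1 : FilV 1 v by split=> //; rewrite vs; apply: (cmF (cmor_Jc R m)).
have vzw : Fil (@wzw m) 1 (vz v).
  rewrite zE; apply: FilD => //.
  apply: FilMl; exact: (@Fil_psX _ _ (@wzw m) (pz m)).
have Jzw f : Fil (@wzw m) 1 f -> Fil (@wzw m) 1 (Jc f).
  move=> fz q qz; rewrite !JcE fz ?conjc0 //.
  by move: qz; rewrite !wt_wzw zdeg_swap wdeg_swap addnC.
have T1 : Fil w1 1 (tlift T : A).
  rewrite tliftE; apply/Fil1_coef0.
  rewrite (cm_coef0 (cmor_rlift R m)) TF ?rmorph0 // !ffunE muln0 add0n.
  have -> : bmu (0 : mindex (option 'I_m)) = 0 by apply/ffunP=> k; rewrite !ffunE.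
  by rewrite mdegE wt0 muln0.
have dL q : ~~ Ldom q -> vz (dmap v (fun _ _ => 0) T S) q = 0.
  apply: (Ldom_supp _).2; rewrite /vz dmap0E bracketE -/(vz v) -/(vz S); split.
    apply: FilD; first exact: (FilM T1 v1).
    by apply: FilB; [apply: (Dv_Fil vF1 z2) | apply: (Dv_Fil SF v1)].
  apply: FilD; first exact: FilMl.
  apply: FilB; rewrite /Dv; apply: FilD; apply: FilMr => //.
    by rewrite vs; apply: Jzw.
  exact: Jzw.
have restF : Fil wg n.+2 ((tlift T : A) * vz v' + (Dv v' g - Dv S (vz v'))).
  apply: FilD.
    by have := FilM (tlift_wg TF) v'F; rewrite addn2.
  apply: FilB; rewrite /Dv; apply: FilD.
  - by have := FilM v'F (Fil_wg_dz gF); rewrite add2n.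
  - by have := FilM v'Fw (Fil_wg_dw gF); rewrite add2n.
  - by have := FilM gF (Fil_wg_dz v'F); rewrite addn1.
  - by have := FilM gJ (Fil_wg_dw v'F); rewrite addn1.
have mainF : Fil wg n.+1 ((tlift T : A) * (psC ii * zv) + psC ii * (rotd g - g)).
  apply: FilD.
    have zF : Fil wg 1 (psC ii * zv).
      apply: FilMl; exact: (@Fil_psX _ _ wg (pz m)).
    by have := FilM (tlift_wg TF) zF; rewrite addn1.
  apply: FilMl; apply: FilB => // q qn.
  by rewrite coef_rotd gF ?mulr0.
have nn : maxn (n.+1 - 1) 1 = n by rewrite subn1; apply/maxn_idPl.
exists (fun _ _ => 0), T, S; rewrite nn; split.
- split=> //; split.
    apply: inL_intro => // [q nq _|]; first exact: gL.
    by rewrite [vz S _]gL // Ldom_mi100.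
  move=> c q qn; have wq : (wt wg q < n.+1)%N by move: qn; rewrite gradeLE; lia.
  by case: (ord2_cases c) => ->; [apply: gF | apply: gJ].
- split.
    apply: inL_intro => // [q nq _|]; first exact: dL.
    by rewrite dL // Ldom_mi100.
  have H q : (wt wg q < n.+1)%N -> vz (dmap v (fun _ _ => 0) T S) q = 0.
    move=> qn; rewrite dS ps_addE mainF // restF ?addr0 //.
    exact: ltnW.
  move=> c q qn; have wq : (wt wg q < n.+1)%N by move: qn; rewrite gradeLE; lia.
  case: (ord2_cases c) => ->; first exact: H.
  rewrite -[LHS]/(vw (dmap v (fun _ _ => 0) T S) q) ms !JcE H ?conjc0 //.
  by move: wq; rewrite !wt_wg zdeg_swap wdeg_swap mupart_swap [(wdeg q + _)%N]addnC.
- rewrite projL_mk // dS; congr mkV; apply/ps_ext=> q; rewrite /projz.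
  case: eqP => // gq; rewrite [RHS]ps_addE restF ?addr0 //.
  by move: gq; rewrite gradeLE; lia.
Qed.

Lemma vz_Xq q : vz (@Xq R m q) = mon q. Proof. by []. Qed.
Lemma vz_Yq q : vz (@Yq R m q) = psC ii * mon q.
Proof. by apply/ps_ext=> p; rewrite coef_psCM. Qed.

Lemma rotd_mon q : rotd (mon q) = psC ((zdeg q)%:R - (wdeg q)%:R) * mon q.
Proof.
apply/ps_ext=> p; rewrite coef_rotd coef_psCM /mon.
by case: eqP => [->|]; rewrite ?mulr0.
Qed.

Lemma projz_mon n q (c : C) : gradeL alpha q = n ->
  projz n (psC c * mon q) = psC c * mon q.
Proof.
move=> qn; apply/ps_ext=> p; rewrite /projz coef_psCM /mon.
case: (p =P q) => [->|]; first by rewrite qn eqxx.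
by rewrite mulr0 if_same.
Qed.

Lemma Fil_wg_mon n q (c : C) : gradeL alpha q = n -> (0 < n)%N ->
  Fil wg n.+1 (psC c * mon q).
Proof.
move=> qn n0; apply: FilMl; apply: Fil_le (@Fil_mon _ _ wg q).
by move: qn; rewrite gradeLE; lia.
Qed.

(** The monomial z^j w^k has eigenvalue i (j - k - 1) under the bracket with the
    linear part, hence is an image of that bracket unless j = k + 1.  In the
    resonant case Y_{(k+1)k} is i z times a series in z w, reached by the time
    change. *)
Lemma tangent_nonres n v (t : lmono m) : (0 < n)%N -> symm v -> lin_rot v ->
  inLmono t -> gradeL alpha t.2 = n ->
  ~~ (t.1 && (zdeg t.2 == (wdeg t.2).+1)) ->
  tangentT alpha 1 n v (lbasis R t).
Proof.
case: t => b q /= n0 vs v10 tL qn nres.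
have Lq : Ldom q.
  case/orP: tL => // /eqP[_ e]; move: n0.
  by rewrite -qn e /gradeL !miE mdegE wt0 muln0.
have LF (c : C) p : ~~ Ldom p -> (psC c * mon q) p = 0.
  rewrite coef_psCM /mon; case: (p =P q) => [->|]; rewrite ?mulr0 //.
  by rewrite Lq.
pose T0 : timespace R m := fun _ _ => 0.
have FR0 : FR alpha n T0 by [].
have tl0 : tlift T0 = 0 :> A.
  by apply/ps_ext=> p; rewrite /tlift; case: ifP => //; rewrite rmorph0.
have bs : symm (lbasis R (b, q)).
  by rewrite /lbasis; case: (b); [apply: symm_Xq | apply: symm_Yq].
have [zq|zq] := eqVneq (zdeg q) (wdeg q).+1.
  have bF : b = false by move: nres; rewrite /= zq eqxx andbT => /negbTE.
  pose T : timespace R m := fun k p => ((k == wdeg q) && (p == mupart q))%:R.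
  have TF : FR alpha n T.
    move=> k p kn; rewrite /T; case: eqP => // kq; case: eqP => // pq.
    by move: kn qn; rewrite /gradeL zq kq pq; lia.
  have TE : (tlift T : A) * (psC ii * zv) = psC ii * mon q.
    have -> : tlift T = mon (mi (wdeg q) (wdeg q) (mupart q)) :> A.
      have -> : mi (wdeg q) (wdeg q) (mupart q) = mi (bi (wdeg q) (mupart q) None)
          (bi (wdeg q) (mupart q) None) (bmu (bi (wdeg q) (mupart q))).
        by rewrite bi_None bmu_bi.
      rewrite tliftE -rlift_mon; congr rlift; apply/ps_ext=> p; rewrite /T /mon; congr (_%:R).
      congr nat_of_bool; apply/andP/eqP=> [[/eqP <- /eqP <-]|->]; first by rewrite biK.
      by rewrite bi_None bmu_bi !eqxx.
    rewrite mulrCA; congr (_ * _).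
    rewrite zvE -monD.
    congr mon; apply: mi_ext; rewrite ?(zdegD, wdegD, mupartD) !miE.
    - by rewrite zdeg_munit eqxx addn1 zq.
    - by rewrite wdeg_munit addn0.
    - by rewrite mupart_munit_inl addr0.
  have := @tangent_first_order n v T 0 n0 vs v10 TF (fun _ _ => erefl) (@Fil0 _ _ _ _).
  rewrite (cd0 (cder_rotd R m)) subrr mulr0 addr0 TE projz_mon //.
  by rewrite -vz_Yq mkVK ?bF //; apply: symm_Yq.
pose d : C := (zdeg q)%:R - (wdeg q)%:R - 1.
have d0 : d != 0.
  rewrite /d -addrA -opprD subr_eq0 -[1]/(1%:R) -natrD eqr_nat addn1.
  exact: zq.
pose s : C := if b then - ii / d else 1 / d.
have := @tangent_first_order n v T0 (psC s * mon q) n0 vs v10 FR0 (LF s) (Fil_wg_mon s qn n0).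
rewrite tl0 mul0r add0r (cdZ (cmor_id _ _) (cder_rotd R m)) rotd_mon.
have -> : psC ii * (psC s * (psC ((zdeg q)%:R - (wdeg q)%:R) * mon q) - psC s * mon q)
    = psC (ii * (s * d)) * mon q.
  by rewrite /d !rmorphM !rmorphB rmorph1 /=; ring.
rewrite projz_mon // {LF tl0 FR0}.
have -> : psC (ii * (s * d)) * mon q = vz (lbasis R (b, q)).
  rewrite /s /lbasis /=; case: (b).
    rewrite divfK // vz_Xq mulrN -expr2.
    have -> : - (ii ^+ 2) = 1 by rewrite sqr_i opprK.
    by rewrite rmorph1 mul1r.
  by rewrite divfK // mulr1 vz_Yq.
by rewrite mkVK.
Qed.

End LevelOne.

(** * Radial fields and the first level *)

Section NormalForms.
Variables (R : realType) (m : nat).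
Local Notation C := R[i].
Local Notation A := (ps (pvar m) C).
Local Notation B := (ps (option 'I_m) R).
Local Notation Mu := (ps 'I_m R).
Local Notation vf := (vfield R m).
Local Notation zv := (@zv R m).
Local Notation wv := (@wv R m).
Local Notation Jc := (@Jc R m).
Local Notation rotd := (@rotd R m).
Local Notation ii := ('i%C : C).
Implicit Types (f g h : A) (q : mindex (pvar m)) (n : mindex 'I_m) (u v S : vf).

Lemma mi_shift k n : mi k.+1 k n = munit (pz m) + mi k k n.
Proof.
apply: mi_ext; rewrite ?(zdegD, wdegD, mupartD) !miE.
- by rewrite zdeg_munit eqxx.
- by rewrite wdeg_munit.
- by rewrite mupart_munit_inl add0r.
Qed.

(** The coefficients of r are those of the X_{(k+1)k} mu^n, see [coef_radfield]. *)
Definition radfield (r : B) : vf := mkV (zv * (psC ii + rlift r)).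

Lemma Jc_psC (c : C) : Jc (psC c) = psC (conjc c).
Proof. exact: (cmC (cmor_Jc R m)). Qed.

Lemma vz_radfield r : vz (radfield r) = zv * (psC ii + rlift r).
Proof. by []. Qed.
Lemma vw_radfield r : vw (radfield r) = wv * (- psC ii + rlift r).
Proof.
rewrite -[LHS]/(Jc (zv * (psC ii + rlift r))) (cmM (cmor_Jc R m)) Jc_z.
by rewrite (cmD (cmor_Jc R m)) Jc_psC Jc_rlift conj_i rmorphN.
Qed.

Lemma coef_radfield r k n : Defs.coefX (radfield r) k.+1 k n = r (bi k n).
Proof.
rewrite /Defs.coefX -[radfield r ord0]/(zv * (psC ii + rlift r)).
rewrite zvE mi_shift coef_monMD ps_addE coef_rlift /psC.
by case: eqP => _ /=; rewrite ?add0r.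
Qed.

Lemma radfield_of f : rotd f = f -> (forall q, zdeg q = (wdeg q).+1 -> conjc (f q) = f q) ->
  exists r : B, f = zv * rlift r.
Proof.
move=> rf cf; have [h fh rh] := rotd_eig1 rf.
have hE q : h q = f (munit (pz m) + q) by rewrite fh zvE coef_monMD.
have [|r hr] := rlift_surj rh; last by exists r; rewrite fh hr.
apply/ps_ext=> q; rewrite !JcE.
have [zq|zq] := eqVneq (zdeg q) (wdeg q); last first.
  by rewrite !rh ?conjc0 // zdeg_swap wdeg_swap eq_sym.
have -> : swapzw q = q by apply: mi_ext; rewrite ?zdeg_swap ?wdeg_swap ?mupart_swap.
by rewrite hE cf // zdegD wdegD zdeg_munit wdeg_munit eqxx zq.
Qed.

Section LevelOneForm.
Variable alpha : nat.
Hypothesis alpha_gt0 : (0 < alpha)%N.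
Variable e : nat -> lmono m.
Hypothesis he : basis_order alpha e.

(** A basis element in the subspace is never fresh. *)
Lemma greedy_fresh (W : vf -> Prop) (n : nat) s k : greedy alpha e W n s -> k \in s ->
  gradeL alpha (e k).2 = n /\ ~ W (lbasis R (e k)).
Proof.
elim=> [//|{}s j _ IH [jn nW] _]; rewrite mem_rcons inE => /orP[/eqP->|/IH//].
split=> // Wj; apply: nW; exists (lbasis R (e j)), 0; split=> //.
  exists (fun=> 0); rewrite big1 // => l _; exact: scale0r.
by rewrite addr0.
Qed.

Lemma espan_z s u : espan e s u -> exists c : nat -> R,
  vz u = \sum_(k <- s) psC (c k)%:C%C * vz (lbasis R (e k)) /\ symm u.
Proof.
move=> [c ->]; exists c; split.
  elim: s => [|k s IH]; first by rewrite !big_nil.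
  rewrite !big_cons -IH; apply/ps_ext=> q.
  by rewrite ps_addE coef_psCM.
elim: s => [|k s IH].
  rewrite big_nil /symm /vw /vz; exact: (esym (cm0 (cmor_Jc R m))).
rewrite big_cons; apply: symmD => //; apply: symmZ.
by rewrite /lbasis; case: ifP => _; [apply: symm_Xq | apply: symm_Yq].
Qed.

(** By [tangent_nonres] the greedy complement in positive grade is spanned by some
    of the X_{(k+1)k} mu^n; in grade 0 the only basis element is Y_10, and its
    coefficient is fixed by the assumption on the linear part. *)
Lemma first_level_radial v u : symm v -> lin_rot v ->
  (forall n : nat, normalN alpha e 1 n v (projL alpha n u)) ->
  Fil w1 2 (vz u - psC ii * zv) ->
  exists r : B, u = radfield r.
Proof.
move=> vs v10 nu u2; have [_ he2 _] := he.
have inLe k : inLmono (e k) by apply/he2; exists k.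
have pz q : vz u q = vz (projL alpha (gradeL alpha q) u) q.
  by rewrite /vz /projL eqxx.
have us : symm u.
  apply/ps_ext=> q; have [s _ es] := nu (gradeL alpha q).
  have [_ [_ ps]] := espan_z es.
  transitivity (vw (projL alpha (gradeL alpha q) u) q).
    by rewrite /vw /projL eqxx.
  rewrite ps !JcE; congr conjc.
  by rewrite /vz /projL gradeL_swap eqxx.
pose f := vz u - psC ii * zv.
have fE q : f q = vz u q - ii * (q == munit (Defs.pz m))%:R.
  by rewrite /f ps_addE ps_oppE coef_psCM zvE.
have fP q : (zdeg q != (wdeg q).+1 -> f q = 0) /\ conjc (f q) = f q.
  have [->|qz] := eqVneq q (munit (Defs.pz m)).
    rewrite /f u2 ?conjc0 //; by rewrite wt1_munit.
  have fq : f q = vz u q by rewrite fE (negPf qz) mulr0 subr0.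
  rewrite fq pz; set n := gradeL alpha q.
  have [s gs es] := nu n; have [c [cE _]] := espan_z es; rewrite cE ps_sumE.
  have [n0|n0] := posnP n.
    rewrite big1_seq ?conjc0 // => k /andP[_ ks].
    have [kn _] := greedy_fresh gs ks.
    have ek : e k = (false, mi 1 0 0).
      have := inLe k; case/orP => [/eqP//|/(Ldom_grade alpha_gt0)].
      by rewrite kn n0.
    by rewrite coef_psCM ek vz_Yq coef_psCM /mon mi100 (negPf qz) !mulr0.
  have kE k : k \in s -> exists2 p, e k = (true, p) & zdeg p = (wdeg p).+1.
    move=> ks; have [kn nW] := greedy_fresh gs ks.
    have [res|nres] := boolP ((e k).1 && (zdeg (e k).2 == (wdeg (e k).2).+1)).
      case/andP: res => b1 /eqP b2; exists (e k).2 => //.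
      by rewrite -b1 -surjective_pairing.
    by case: nW; apply: tangent_nonres.
  split=> [zq|].
    rewrite big1_seq // => k /andP[_ ks]; have [p -> pE] := kE k ks.
    rewrite coef_psCM vz_Xq /mon; case: eqP => [qp|]; last by rewrite mulr0.
    by case/eqP: zq; rewrite qp.
  rewrite rmorph_sum; apply: eq_big_seq => k ks; have [p -> pE] := kE k ks.
  by rewrite coef_psCM vz_Xq /mon [LHS]conjc_Mnat conjc_real.
have [||r fr] := @radfield_of f.
- apply/ps_ext=> q; rewrite coef_rotd.
  have [zq|/(fP q).1->] := eqVneq (zdeg q) (wdeg q).+1; last by rewrite mulr0.
  by rewrite zq -addn1 natrD addrAC subrr add0r mul1r.
- by move=> q _; apply: (fP q).2.
exists r; rewrite -(mkVK us); congr mkV.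
by rewrite mulrDr -fr /f; ring.
Qed.
End LevelOneForm.

Definition emb (p : Mu) : B := fun b => if b None == 0%N then p (bmu b) else 0.

Lemma muonly_emb p : muonly (emb p).
Proof. by move=> b /negPf; rewrite /emb => ->. Qed.

Lemma emb_inj : injective emb.
Proof.
move=> p p' pp; apply/ps_ext=> n; have := congr1 (fun f : B => f (bi 0 n)) pp.
by rewrite /emb bi_None bmu_bi.
Qed.

Lemma rlift_emb p : rlift (emb p) = mulift p.
Proof.
apply/ps_ext=> q; rewrite /rlift /emb /mulift bi_None bmu_bi.
case: eqP => [->|zw]; first by case: (wdeg q =P 0%N) => // _; rewrite rmorph0.
by case: andP => // -[/eqP z0 /eqP w0]; rewrite z0 w0 in zw.
Qed.

Lemma emb_of (f : B) : muonly f -> f = emb (fun n => f (bi 0 n)).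
Proof.
move=> fm; apply/ps_ext=> b; rewrite /emb; case: eqP => [b0|/eqP/fm//].
by rewrite -{1}(biK b) b0.
Qed.

(** The radial part of the normal forms; [rho * Qf] is [Ff]. *)
Definition Qf N (a : R) (p : 'I_N -> Mu) (b : Mu) (X : B) : B :=
  psC a * X ^+ N + \sum_(k < N) emb (p k) * X ^+ k + emb b * X ^+ (2 * N).

Lemma phi_Qf N (a : R) (p : 'I_N -> Mu) (b : Mu) X (phi : A -> A) :
  cmor idfun phi ->
  phi (rlift (Qf a p b X)) = psC a%:C%C * phi (rlift X) ^+ N +
   \sum_(k < N) phi (mulift (p k)) * phi (rlift X) ^+ k +
   phi (mulift b) * phi (rlift X) ^+ (2 * N).
Proof.
move=> P; have L := cmor_rlift R m; rewrite /Qf !(cmD L) !(cmM L) (cmC L) (cm_sum L).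
rewrite !(cmX L) !(cmD P) !(cmM P) (cmC P) (cm_sum P) !(cmX P) !rlift_emb.
congr (_ + _ + _); apply: eq_bigr => k _.
by rewrite (cmM L) (cmX L) (cmM P) (cmX P) rlift_emb.
Qed.

End NormalForms.

Lemma vinfty_radfield (R : realType) (N : nat) (s : 'S_N) (a : R)
    (b : ps 'I_N R) :
  vinfty s a b = radfield (Qf a (fun k => psX (s k)) b (@xB R N)).
Proof.
have vs : symm (vinfty s a b).
  apply: symmD; first apply: symmD; first apply: symmD.
  - exact: symm_Yq.
  - by apply: symmZ; apply: symm_Xq.
  - by apply: symm_fs; apply: symm_Xq.
  - elim/big_rec: _ => [|k v _ IH]; last by apply: symmD => //; apply: symm_Xq.
    rewrite /symm /vw /vz; exact: (esym (cm0 (cmor_Jc R N))).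
rewrite -(mkVK vs) /radfield; congr mkV.
rewrite (@phi_Qf _ _ _ _ _ _ _ id (cmor_id _ _)) rlift_rho.
have rhoX k : @zv R N * @rho R N ^+ k = mon (mi k.+1 k 0).
  rewrite mi_shift monD -zvE; congr (_ * _).
  rewrite -rlift_rho -(cmX (cmor_rlift R N)) -/(@xB R N) xBX rlift_mon.
  by rewrite bi_None bmu_bi.
have mulmi j k (u : ps 'I_N R) q : ((mulift u : ps (pvar N) R[i]) * mon (mi j k 0)) q =
   if (zdeg q == j) && (wdeg q == k) then (u (mupart q))%:C%C else 0.
  rewrite mulrC coef_monM; case: ifP => [le|/negP nle].
    have := submK le => /esym qE; rewrite {2 3 4}qE zdegD wdegD mupartD !miE add0r.
    have a0 x y : (x + y == x)%N = (y == 0%N) by rewrite -{2}[x]addn0 eqn_add2l.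
    by rewrite !a0.
  case: andP => // -[/eqP zj /eqP wk]; case: nle; apply/forallP.
  by elim/pvar_ind => [||l]; rewrite /mi ffunE /= ?ffunE // -?zj -?wk.
have fsE : vz (formal_sum (fun q => (zdeg q == (2 * N).+1)%N && (wdeg q == 2 * N)%N)
      (fun q => b (mupart q)) (@Xq R N)) = (mulift b : ps (pvar N) R[i]) * mon (mi (2 * N).+1 (2 * N) 0).
  by apply/ps_ext=> q; rewrite fsXz mulmi.
have sumE : vz (\sum_(k < N) Xjk R k.+1 k (munit (s k))) =
   \sum_(k < N) mon (mi k.+1 k (munit (s k))).
  by apply: (big_morph (@vz R N)).
transitivity (psC 'i%C * mon (mi 1 0 0) + psC a%:C%C * mon (mi N.+1 N 0) +
   (mulift b : ps (pvar N) R[i]) * mon (mi (2 * N).+1 (2 * N) 0) +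
   \sum_(k < N) mon (mi k.+1 k (munit (s k))) : ps (pvar N) R[i]).
  rewrite -fsE -sumE; apply/ps_ext=> q.
  by rewrite !ps_addE !coef_psCM.
rewrite !mulrDr mulr_sumr mi100 -zvE.
have -> : @zv R N * psC 'i%C = psC 'i%C * @zv R N by rewrite mulrC.
have -> : @zv R N * (psC a%:C%C * @rho R N ^+ N) = psC a%:C%C * mon (mi N.+1 N 0).
  by rewrite mulrCA rhoX.
have -> : @zv R N * ((mulift b : ps (pvar N) R[i]) * @rho R N ^+ (2 * N)) =
   (mulift b : ps (pvar N) R[i]) * mon (mi (2 * N).+1 (2 * N) 0) by rewrite mulrCA rhoX.
have -> : \sum_(i < N) @zv R N * ((mulift (psX (s i)) : ps (pvar N) R[i]) * @rho R N ^+ i) =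
  \sum_(k < N) mon (mi k.+1 k (munit (s k))).
  apply: eq_bigr => k _; rewrite mulrCA rhoX mulift_psX.
  rewrite muvE -monD; congr mon; apply: mi_ext; rewrite ?(zdegD, wdegD, mupartD) !miE.
  - by rewrite zdeg_munit.
  - by rewrite wdeg_munit.
  - by rewrite mupart_munit_inr addr0.
by ring.
Qed.

(** * Changes of variables *)

Section ChangesOfVariables.
Variables (R : realType) (m : nat).
Local Notation C := R[i].
Local Notation A := (ps (pvar m) C).
Local Notation B := (ps (option 'I_m) R).
Local Notation Mu := (ps 'I_m R).
Local Notation vf := (vfield R m).
Local Notation zv := (@zv R m).
Local Notation wv := (@wv R m).
Local Notation muv := (@muv R m).
Local Notation dz := (@dz R m).
Local Notation dw := (@dw R m).
Local Notation Jc := (@Jc R m).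
Local Notation rotd := (@rotd R m).
Local Notation rho := (@rho R m).
Local Notation ii := ('i%C : C).
Implicit Types (f g h : A) (q : mindex (pvar m)) (n : mindex 'I_m) (u v S : vf).

Lemma lin_rot_FilV v : symm v -> lin_rot v -> FilV 1 v.
Proof.
move=> vs v10; have [v2 _] := (Ldom_supp _).1 v10.
have v1 : Fil w1 1 (vz v).
  rewrite -(subrK (psC ii * zv) (vz v)); apply: FilD; first exact: Fil_le v2.
  by apply: FilMl; apply: Fil_zv.
by split=> //; rewrite vs; apply: (cmF (cmor_Jc R m)).
Qed.

Lemma phiS_linear_part alpha v S : symm v -> lin_rot v -> FL alpha 1 S ->
  Fil w1 2 (vz (phiS S v) - psC ii * zv).
Proof.
move=> vs v10 SF; have S2 := FL1_FilV SF; have v1 := lin_rot_FilV vs v10.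
have F := cmor_flow S2; have [v2 _] := (Ldom_supp _).1 v10.
apply: (unipotent_Fil (cmB F) (cmor_unipotent F (flow_psX2 S2))).
rewrite (cmB F) (cmM F) (cmC F) -[flow S (vz _)](phiS_gen S2 v1 (c := ord0) (x := zv)).
  have -> : flow S zv = zv + (flow S zv - zv) by rewrite addrC subrK.
  rewrite (cdD (cder_Dv v)) Dv_z mulrDr opprD addrACA; apply: FilD => //.
  apply: FilB; first exact: (Dv_Fil v1 (flow_z2 S2)).
  by apply: FilMl; apply: flow_z2.
by move=> w; rewrite Dv_z.
Qed.

Lemma transform_linear_part alpha v u S (t : B) tau : symm v -> lin_rot v ->
  FL alpha 1 S -> t 0 = 0 -> paramor tau ->
  (forall c, u c = tau ((1 + rlift t) * (phiS S v c : A)) :> A) ->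
  Fil w1 2 (vz u - psC ii * zv).
Proof.
move=> vs v10 SF t0 P uE; have F := phiS_linear_part vs v10 SF.
have T := pm_cmor P.
have -> : psC ii * zv = tau (psC ii * zv) by rewrite (cmM T) (cmC T) (pm_z P).
rewrite /vz uE -(cmB T); apply: (cmF T).
have -> : (1 + rlift t) * (phiS S v ord0 : A) - psC ii * zv =
  (vz (phiS S v) - psC ii * zv) + rlift t * (vz (phiS S v) - psC ii * zv) +
  rlift t * (psC ii * zv) by rewrite /vz; ring.
have t1 : Fil w1 1 (rlift t).
  by apply/Fil1_coef0; rewrite (cm_coef0 (cmor_rlift R m)) t0 rmorph0.
apply: FilD; first by apply: FilD => //; apply: FilMl.
by apply: (FilM t1); apply: FilMl; apply: Fil_zv.
Qed.

(** Vanishing derivatives make f rotation invariant, hence a series in rho, and then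
    exclude positive powers of rho. *)
Lemma mulift_surj f : dz f = 0 -> dw f = 0 -> Jc f = f -> exists p : Mu, f = mulift p.
Proof.
move=> fz fw fJ; have rf : radial f.
  by apply/radialP; rewrite !rotdE fz fw !mulr0 subrr.
have [u uE] := rlift_surj rf fJ; exists (fun n => u (bi 0 n)).
rewrite -rlift_emb -emb_of // => b b0.
apply: (@complexI R); rewrite rmorph0.
have := congr1 (fun h : A => h (mi (b None) (b None) (bmu b))) (erefl (zv * dz f)).
rewrite {1}fz mulr0 coef_zdz miE uE coef_rlift biK => /esym/eqP.
rewrite ps_zeroE mulf_eq0 pnatr_eq0 (negPf b0) /= => /eqP.
exact.
Qed.

Lemma pm_rotd tau f : paramor tau -> tau (rotd f) = rotd (tau f).
Proof.
move=> P; have T := pm_cmor P.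
by rewrite !rotdE (cmB T) !(cmM T) (pm_z P) (pm_w P) (pm_dz P) (pm_dw P).
Qed.

Lemma rotd_rlift (r : B) : rotd (rlift r) = 0.
Proof. exact/radialP/radial_rlift. Qed.

(** The series in z w are cut out by rotation and conjugation ([rlift_surj]). *)
Lemma rlift_stable (phi : A -> A) (r : B) :
  (forall f, phi (rotd f) = rotd (phi f)) -> (forall f, phi (Jc f) = Jc (phi f)) ->
  phi 0 = 0 -> exists r' : B, phi (rlift r) = rlift r'.
Proof.
move=> pr pJ p0; apply: rlift_surj; last by rewrite -pJ Jc_rlift.
by apply/radialP; rewrite -pr rotd_rlift.
Qed.

Lemma flow_zw S f : Fil (@wzw m) 1 (vz S) -> Fil (@wzw m) 1 (vw S) ->
  Fil (@wzw m) 1 (flow S f - f).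
Proof.
move=> Sz Sw q q0.
rewrite ps_addE ps_oppE /flow /expD big_ord_recl dexp0 ps_addE addrC addKr.
rewrite ps_sumE big1 // => l _; rewrite /dexp coef_psCM /=.
suff -> : Dv S (iter l (Dv S) f) q = 0 by rewrite mulr0.
suff: Fil (@wzw m) 1 (Dv S (iter l (Dv S) f)) by apply.
by apply: FilD; apply: FilMr.
Qed.

Lemma wzw_Jc f : Fil (@wzw m) 1 f -> Fil (@wzw m) 1 (Jc f).
Proof.
move=> fz q qz; rewrite !JcE fz ?conjc0 //.
by move: qz; rewrite !wt_wzw zdeg_swap wdeg_swap addnC.
Qed.

Lemma Dv_radfield r (h : B) : Dv (radfield r) (rlift h) =
  (rlift r * rlift (psX None * pd None h)) *+ 2.
Proof.
rewrite /Dv vz_radfield vw_radfield.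
have -> : zv * (psC ii + rlift r) * dz (rlift h) =
  (psC ii + rlift r) * (zv * dz (rlift h)) by ring.
have -> : wv * (- psC ii + rlift r) * dw (rlift h) =
  (- psC ii + rlift r) * (wv * dw (rlift h)) by ring.
by rewrite zdz_rlift wdw_rlift; ring.
Qed.

(** The change of variables z -> z h, w -> w h by a radial unit h. *)
Section Rescaling.
Variable h : B.
Hypothesis h0 : h 0 = 1.

Definition scl_images (i : pvar m) : A :=
  match i with
  | inl s => psX (inl s) * rlift h
  | inr k => psX (inr k)
  end.

Lemma scl_images_Fil i : Fil w1 1 (scl_images i).
Proof. by case: i => [s|k] /=; [apply: FilMr|]; apply: Fil_psX. Qed.

Definition scl : A -> A := sub scl_images.

Lemma cmor_scl : cmor idfun scl. Proof. exact: cmor_sub scl_images_Fil. Qed.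

Lemma scl_z : scl zv = zv * rlift h.
Proof.
by rewrite /scl -psX_pz sub_psX //; exact: scl_images_Fil.
Qed.
Lemma scl_w : scl wv = wv * rlift h.
Proof.
by rewrite /scl -psX_pw sub_psX //; exact: scl_images_Fil.
Qed.
Lemma scl_mu k : scl (muv k) = muv k.
Proof.
by rewrite /scl -psX_inr sub_psX //; exact: scl_images_Fil.
Qed.

Lemma h_sub1 : Fil w1 1 (rlift h - 1).
Proof.
apply/Fil1_coef0; rewrite ps_addE ps_oppE coef01 (cm_coef0 (cmor_rlift R m)) h0.
by rewrite rmorph1 subrr.
Qed.

Lemma scl_psX2 i : Fil w1 2 (scl (psX i) - psX i).
Proof.
move: i; apply: (gen_ind (Q := fun x => Fil w1 2 (scl x - x))) => [||k].
- have -> : scl zv - zv = zv * (rlift h - 1) by rewrite scl_z; ring.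
  exact: (FilM (@Fil_zv R m) h_sub1).
- have -> : scl wv - wv = wv * (rlift h - 1) by rewrite scl_w; ring.
  exact: (FilM (@Fil_wv R m) h_sub1).
- by rewrite scl_mu subrr; apply: Fil0.
Qed.

Lemma scl_Jc f : scl (Jc f) = Jc (scl f).
Proof.
have PJ := cmor_Jc R m; have P := cmor_scl.
apply: (@cmor_ext _ _ _ _ (@conjc R) (scl \o Jc) (Jc \o scl)).
- exact: cmor_io (cmor_comp PJ P).
- exact: cmor_io (cmor_comp P PJ).
apply: (gen_ind (Q := fun x => scl (Jc x) = Jc (scl x))) => [||k].
- by rewrite Jc_z scl_w scl_z (cmM PJ) Jc_z Jc_rlift.
- by rewrite Jc_w scl_w scl_z (cmM PJ) Jc_w Jc_rlift.
- by rewrite Jc_mu scl_mu Jc_mu.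
Qed.

Lemma scl_rotd f : scl (rotd f) = rotd (scl f).
Proof.
have P := cmor_scl; have Q := cder_rotd R m.
apply: (@cder_ext _ _ _ _ _ scl (scl \o rotd) (rotd \o scl) P).
- exact: (cder_postcomp Q P).
- exact: (cder_precomp P Q).
apply: (gen_ind (Q := fun x => scl (rotd x) = rotd (scl x))) => [||k].
- by rewrite rotd_z scl_z (cdM Q) rotd_z rotd_rlift mulr0 addr0.
- by rewrite rotd_w (cmN P) scl_w (cdM Q) rotd_w rotd_rlift mulr0 addr0 mulNr.
- by rewrite rotd_mu scl_mu rotd_mu (cm0 P).
Qed.

Lemma scl_mulift (p : Mu) : scl (mulift p) = mulift p.
Proof.
apply: (@cmor_ext _ _ _ _ (real_complex R) (scl \o @mulift R m) (@mulift R m)).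
- exact: cmor_io (cmor_comp (cmor_mulift R m) cmor_scl).
- exact: cmor_mulift.
by move=> k /=; rewrite mulift_psX scl_mu.
Qed.

Lemma scl_rho : scl rho = rlift (@xB R m * h ^+ 2).
Proof.
have L := cmor_rlift R m.
rewrite !rhoE (cmM cmor_scl) scl_z scl_w (cmM L) (cmX L) rlift_rho !rhoE; ring.
Qed.

End Rescaling.

Lemma unitmx_of_ker (M : 'M[R]_m) :
  (forall c : 'cV[R]_m, M *m c = 0 -> c = 0) -> M \in unitmx.
Proof.
move=> H; rewrite -unitmx_tr -row_free_unit -kermx_eq0; apply/rowV0P => c /sub_kermxP cM.
have e : M *m c^T = 0 by apply: trmx_inj; rewrite trmx_mul trmxK cM trmx0.
by rewrite -[c]trmxK (H _ e) trmx0.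
Qed.

(** The equations p_k(mu) = nu_k are solved for mu in two stages, as required by the
    shape of the transformations: after multiplication by the inverse of the
    linear part L of p the substitution is tangent to the identity and inverted
    formally, and L is undone by a linear substitution. *)
Lemma param_inverse (p : 'I_m -> Mu) : (forall k, p k 0 = 0) ->
  (\matrix_(k, j) p k (munit j)) \in unitmx ->
  exists (M : 'M[R]_m) (g : 'I_m -> Mu), [/\ M \in unitmx,
    forall k, Fil w1 2 (g k - psX k) &
    forall k, sub (glin M) (sub g (p k)) = psX k].
Proof.
set L := \matrix_(k, j) _ => p0 LU.
pose p' k : Mu := \sum_j psC (invmx L k j) * p j.
have coef_munit (i j : 'I_m) : (munit i == munit j :> mindex 'I_m) = (i == j).
  apply/eqP/eqP => [/(congr1 (fun a : mindex 'I_m => a i))|->//].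
  by rewrite !ffunE eqxx; case: eqP.
have p'2 k : Fil w1 2 (p' k - psX k).
  move=> n; rewrite -mdegE => n2; rewrite ps_addE ps_oppE /p' ps_sumE.
  under eq_bigr do rewrite coef_psCM.
  have [n0|n0] := posnP (mdeg n).
    have -> : n = 0 by apply/eqP; rewrite -mdeg_eq0 n0.
    rewrite big1; last by move=> j _; rewrite p0 mulr0.
    by rewrite /psX /mon eq_sym (negPf (munit_neq0 _)) subrr.
  have [l nl] : exists l, n = munit l.
    have n1 : mdeg n = 1%N by lia.
    have /existsP[l nl] : [exists l, 0 < n l]%N.
      apply/existsPn => H; move: n1; rewrite /mdeg big1 // => i _.
      by apply/eqP; rewrite -leqn0 leqNgt H.
    exists l; rewrite -leqm_munit in nl; rewrite -(submK nl).
    have := congr1 (@mdeg _) (submK nl); rewrite n1 mdegE wtD wt1_munit -mdegE.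
    by case => /eqP; rewrite mdeg_eq0 => /eqP ->; rewrite addr0.
  rewrite nl /psX /mon coef_munit.
  transitivity ((invmx L *m L) k l - (l == k)%:R).
    by rewrite mxE; congr (_ - _); apply: eq_bigr => j _; rewrite mxE.
  by rewrite mulVmx // mxE eq_sym subrr.
have p'1 k : Fil w1 1 (p' k).
  rewrite -(subrK (psX k) (p' k)); apply: FilD; last exact: Fil_psX.
  exact: Fil_le (p'2 k).
have SP := cmor_sub p'1.
have S2 i : Fil w1 2 (sub p' (psX i) - psX i) by rewrite sub_psX.
have [V [VP VK KV]] := cmor_inv SP S2.
pose g k := V (psX k).
have g2 k : Fil w1 2 (g k - psX k).
  apply: (unipotent_Fil (cmB SP) (cmor_unipotent SP S2)).
  by rewrite (cmB SP) KV sub_psX //; apply: FilB_sym.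
have g1 k : Fil w1 1 (g k) := Fil1_near_psX (g2 k).
have GP := cmor_sub g1.
have gV (f : Mu) : sub g f = V f.
  apply: (cmor_ext GP VP) => i; by rewrite sub_psX.
have gp' k : sub g (p' k) = psX k by rewrite gV -[RHS]VK sub_psX.
have pE k : p k = \sum_j psC (L k j) * p' j.
  rewrite /p'; under eq_bigr do rewrite mulr_sumr.
  rewrite exchange_big /= (bigD1 k) //= [X in _ + X]big1 ?addr0 => [|l lk].
    transitivity (psC ((L *m invmx L) k k) * p k).
      by rewrite mulmxV // mxE eqxx rmorph1 mul1r.
    rewrite mxE rmorph_sum mulr_suml; apply: eq_bigr => j _.
    by rewrite mulrA -rmorphM.
  transitivity (psC ((L *m invmx L) k l) * p l).
    rewrite mxE rmorph_sum mulr_suml; apply: eq_bigr => j _.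
    by rewrite mulrA -rmorphM.
  by rewrite mulmxV // mxE eq_sym (negPf lk) rmorph0 mul0r.
have gp k : sub g (p k) = glin L k.
  rewrite pE (cm_sum GP); apply: eq_bigr => j _.
  by rewrite (cmM GP) (cmC GP) gp'.
exists (invmx L), g; split=> // [|k]; first by rewrite unitmx_inv.
by rewrite gp sub_glin2 mulmxV // glin_id.
Qed.

End ChangesOfVariables.

(** * Existence of the normal form *)

Section ExistenceTheorem.
Variables (R : realType) (N alpha : nat).
Hypotheses (N_gt0 : (0 < N)%N) (alpha_gt0 : (0 < alpha)%N).
Local Notation C := R[i].
Local Notation A := (ps (pvar N) C).
Local Notation B := (ps (option 'I_N) R).
Local Notation Mu := (ps 'I_N R).
Local Notation vf := (vfield R N).
Local Notation zv := (@zv R N).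
Local Notation wv := (@wv R N).
Local Notation muv := (@muv R N).
Local Notation Jc := (@Jc R N).
Local Notation rotd := (@rotd R N).
Local Notation rho := (@rho R N).
Local Notation ii := ('i%C : C).
Local Notation x := (@xB R N).

Definition wmu : pvar N -> nat := fun i => if i is inr _ then 1%N else 0%N.

Lemma wt_wmu q : wt wmu q = mdeg (mupart q).
Proof. by rewrite wt_pvar /= !mul0n !add0n mdegE. Qed.

(** Substitutions tangent to the identity preserve the terms of degree at most one
    in the parameters; the assumptions on r survive them. *)
Lemma tau_mu_low (g : 'I_N -> Mu) f : (forall k, Fil w1 2 (g k - psX k)) ->
  Fil wmu 2 (tau g f - f).
Proof.
move=> g2; have g1 k : Fil w1 1 (g k) := Fil1_near_psX (g2 k).
have P := paramor_tau g1.
apply: (cmor_congr (pm_cmor P) (cmor_id _ _)).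
apply: (gen_ind (Q := fun y => Fil wmu 2 (tau g y - y))) => [||k].
- by rewrite (pm_z P) subrr; apply: Fil0.
- by rewrite (pm_w P) subrr; apply: Fil0.
- rewrite tau_mu // -mulift_psX -(cmB (cmor_mulift R N)) => q.
  rewrite wt_wmu => q2; rewrite /mulift; case: ifP => // _.
  by rewrite g2 ?rmorph0 // -mdegE.
Qed.

(** Start from the transformation that makes v radial and drop its substitution
    of parameters, which replaces r by some r' with the same terms of degree at
    most one in mu.  The solution h of the radial equation for r' gives a rescaling
    s2 of z and w that conjugates [radfield r'] to [radfield R2], where R2 is the
    normal form with coefficients psi and beta.  The composed change of phase
    variables is a flow by [flow_log], the time change is transported by s2, and
    the parameters are changed last. *)
Lemma normal_form_exists (v : vf) (S1 : vf) (t1 r : B) (g1 : 'I_N -> Mu) :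
  symm v -> lin_rot v -> FL alpha 1 S1 -> t1 0 = 0 ->
  (forall k, Fil w1 2 (g1 k - psX k)) ->
  (forall c, radfield r c = tau g1 ((1 + rlift t1) * (phiS S1 v c : A)) :> A) ->
  (forall j, (j < N)%N -> r (bi j 0) = 0) -> r (bi N 0) != 0 ->
  (\matrix_(k, j) r (bi (nat_of_ord k) (munit j)) : 'M[R]_N) \in unitmx ->
  exists a b, a != 0 /\ transforms alpha v (vinfty (1%g : 'S_N) a b).
Proof.
move=> vs v10 S1F t10 g12 uE rlow rN rU.
have g11 k : Fil w1 1 (g1 k) := Fil1_near_psX (g12 k).
have P1 := paramor_tau g11.
have [tau1' [P1' K1 K1']] := tau_inv g12.
have L := cmor_rlift R N.
have [r' r'E] : exists r' : B, tau1' (rlift r) = rlift r'.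
  apply: rlift_stable; last exact: cm0 (pm_cmor P1').
    by move=> f; apply: pm_rotd.
  exact: (pm_Jc P1').
have rE' : tau g1 (rlift r') = rlift r by rewrite -r'E K1'.
(* The assumptions only concern coefficients of degree at most one in mu. *)
have coef_low k n : (mdeg n < 2)%N -> r' (bi k n) = r (bi k n).
  move=> n2; apply: (@complexI R); rewrite -!coef_rlift -rE'.
  have := tau_mu_low (rlift r') g12 (q := mi k k n).
  rewrite wt_wmu miE => /(_ n2) /eqP; rewrite ps_addE ps_oppE subr_eq0.
  by move=> /eqP ->.
have mdeg_munit (j : 'I_N) : mdeg (munit j) = 1%N by rewrite mdegE wt1_munit.
have r'low j : (j < N)%N -> r' (bi j 0) = 0.
  by move=> jN; rewrite coef_low ?mdeg0 // rlow.
pose a := r' (bi N 0).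
have a0 : a != 0 by rewrite /a coef_low ?mdeg0.
have S12 := FL1_FilV S1F; have v1 := lin_rot_FilV vs v10.
pose sg1 := flow S1; have sg1P : cmor idfun sg1 := cmor_flow S12.
have sg1_inj : injective sg1.
  have [V [_ VK _]] := cmor_inv sg1P (flow_psX2 S12); exact: can_inj VK.
have sg1mu k : sg1 (muv k) = muv k := flow_mu S1 k.
have sg1Dv f : Dv v (sg1 f) = sg1 (Dv (phiS S1 v) f) := Dv_flow S12 v1 f.
pose w := phiS S1 v.
have wE c : radfield r' c = (1 + rlift t1) * (w c : A) :> A.
  apply: (can_inj K1); rewrite -uE; have T := pm_cmor P1.
  case: (ord2_cases c) => ->.
    rewrite -[radfield r' ord0]/(vz (radfield r')) -[radfield r ord0]/(vz (radfield r)).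
    by rewrite !vz_radfield (cmM T) (cmD T) (cmC T) (pm_z P1) rE'.
  rewrite -[radfield r' _]/(vw (radfield r')) -[radfield r _]/(vw (radfield r)).
  by rewrite !vw_radfield (cmM T) (cmD T) (cmN T) (cmC T) (pm_w P1) rE'.
have DwE f : Dv (radfield r') f = (1 + rlift t1) * Dv w f.
  by rewrite /Dv /vz /vw !wE; ring.
have [h [psi [be [h0 psi_mu psi_0 be_mu heq]]]] :=
  radial_form_exists N_gt0 a0 r'low (erefl a).
pose p k : Mu := fun n => psi k (bi 0 n).
pose b1 : Mu := fun n => be (bi 0 n).
have psiE k : psi k = emb (p k) by apply: emb_of.
have beE : be = emb b1 by apply: emb_of.
have p_0 k : p k 0 = 0.
  by rewrite /p (_ : bi 0 0 = 0) ?psi_0 //; apply/eqP; rewrite bi_eq0 !eqxx.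
(* A kernel vector for psi is one for r by linearization. *)
have pU : (\matrix_(k, j) p k (munit j)) \in unitmx.
  apply: unitmx_of_ker => c pc.
  have c0 k : \sum_i c i ord0 * psi k (bi 0 (munit i)) = 0.
    have := congr1 (fun M : 'cV[R]_N => M k ord0) pc; rewrite !mxE => E.
    rewrite -[RHS]E; apply: eq_bigr => i _; by rewrite mxE mulrC.
  have H := radial_form_linear_part N_gt0 a0 r'low (erefl a) h0 psi_mu psi_0 heq c0.
  suff rc : (\matrix_(k, j) r (bi (nat_of_ord k) (munit j)) : 'M[R]_N) *m c = 0.
    by rewrite -[c](mulKmx rU) rc mulmx0.
  apply/matrixP=> k i; rewrite ord1 !mxE -[RHS](H k (ltn_ord k)).
  by apply: eq_bigr => j _; rewrite mxE mulrC coef_low ?mdeg_munit.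
pose s2 := scl h; have s2P : cmor idfun s2 := cmor_scl h.
have [s2' [s2'P s2K s2K']] := cmor_inv s2P (scl_psX2 h0).
have s2_inj : injective s2 := can_inj s2K.
have s2z : s2 zv = zv * rlift h := scl_z h.
have s2w : s2 wv = wv * rlift h := scl_w h.
have s2mu k : s2 (muv k) = muv k := scl_mu h k.
have s2J f : s2 (Jc f) = Jc (s2 f) := scl_Jc h f.
have s2rot f : s2 (rotd f) = rotd (s2 f) := scl_rotd h f.
have s2mulift f : s2 (mulift f) = mulift f := scl_mulift h f.
have s2x : s2 (rlift x) = rlift (x * h ^+ 2).
  by rewrite rlift_rho; apply: scl_rho.
clearbody s2.
pose R2 := Qf a p b1 x.
(* This is the radial equation, with rho h^2 substituted for rho. *)
have s2R2 : rlift h * s2 (rlift R2) =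
    rlift r' * (rlift h + rlift (x * dB h) *+ 2).
  have -> : s2 (rlift R2) = rlift (Qf a p b1 (x * h ^+ 2)).
    rewrite (phi_Qf _ _ _ _ s2P) [RHS](phi_Qf _ _ _ _ (cmor_id _ _)).
    rewrite s2x s2mulift; congr (_ + _ + _); apply: eq_bigr => k _.
    by rewrite s2mulift.
  have -> : Qf a p b1 (x * h ^+ 2) = psC a * x ^+ N * h ^+ (2 * N) +
      \sum_(k < N) psi k * x ^+ k * h ^+ (2 * k) + be * x ^+ (2 * N) * h ^+ (4 * N).
    have hX k : (x * h ^+ 2) ^+ k = x ^+ k * h ^+ (2 * k) by rewrite exprMn -exprM.
    rewrite /Qf beE !hX mulnA; congr (_ + _ + _); try exact: mulrA.
    by apply: eq_bigr => k _; rewrite psiE hX mulrA.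
  rewrite -(cmM L) heq (cmM L) (cmD L); congr (_ * (_ + _)).
  by rewrite mulr_natl mulr2n (cmD L) -mulr2n.
pose u2 := radfield R2.
have Du2 c (y : A) : (forall w, Dv w y = w c :> A) -> s2 y = y * rlift h ->
    Dv (radfield r') y * rlift h + y * (rlift r' * rlift (x * dB h)) *+ 2 =
      s2 (Dv u2 y) -> Dv (radfield r') (s2 y) = s2 (u2 c).
  move=> yE ys2 e; rewrite ys2 (cdM (cder_Dv _)) Dv_radfield -yE -e.
  by rewrite mulrnAr.
have Du2z : Dv (radfield r') (s2 zv) = s2 (vz u2).
  apply: Du2 => [w'||]; [exact: Dv_z | exact: s2z |].
  rewrite !Dv_z !vz_radfield (cmM s2P) (cmD s2P) (cmC s2P) s2z.
  have -> : zv * rlift h * (psC ii + s2 (rlift R2)) =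
    zv * (psC ii * rlift h + rlift h * s2 (rlift R2)) by ring.
  by rewrite s2R2; ring.
have Du2w : Dv (radfield r') (s2 wv) = s2 (vw u2).
  apply: Du2 => [w'||]; [exact: Dv_w | exact: s2w |].
  rewrite !Dv_w !vw_radfield (cmM s2P) (cmD s2P) (cmN s2P) (cmC s2P) s2w.
  have -> : wv * rlift h * (- psC ii + s2 (rlift R2)) =
    wv * (- psC ii * rlift h + rlift h * s2 (rlift R2)) by ring.
  by rewrite s2R2; ring.
have [S1s S1L] := FL1_form S1F; have [_ S1z] := (Ldom_supp _).1 S1L.
have S1w : Fil (@wzw N) 1 (vw S1) by rewrite S1s; apply: wzw_Jc.
have zzw : Fil (@wzw N) 1 zv by rewrite zvE; apply: (@Fil_psX _ _ (@wzw N) (pz N)).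
(* The composition of flow and rescaling is the flow of a single S. *)
have [|S [Ss SL Sz Sw]] := @flow_log R N (sg1 (s2 zv)).
  apply: (Ldom_supp _).2; split.
    have -> : sg1 (s2 zv) - zv = sg1 (s2 zv - zv) + (sg1 zv - zv).
      by rewrite (cmB sg1P); ring.
    apply: FilD; last exact: flow_z2.
    apply: (cmF sg1P); rewrite s2z.
    have -> : zv * rlift h - zv = zv * (rlift h - 1) by ring.
    by apply: (FilM (@Fil_zv R N)); apply: h_sub1.
  have -> : sg1 (s2 zv) - zv = (sg1 (s2 zv) - s2 zv) + (s2 zv - zv) by ring.
  apply: FilD; first exact: flow_zw.
  by rewrite s2z; apply: FilB => //; apply: FilMr.
have SF : FL alpha 1 S by apply: FL1_intro.
have S2 := FL1_FilV SF; have SP := cmor_flow S2.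
have Sw' : flow S wv = sg1 (s2 wv).
  have E : Jc (s2 zv) = s2 wv by rewrite -(s2J zv) Jc_z.
  rewrite -E Sw; exact: flow_Jc.
have DS c (y : A) : (forall w, Dv w y = w c :> A) -> flow S y = sg1 (s2 y) ->
    Dv w (s2 y) = s2 (phiS S v c).
  move=> yE ySs; apply: sg1_inj; rewrite -(sg1Dv (s2 y)) -ySs (phiS_gen S2 v1 yE).
  have ext : forall f, flow S f = sg1 (s2 f).
    apply: (@cmor_ext _ _ _ _ _ (flow S) (sg1 \o s2) SP).
      exact: cmor_io (cmor_comp s2P sg1P).
    apply: (gen_ind (Q := fun y => flow S y = sg1 (s2 y))) => [||k].
    - exact: Sz.
    - exact: Sw'.
    - by rewrite flow_mu s2mu sg1mu.
  exact: ext.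
(* The time change expressed in the rescaled variables. *)
have [t2 t2E] : exists t2 : B, s2' (rlift t1) = rlift t2.
  apply: rlift_stable => [f|f|]; last exact: cm0 s2'P.
    by apply: s2_inj; rewrite s2K' s2rot s2K'.
  by apply: s2_inj; rewrite s2K' s2J s2K'.
have t20 : t2 0 = 0.
  apply: (@complexI R); rewrite rmorph0 -(cm_coef0 L) -t2E (cm_coef0 s2'P).
  by rewrite (cm_coef0 L) t10 rmorph0.
have phiTS c : (1 + rlift t2) * (phiS S v c : A) = u2 c.
  apply: s2_inj; rewrite (cmM s2P) (cmD s2P) (cm1 s2P) -t2E s2K'.
  case: (ord2_cases c) => ->.
    by rewrite -(DS ord0 zv (fun w' => Dv_z w') Sz) -(DwE (s2 zv)); exact: Du2z.
  by rewrite -(DS ord_max wv (fun w' => Dv_w w') Sw') -(DwE (s2 wv)); exact: Du2w.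
have [M [g [MU g2 gE]]] := param_inverse p_0 pU.
have g1' k : Fil w1 1 (g k) := Fil1_near_psX (g2 k).
exists a, (sub (glin M) (sub g b1)); split=> //.
pose T : timespace R N := fun k n => t2 (bi k n).
have TE : tlift T = rlift t2 :> A.
  by rewrite tliftE; congr rlift; apply/ps_ext=> b; rewrite /T biK.
exists M, (fun k => g k - psX k), T, S; split=> //.
  split=> //.
    by apply/(FP_Fil _ alpha_gt0) => k; rewrite /gpar addrCA subrr addr0.
  apply/(FR_coef _ alpha_gt0); rewrite /T (_ : bi 0 0 = 0) //.
  by apply/eqP; rewrite bi_eq0 !eqxx.
have gg : gpar (fun k => g k - psX k) = g.
  by apply/funext=> k; rewrite /gpar addrCA subrr addr0.
have PM := paramor_tau (glin1 M); have PG := paramor_tau g1'.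
pose tau2 := tau (glin M) \o tau g.
have P2 : paramor tau2 := paramor_comp PG PM.
have tau2m (y : Mu) : tau2 (mulift y) = mulift (sub (glin M) (sub g y)).
  by rewrite /tau2 /= !tau_mulift //; apply: glin1.
have tau2rho : tau2 (rlift x) = rho.
  by rewrite rlift_rho !rhoE (cmM (pm_cmor P2)) (pm_z P2) (pm_w P2).
have R2E : tau2 (rlift R2) =
   rlift (Qf a (fun k => psX ((1%g : 'S_N) k)) (sub (glin M) (sub g b1)) x).
  rewrite (phi_Qf _ _ _ _ (pm_cmor P2)) [RHS](phi_Qf _ _ _ _ (cmor_id _ _)).
  rewrite tau2rho rlift_rho tau2m; congr (_ + _ + _).
  by apply: eq_bigr => k _; rewrite tau2m gE perm1.
apply/funext=> c; rewrite phiME phiPE gg phiTE TE phiTS vinfty_radfield.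
have T2 := pm_cmor P2.
have E (y : A) : tau (glin M) (tau g y) = tau2 y by [].
rewrite E; case: (ord2_cases c) => ->.
  rewrite -[radfield _ ord0]/(vz (radfield _)) -[u2 ord0]/(vz u2) !vz_radfield.
  by rewrite (cmM T2) (cmD T2) (cmC T2) (pm_z P2) R2E.
rewrite -[radfield _ ord_max]/(vw (radfield _)) -[u2 ord_max]/(vw u2) !vw_radfield.
by rewrite (cmM T2) (cmD T2) (cmN T2) (cmC T2) (pm_w P2) R2E.
Qed.

End ExistenceTheorem.

(** * Conjugacies between radial fields *)

Section ConjugacyOfRadialFields.
Variables (R : realType) (m : nat).
Local Notation C := R[i].
Local Notation A := (ps (pvar m) C).
Local Notation B := (ps (option 'I_m) R).
Local Notation vf := (vfield R m).
Local Notation zv := (@zv R m).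
Local Notation wv := (@wv R m).
Local Notation muv := (@muv R m).
Local Notation dz := (@dz R m).
Local Notation dw := (@dw R m).
Local Notation Jc := (@Jc R m).
Local Notation rotd := (@rotd R m).
Local Notation rho := (@rho R m).
Local Notation ii := ('i%C : C).
Local Notation x := (@xB R m).
Local Notation dB := (@dB R m).
Implicit Types (f : A) (w : vf).

(** The field z (i + r) U, where U is the inverse of a time change 1 + t. *)
Definition tfield (r U : B) (w : vf) :=
  vz w = zv * ((psC ii + rlift r) * rlift U) /\
  vw w = wv * ((- psC ii + rlift r) * rlift U).

Lemma tfield_FilV r U w : tfield r U w -> FilV 1 w.
Proof.
by rewrite /FilV => -[-> ->]; split; apply: FilMr; [apply: Fil_zv | apply: Fil_wv].
Qed.

(** Both components have rotation eigenvalue equal to that of the coordinate, so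
    the bracket with the rotation vanishes. *)
Lemma tfield_rotd r U w f : tfield r U w -> Dv w (rotd f) = rotd (Dv w f).
Proof.
move=> tw; have [wz ww] := tw; have Q := cder_rotd R m.
pose Y : vf := fun c => if c == ord0 then zv else - wv.
have YE g : Dv Y g = rotd g.
  by rewrite /Dv !rotdE -[vz Y]/zv -[vw Y]/(- wv) mulNr.
have Y1 : FilV 1 Y by split; [apply: Fil_zv | apply: FilN; apply: Fil_wv].
have := Dv_bracket f Y1 (tfield_FilV tw).
have bz : vz (bracket Y w) = 0.
  rewrite /vz bracketE -[Y ord0]/zv -[w ord0]/(vz w) Dv_z YE wz (cdM Q) rotd_z.
  have -> : (psC ii + rlift r) * rlift U = psC ii * rlift U + rlift (r * U).
    by rewrite (cmM (cmor_rlift R m)); ring.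
  by rewrite (cdD Q) (cdZ (cmor_id _ _) Q) !rotd_rlift mulr0 addr0 mulr0 addr0 subrr.
have bw : vw (bracket Y w) = 0.
  rewrite /vw bracketE -[Y ord_max]/(- wv) -[w ord_max]/(vw w) (cdN (cder_Dv w)).
  rewrite Dv_w YE ww (cdM Q) rotd_w.
  have -> : (- psC ii + rlift r) * rlift U = - (psC ii * rlift U) + rlift (r * U).
    by rewrite (cmM (cmor_rlift R m)); ring.
  rewrite (cdD Q) (cdN Q) (cdZ (cmor_id _ _) Q) !rotd_rlift; ring.
by rewrite !YE /Dv bz bw !mul0r addr0 => /esym/eqP; rewrite subr_eq0 => /eqP.
Qed.

Lemma Dv_tfield r U w (h : A) : tfield r U w -> rotd h = 0 ->
  Dv w h = (rlift r * rlift U * (zv * dz h)) *+ 2.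
Proof.
move=> [wz ww] rh; have e : wv * dw h = zv * dz h.
  by apply/esym/eqP; rewrite -subr_eq0; apply/eqP.
rewrite /Dv wz ww.
have -> : wv * ((- psC ii + rlift r) * rlift U) * dw h =
   (- psC ii + rlift r) * rlift U * (wv * dw h) by ring.
by rewrite e; ring.
Qed.

Variables (r1 U1 r2 U2 : B) (w1' w2' : vf) (sg : A -> A).
Hypotheses (tw1 : tfield r1 U1 w1') (tw2 : tfield r2 U2 w2').
Hypotheses (r10 : r1 0 = 0) (r20 : r2 0 = 0) (U10 : U1 0 = 1) (U20 : U2 0 = 1).
Hypothesis sgP : cmor idfun sg.
Hypothesis sg2 : forall i, Fil w1 2 (sg (psX i) - psX i).
Hypothesis sg_mu : forall k, sg (muv k) = muv k.
Hypothesis sgJ : forall f, sg (Jc f) = Jc (sg f).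
Hypothesis conj12 : forall f, Dv w1' (sg f) = sg (Dv w2' f).

Let Q := cder_rotd R m.
Let L := cmor_rlift R m.
(** The failure of sg to commute with the rotation; a derivation along sg. *)
Let de f := rotd (sg f) - sg (rotd f).

Let deP : cder sg de.
Proof.
apply: cder_sub; first exact: (cder_precomp sgP Q).
exact: (cder_postcomp Q sgP).
Qed.

Let rest_Fil (r U : B) : r 0 = 0 -> U 0 = 1 ->
  Fil w1 1 ((psC ii + rlift r) * rlift U - psC ii).
Proof.
move=> r0 U0; apply/Fil1_coef0; rewrite ps_addE ps_oppE coef0M ps_addE.
by rewrite !(cm_coef0 L) r0 U0 rmorph0 rmorph1 mulr1 addr0 subrr.
Qed.

(** Suppose e = [de z] has order at least k + 1.  Applying [de] to the conjugacy
    relation shows that w1' e agrees with i e up to order k + 2, while w1' acts as i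
    times the rotation at lowest order.  So the terms of degree k + 1 of e have
    eigenvalue 1.  But e = (rotation - 1)(sg z) has no terms of eigenvalue 1. *)
Lemma conj_rotd_z : rotd (sg zv) = sg zv.
Proof.
have dez f : Jc (de f) = - de (Jc f).
  rewrite /de (cmB (cmor_Jc R m)) (Jc_rotd (sg f)) -(sgJ f) -(sgJ (rotd f)).
  by rewrite (Jc_rotd f) (cmN sgP); ring.
have dezE : de zv = rotd (sg zv) - sg zv by rewrite /de rotd_z.
have all k : Fil w1 k.+1 (de zv).
  elim: k => [|k IH].
    rewrite dezE; apply/Fil1_coef0; rewrite ps_addE ps_oppE (cm_coef0 sgP).
    rewrite coef_rotd zdeg0 wdeg0 subrr mul0r add0r.
    by rewrite ((Fil1_coef0 zv).2 (@Fil_zv R m)) rmorph0 oppr0.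
  have gens i : Fil w1 k.+1 (de (psX i)).
    move: i; apply: (gen_ind (Q := fun y => Fil w1 k.+1 (de y))) => [||j].
    - exact: IH.
    - rewrite -Jc_z -[de _]opprK -(dez zv); apply: FilN.
      exact: (cmF (cmor_Jc R m) IH).
    - have -> : de (muv j) = 0.
        by rewrite /de (sg_mu j) (rotd_mu R j) (cm0 sgP) subrr.
      exact: Fil0.
  have raise := cder_raise sgP deP gens.
  set e := de zv in IH dezE *.
  pose G2 := (psC ii + rlift r2) * rlift U2.
  have G2F : Fil w1 1 (G2 - psC ii) := rest_Fil r20 U20.
  have deG2 : Fil w1 k.+1 (de G2).
    have := raise _ _ G2F.
    by rewrite (cdB deP) (cdC deP) subr0.
  have De : Dv w1' e = de (vz w2').
    rewrite /e /de (cdB (cder_Dv w1')) (tfield_rotd _ tw1) conj12 Dv_z.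
    by rewrite conj12 (tfield_rotd _ tw2) Dv_z.
  have [wz2 _] := tw2.
  have e1 : Fil w1 k.+2 (Dv w1' e - psC ii * e).
    rewrite De wz2 (cdM deP) -/G2.
    have -> : de zv * sg G2 + sg zv * de G2 - psC ii * e =
      e * (sg (G2 - psC ii)) + sg zv * de G2.
      by rewrite (cmB sgP) (cmC sgP) /e; ring.
    apply: FilD.
      by have := FilM IH (cmF sgP G2F); rewrite addn1.
    exact: (FilM (cmF sgP (@Fil_zv R m)) deG2).
  have e2 : Fil w1 k.+2 (Dv w1' e - psC ii * rotd e).
    have [wz ww] := tw1.
    have -> : Dv w1' e - psC ii * rotd e =
      zv * ((psC ii + rlift r1) * rlift U1 - psC ii) * dz e +
      wv * ((- psC ii + rlift r1) * rlift U1 - - psC ii) * dw e.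
      by rewrite /Dv wz ww !rotdE; ring.
    have F1 := rest_Fil r10 U10.
    have F1' : Fil w1 1 ((- psC ii + rlift r1) * rlift U1 - - psC ii).
      have := cmF (cmor_Jc R m) F1.
      rewrite (cmB (cmor_Jc R m)) (cmM (cmor_Jc R m)) (cmD (cmor_Jc R m)) !Jc_rlift.
      by rewrite Jc_psC conj_i rmorphN.
    have dF g : Fil w1 k.+1 g -> Fil w1 k (dz g) /\ Fil w1 k (dw g).
      by move=> gk; split; [apply: (cdF (cder_dz R m)) | apply: (cdF (cder_dw R m))].
    apply: FilD.
      by apply: (FilM (FilM (@Fil_zv R m) F1)); apply: (dF _ IH).1.
    by apply: (FilM (FilM (@Fil_wv R m) F1')); apply: (dF _ IH).2.
  have e3 : Fil w1 k.+2 (psC ii * (rotd e - e)).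
    have -> : psC ii * (rotd e - e) = (Dv w1' e - psC ii * e) -
      (Dv w1' e - psC ii * rotd e) by ring.
    exact: FilB.
  move=> q qk; have := e3 q qk.
  have i0 : ii != 0 by apply/eqP => /(congr1 (@complex.Im R)) /= /eqP; rewrite oner_eq0.
  rewrite coef_psCM ps_addE ps_oppE coef_rotd => /eqP; rewrite mulf_eq0 (negPf i0) /=.
  rewrite -[X in _ - X]mul1r -mulrBl mulf_eq0 => /orP[|/eqP//].
  move=> d0; rewrite dezE ps_addE ps_oppE coef_rotd -[X in _ - X]mul1r -mulrBl.
  by rewrite (eqP d0) mul0r.
have : de zv = 0 by apply: (@Fil_eq0 _ _ w1) => k; apply: Fil_le (all k).
by rewrite dezE => /eqP; rewrite subr_eq0 => /eqP.
Qed.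

Lemma conj_rotd f : rotd (sg f) = sg (rotd f).
Proof.
apply: (@cder_ext _ _ _ _ _ sg (rotd \o sg) (sg \o rotd) sgP).
- exact: (cder_precomp sgP Q).
- exact: (cder_postcomp Q sgP).
apply: (gen_ind (Q := fun y => rotd (sg y) = sg (rotd y))) => [||k].
- by rewrite conj_rotd_z rotd_z.
- rewrite -[in LHS]Jc_z (sgJ zv) -[rotd _]opprK -(Jc_rotd (sg zv)) conj_rotd_z.
  by rewrite -(sgJ zv) Jc_z rotd_w (cmN sgP).
- by rewrite (sg_mu k) (rotd_mu R k) (cm0 sgP).
Qed.

Lemma conj_radial (r : B) : exists r' : B, sg (rlift r) = rlift r'.
Proof.
apply: rlift_stable; last exact: cm0 sgP.
  by move=> f; rewrite conj_rotd.
exact: sgJ.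
Qed.

(** By rotation invariance sg z = z h with h radial; put H = h Jc(h).  The z- and
    w-components of the conjugacy relation are conjugate to each other: multiplied
    by Jc(h) and h, their sum describes how H moves and their difference how the
    angle of h moves.  Here x ka is 2 H rho d/drho of that angle. *)
Lemma conj_radial_eq : exists H ka SR SU : B,
  [/\ H 0 = 1, sg rho = rlift (x * H),
     sg (rlift r2) = rlift SR /\ sg (rlift U2) = rlift SU,
     U1 * (H + x * r1 * ka) = H * SU &
     r1 * U1 * dB (x * H) = H * SR * SU].
Proof.
have PJ := cmor_Jc R m.
have [h zh rh] := rotd_eig1 conj_rotd_z.
pose k := Jc h.
have wk : sg wv = wv * k by rewrite -Jc_z sgJ zh (cmM PJ) Jc_z.
have rh0 : rotd h = 0 by apply/radialP.
have rk : radial k.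
  by move=> q qn; rewrite /k !JcE rh ?conjc0 // zdeg_swap wdeg_swap eq_sym.
have rk0 : rotd k = 0 by apply/radialP.
have Jk : Jc k = h by rewrite /k JcK.
have [H HE] : exists H : B, h * k = rlift H.
  apply: rlift_surj; last by rewrite (cmM PJ) Jk /k mulrC.
  by apply/radialP; rewrite (cdM Q) rh0 rk0 mul0r mulr0 addr0.
have h00 : h 0 = 1.
  have := (@sg2 (pz m)) (munit (pz m)); rewrite wt1_munit => /(_ isT) /eqP.
  rewrite -[psX (pz m)]/(mon (munit (pz m)) : A) -zvE zh zvE ps_addE ps_oppE.
  have := coef_monMD (munit (pz m)) h 0; rewrite addr0 => ->.
  by rewrite /mon eqxx subr_eq0 => /eqP.
have H0 : H 0 = 1.
  apply: (@complexI R); rewrite -[LHS](cm_coef0 L) -HE coef0M /k !JcE h00.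
  have -> : swapzw (0 : mindex (pvar m)) = 0.
    by apply: mi_ext; rewrite ?zdeg_swap ?wdeg_swap ?mupart_swap ?zdeg0 ?wdeg0.
  by rewrite h00 conjc1 mulr1 rmorph1.
have [SR SRE] := conj_radial r2; have [SU SUE] := conj_radial U2.
have [wz2 ww2] := tw2; have [wz1 ww1] := tw1.
pose th := zv * dz h; pose tk := zv * dz k.
have eqz : (psC ii + rlift r1) * rlift U1 * h + (rlift r1 * rlift U1 * th) *+ 2 =
    h * ((psC ii + rlift SR) * rlift SU).
  apply: (@zv_lreg R m); have := conj12 zv.
  rewrite zh (cdM (cder_Dv w1')) !Dv_z (Dv_tfield tw1 rh0) wz1 wz2 (cmM sgP) zh.
  rewrite (cmM sgP) (cmD sgP) (cmC sgP) SRE SUE => e.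
  by apply: (etrans (etrans _ e)); rewrite /th; ring.
have eqw : (- psC ii + rlift r1) * rlift U1 * k + (rlift r1 * rlift U1 * tk) *+ 2 =
    k * ((- psC ii + rlift SR) * rlift SU).
  apply: (@wv_lreg R m); have := conj12 wv.
  rewrite wk (cdM (cder_Dv w1')) !Dv_w (Dv_tfield tw1 rk0) ww1 ww2 (cmM sgP) wk.
  rewrite (cmM sgP) (cmD sgP) (cmN sgP) (cmC sgP) SRE SUE => e.
  by apply: (etrans (etrans _ e)); rewrite /tk; ring.
(* k0 is real and divisible by rho. *)
pose k0 := - psC ii * (k * th - h * tk).
have tJ g : rotd g = 0 -> Jc (zv * dz g) = zv * dz (Jc g).
  move=> rg; have rJ : rotd (Jc g) = 0.
    apply/radialP => q qn; rewrite !JcE ((radialP g).2 rg) ?conjc0 //.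
    by rewrite zdeg_swap wdeg_swap eq_sym.
  rewrite (cmM PJ) Jc_z Jc_dz; apply/esym/eqP; rewrite -subr_eq0; exact/eqP.
have [ka1 ka1E] : exists ka1 : B, k0 = rlift ka1.
  apply: rlift_surj.
    have rt g : rotd g = 0 -> rotd (zv * dz g) = 0.
      move=> rg; apply/radialP => q qn; rewrite coef_zdz.
      by rewrite ((radialP g).2 rg) ?mulr0.
    apply/radialP; rewrite /k0 (cdM Q) (cdN Q) (cdC Q) oppr0 mul0r add0r (cdB Q).
    rewrite (cdM Q k th) (cdM Q h tk) rh0 rk0 [rotd th](rt h rh0) [rotd tk](rt k rk0).
    by rewrite !mul0r !mulr0 !addr0 subrr mulr0.
  rewrite /k0 (cmM PJ) (cmN PJ) (cmB PJ) !(cmM PJ k) !(cmM PJ h) !tJ // Jk -/k -/th -/tk.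
  by rewrite Jc_psC conj_i rmorphN; ring.
have [ka kaE] : exists ka : B, ka1 = x * ka.
  exists (fun b => ka1 (bi 1 0 + b)); apply/ps_ext=> b.
  rewrite -[x]expr1 xBX coef_monM; case: ifP => [/submK->//|].
  move=> /negP nb; have b0 : b None = 0%N.
    apply/eqP; rewrite -leqn0 leqNgt; apply/negP => bpos; apply: nb.
    by apply/forallP => -[l|]; rewrite !ffunE.
  apply: (@complexI R); rewrite rmorph0.
  have := congr1 (fun g : A => g (mi (b None) (b None) (bmu b))) ka1E.
  rewrite coef_rlift biK => <-.
  have zc (g1 g2 : A) q : zdeg q = 0%N -> (g1 * (zv * dz g2)) q = 0.
    move=> q0; have -> : g1 * (zv * dz g2) = zv * (g1 * dz g2) by ring.
    by rewrite zvE coef_monM leqm_munit -/(zdeg q) q0.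
  have z0 : zdeg (mi (b None) (b None) (bmu b)) = 0%N by rewrite miE.
  have -> : k0 = (- psC ii * k) * (zv * dz h) - (- psC ii * h) * (zv * dz k).
    by rewrite /k0 /th /tk; ring.
  by rewrite ps_addE ps_oppE !zc // subrr.
have thH : rlift (x * dB H) = h * tk + k * th.
  by rewrite -zdz_rlift -HE (cdM (cder_dz R m)) /th /tk; ring.
have i2 : psC ii * psC ii = -1 :> A.
  by rewrite -rmorphM -expr2 sqr_i rmorphN rmorph1.
exists H, ka, SR, SU; split=> //.
- by rewrite !rhoE (cmM sgP) zh wk (cmM L) rlift_rho !rhoE -HE; ring.
- apply: (@rlift_inj R m).
  have -> : x * r1 * ka = r1 * ka1 by rewrite kaE; ring.
  rewrite (cmM L) (cmD L) (cmM L) -ka1E [RHS](cmM L) -HE /k0.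
  have e2 : psC (2%:R : C) * (rlift U1 * (h * k + rlift r1 * (- psC ii * (k * th - h * tk)))) =
            psC 2%:R * (h * k * rlift SU).
    have -> : psC (2%:R : C) * (rlift U1 * (h * k +
        rlift r1 * (- psC ii * (k * th - h * tk)))) = - psC ii *
      (k * ((psC ii + rlift r1) * rlift U1 * h + (rlift r1 * rlift U1 * th) *+ 2) -
       h * ((- psC ii + rlift r1) * rlift U1 * k + (rlift r1 * rlift U1 * tk) *+ 2))
      + (psC ii * psC ii + 1) * (h * k * rlift U1) *+ 2.
      by rewrite rmorph_nat; ring.
    rewrite eqz eqw i2 addNr mul0r mul0rn addr0.
    have -> : - psC ii * (k * (h * ((psC ii + rlift SR) * rlift SU)) -
       h * (k * ((- psC ii + rlift SR) * rlift SU))) =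
      - (psC ii * psC ii) * (h * k * rlift SU) *+ 2 by ring.
    by rewrite i2 rmorph_nat; ring.
  exact: natC_inj e2.
- apply: (@rlift_inj R m).
  have -> : dB (x * H) = H + x * dB H by rewrite (cdM (cder_dB R m)) dB_x mul1r.
  rewrite (cmM L) (cmM L r1) (cmD L) thH [RHS](cmM L) (cmM L H) -HE.
  have e2 : psC (2%:R : C) * (rlift r1 * rlift U1 * (h * k + (h * tk + k * th))) =
            psC 2%:R * (h * k * rlift SR * rlift SU).
    have -> : psC (2%:R : C) * (rlift r1 * rlift U1 * (h * k + (h * tk + k * th))) =
      k * ((psC ii + rlift r1) * rlift U1 * h + (rlift r1 * rlift U1 * th) *+ 2) +
      h * ((- psC ii + rlift r1) * rlift U1 * k + (rlift r1 * rlift U1 * tk) *+ 2).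
      by rewrite rmorph_nat; ring.
    by rewrite eqz eqw rmorph_nat; ring.
  exact: natC_inj e2.
Qed.

End ConjugacyOfRadialFields.

(** * Uniqueness of the normal form *)

Section UniquenessTheorem.
Variables (R : realType) (N alpha : nat).
Hypotheses (N_gt0 : (0 < N)%N) (alpha_gt0 : (0 < alpha)%N).
Local Notation C := R[i].
Local Notation A := (ps (pvar N) C).
Local Notation B := (ps (option 'I_N) R).
Local Notation Mu := (ps 'I_N R).
Local Notation vf := (vfield R N).
Local Notation muv := (@muv R N).
Local Notation Jc := (@Jc R N).
Local Notation x := (@xB R N).
Local Notation dB := (@dB R N).

Lemma pm_mulift tau (u : Mu) : paramor tau -> exists p : Mu, tau (mulift u) = mulift p.
Proof.
move=> P; have T := pm_cmor P; apply: mulift_surj.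
- by rewrite -(pm_dz P) dz_mulift (cm0 T).
- by rewrite -(pm_dw P) dw_mulift (cm0 T).
- by rewrite -(pm_Jc P) Jc_mulift.
Qed.

Lemma pm_rlift_x tau : paramor tau -> tau (rlift x) = rlift x.
Proof.
by move=> P; rewrite rlift_rho !rhoE (cmM (pm_cmor P)) (pm_z P) (pm_w P).
Qed.

(** Undoing the time change and the substitution of parameters leaves a radial
    field in the original parameters, obtained from v by a change of phase
    variables only. *)
Lemma transforms_tfield (v : vf) (s : 'S_N) a b : transforms alpha v (vinfty s a b) ->
  exists (S : vf) (U : B) (p : 'I_N -> Mu) (q : Mu) (tau tau' : A -> A),
  [/\ FL alpha 1 S /\ U 0 = 1, forall k, p k 0 = 0,
      [/\ paramor tau, paramor tau', cancel tau tau' & cancel tau' tau],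
      (forall k, tau (mulift (p k)) = muv (s k)) /\ tau (mulift q) = mulift b &
      tfield (Qf a p q x) U (phiS S v)].
Proof.
move=> /(transforms_elim alpha_gt0) [S [t [tau [tau' [SF t0 [P P'] [K K'] uE]]]]].
have T' := pm_cmor P'; have L := cmor_rlift R N.
have /boolp.choice[p pE] k : exists p : Mu, tau' (mulift (psX (s k))) = mulift p.
  exact: pm_mulift P'.
have [q qE] := pm_mulift b P'.
have u0 : (1 + t) 0 = 1 by rewrite ps_addE t0 coef01 addr0.
have [U [UE U0]] := psV_exists u0.
have p0 k : p k 0 = 0.
  apply: (@complexI R); rewrite rmorph0 -(cm_coef0 (cmor_mulift R N)) -pE.
  rewrite (cm_coef0 T') (cm_coef0 (cmor_mulift R N)).
  have /Fil1_coef0 -> : Fil w1 1 (psX (s k) : Mu) by apply: Fil_psX.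
  by rewrite !rmorph0.
have rE : tau' (rlift (Qf a (fun k => psX (s k)) b x)) = rlift (Qf a p q x).
  rewrite (phi_Qf _ _ _ _ T') [RHS](phi_Qf _ _ _ _ (cmor_id _ _)) qE.
  by rewrite (pm_rlift_x P'); congr (_ + _ + _); apply: eq_bigr => k _; rewrite pE.
have wE c : (phiS S v c : A) = tau' (vinfty s a b c) * rlift U.
  rewrite uE K mulrAC -(cm1 L) -(cmD L) -(cmM L) UE (cm1 L) mul1r //.
exists S, U, p, q, tau, tau'; split=> //.
- by split=> [k|]; rewrite -?pE -?qE K' // mulift_psX.
- have E := vinfty_radfield s a b; split.
    rewrite {1}/vz wE E -[radfield _ ord0]/(vz (radfield _)) vz_radfield.
    by rewrite (cmM T') (cmD T') (cmC T') (pm_z P') rE mulrA.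
  rewrite {1}/vw wE E -[radfield _ ord_max]/(vw (radfield _)) vw_radfield.
  by rewrite (cmM T') (cmD T') (cmN T') (cmC T') (pm_w P') rE mulrA.
Qed.

(** The substitution of mu_(s k) for mu_k, see [rename_psX]; its effect on
    coefficients is explicit. *)
Definition rename (s : 'S_N) (f : Mu) : Mu := fun n => f [ffun j => n (s j)].

Lemma cmor_rename s : cmor idfun (rename s).
Proof.
have renD (n n' : mindex 'I_N) : [ffun j => (n + n') (s j)] =
    [ffun j => n (s j)] + [ffun j => n' (s j)] :> mindex 'I_N.
  by apply/ffunP=> j; rewrite !ffunE.
have inj (n n' : mindex 'I_N) : ([ffun j => n (s j)] == n') =
    (n == [ffun j => n' ((s^-1)%g j)]).
  apply/eqP/eqP=> [<-|->]; apply/ffunP=> j; rewrite !ffunE ?permKV ?permK //.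
have monE a : rename s (mon a) = mon [ffun j => a ((s^-1)%g j)].
  by apply/ps_ext=> n; rewrite /rename /mon inj.
apply: cmor_of_mon => [f g|c f|k f fk n nk||a b].
- by apply/ps_ext=> n; rewrite /rename !ps_addE !ps_oppE.
- by apply/ps_ext=> n; rewrite /rename !coef_psCM.
- rewrite /rename fk // (_ : wt _ _ = wt w1 n) //.
  rewrite -!mdegE /mdeg [RHS](reindex_inj (@perm_inj _ s)).
  by apply: eq_bigr => j _; rewrite ffunE.
- rewrite -mon0 monE; congr mon; apply/ffunP=> j; rewrite !ffunE //.
- rewrite !monE -monD; congr mon; apply/ffunP=> j; rewrite !ffunE //.
Qed.

Lemma rename_psX s k : rename s (psX k) = psX (s k).
Proof.
apply/ps_ext=> n; rewrite /rename /psX /mon; congr (nat_of_bool _)%:R.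
apply/eqP/eqP=> [e|->].
  apply/ffunP=> j; have /ffunP/(_ ((s^-1)%g j)) := e; rewrite !ffunE permKV => ->.
  by rewrite -(inj_eq (@perm_inj _ s)) permKV.
by apply/ffunP=> j; rewrite !ffunE (inj_eq (@perm_inj _ s)).
Qed.

(** The conjugacy between the two radial fields of [transforms_tfield] makes their
    coefficients p and q equal as series in the original parameters.  Hence the
    composition tau1 tau2^-1 sends mu_(s2 k) to mu_(s1 k) and b2 to b1. *)
Lemma normal_form_unique (v : vf) (s1 s2 : 'S_N) (a1 a2 : R) (b1 b2 : Mu) :
  symm v -> lin_rot v -> a1 != 0 ->
  transforms alpha v (vinfty s1 a1 b1) -> transforms alpha v (vinfty s2 a2 b2) ->
  a2 = a1 /\
  forall n n' : mindex 'I_N, (forall k, n' (s2 k) = n (s1 k)) -> b2 n' = b1 n.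
Proof.
move=> vs v10 a10 /transforms_tfield [S1 [U1 [p1 [q1 [tau1 [tau1']]]]]].
move=> [[S1F U10] p10 [P1 P1' K1 K1'] [tp1 tq1] tw1].
move=> /transforms_tfield [S2 [U2 [p2 [q2 [tau2 [tau2']]]]]].
move=> [[S2F U20] p20 [P2 P2' K2 K2'] [tp2 tq2] tw2].
have v1 := lin_rot_FilV vs v10; have L := cmor_rlift R N.
have S12 := FL1_FilV S1F; have S22 := FL1_FilV S2F.
have [S1s _] := FL1_form S1F; have [S2s _] := FL1_form S2F.
have F1 := cmor_flow S12; have F2 := cmor_flow S22.
have Dv1 f : Dv v (flow S1 f) = flow S1 (Dv (phiS S1 v) f) := Dv_flow S12 v1 f.
have Dv2 f : Dv v (flow S2 f) = flow S2 (Dv (phiS S2 v) f) := Dv_flow S22 v1 f.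
have J1 f : Jc (flow S1 f) = flow S1 (Jc f) := flow_Jc f S1s.
have J2 f : Jc (flow S2 f) = flow S2 (Jc f) := flow_Jc f S2s.
have mu1 k : flow S1 (muv k) = muv k := flow_mu S1 k.
have mu2 k : flow S2 (muv k) = muv k := flow_mu S2 k.
have X1 := flow_psX2 S12; have X2 := flow_psX2 S22.
move: (flow S1) (flow S2) F1 F2 Dv1 Dv2 J1 J2 mu1 mu2 X1 X2.
move=> f1 f2 F1 F2 Dv1 Dv2 J1 J2 mu1 mu2 X1 X2.
have [f1' [F1' fK fK']] := cmor_inv F1 X1.
pose sg f := f1' (f2 f).
have sgP : cmor idfun sg by exact: cmor_io (cmor_comp F2 F1').
have f1_inj := can_inj fK.
have sgE f : f1 (sg f) = f2 f by rewrite /sg fK'.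
have sg_mu k : sg (muv k) = muv k by apply: f1_inj; rewrite sgE mu1 mu2.
have sgJ f : sg (Jc f) = Jc (sg f) by apply: f1_inj; rewrite -J1 !sgE J2.
have conj12 f : Dv (phiS S1 v) (sg f) = sg (Dv (phiS S2 v) f).
  by apply: f1_inj; rewrite -Dv1 !sgE Dv2.
have sg2 i : Fil w1 2 (sg (psX i) - psX i).
  have -> : sg (psX i) - psX i = f1' ((f2 (psX i) - psX i) - (f1 (psX i) - psX i)).
    by rewrite !(cmB F1') /sg fK; ring.
  by apply: (cmF F1'); apply: FilB.
have emb0 (p : Mu) : p 0 = 0 -> emb p 0 = 0.
  by move=> p0; rewrite /emb ffunE eqxx -[RHS]p0; congr (p _); apply/ffunP=> k; rewrite !ffunE.
have Q0 (a : R) (p : 'I_N -> Mu) (q : Mu) : (forall k, p k 0 = 0) -> Qf a p q x 0 = 0.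
  have x0 : x 0 = 0 by apply/(Fil1_coef0 x); apply: Fil_psX.
  have xX j : (0 < j)%N -> (x ^+ j) 0 = 0.
    by case: j => // j _; rewrite exprS coef0M x0 mul0r.
  move=> p0; rewrite /Qf !ps_addE ps_sumE !coef0M !xX ?muln_gt0 // !mulr0 add0r addr0.
  by rewrite big1 // => k _; rewrite coef0M emb0 ?mul0r.
have [H [ka [SR [SU [H0 rhoE [SRE SUE] eqU eqR]]]]] :=
  conj_radial_eq tw1 tw2 (Q0 a1 p1 q1 p10) (Q0 a2 p2 q2 p20) U10 U20 sgP sg2 sg_mu sgJ conj12.
have smu (u : Mu) : sg (mulift u) = mulift u.
  apply: (@cmor_ext _ _ _ _ (real_complex R) (sg \o @mulift R N) (@mulift R N)).
  - exact: cmor_io (cmor_comp (cmor_mulift R N) sgP).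
  - exact: cmor_mulift.
  by move=> k /=; rewrite mulift_psX sg_mu.
have SRQ : SR = Qf a2 p2 q2 (x * H).
  apply: (@rlift_inj R N); rewrite -SRE (phi_Qf _ _ _ _ sgP).
  rewrite [RHS](phi_Qf _ _ _ _ (cmor_id _ _)) rlift_rho rhoE smu.
  by congr (_ + _ + _); apply: eq_bigr => k _; rewrite smu.
have [V [VE V0]] := psV_exists U10.
have [H' [HH' _]] := psV_exists H0.
set r1 := Qf a1 p1 q1 x in eqU eqR.
have eqC : SR * (H + x * r1 * ka) = r1 * dB (x * H).
  have -> : SR * (H + x * r1 * ka) = V * (SR * (U1 * (H + x * r1 * ka))).
    by rewrite -[LHS]mul1r -VE; ring.
  have -> : V * (SR * (U1 * (H + x * r1 * ka))) = V * (H * SR * SU).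
    by rewrite eqU; ring.
  by rewrite -eqR -[RHS]mul1r -VE; ring.
have FfE (a : R) (p : 'I_N -> Mu) (q : Mu) X : Ff a (fun k => emb (p k)) (emb q) X = X * Qf a p q X.
  rewrite /Ff /Qf !exprS !mulrDr mulr_sumr; congr (_ + _ + _); try by ring.
  by apply: eq_bigr => k _; rewrite exprS; ring.
have conj_eq : Ff a2 (fun k => emb (p2 k)) (emb q2) (x * H) *
   (1 + ka * H' * Ff a1 (fun k => emb (p1 k)) (emb q1) x) =
   Ff a1 (fun k => emb (p1 k)) (emb q1) x * dB (x * H).
  rewrite !FfE -SRQ -/r1 -[RHS]mulrA -eqC.
  have -> : x * H * SR * (1 + ka * H' * (x * r1)) =
    x * (SR * (H + x * r1 * ka * (H * H'))) by ring.
  by rewrite HH' mulr1.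
have m1 k : muonly (emb (p1 k)) := muonly_emb (p1 k).
have m2 k : muonly (emb (p2 k)) := muonly_emb (p2 k).
have z1 k : emb (p1 k) 0 = 0 := emb0 _ (p10 k).
have z2 k : emb (p2 k) 0 = 0 := emb0 _ (p20 k).
have ea : a1 = a2.
  exact: (radial_lead_unique (K := R) N_gt0 a10 m1 m2 z1 z2 H0 conj_eq).
have [ep eq] : (forall k, emb (p1 k) = emb (p2 k)) /\ emb q1 = emb q2.
  exact: (radial_coefs_unique (K := R) N_gt0 a10 m1 m2 (muonly_emb q1) (muonly_emb q2) z1 z2 H0 conj_eq).
split=> // n n' nn'.
pose pi f := tau1 (tau2' f).
have piP : cmor idfun pi by exact: cmor_io (cmor_comp (pm_cmor P2') (pm_cmor P1)).
pose sg0 := (s2^-1 * s1)%g.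
have piE (u : Mu) : pi (mulift u) = mulift (rename sg0 u).
  apply: (@cmor_ext _ _ _ _ (real_complex R) (pi \o @mulift R N) (@mulift R N \o rename sg0)).
  - exact: cmor_io (cmor_comp (cmor_mulift R N) piP).
  - exact: cmor_io (cmor_comp (cmor_rename _) (cmor_mulift R N)).
  move=> k /=; rewrite rename_psX !mulift_psX permM.
  by rewrite -{1}(permKV s2 k) -tp2 /pi K2 -(emb_inj (ep _)) tp1.
have : mulift b1 = mulift (rename sg0 b2).
  by rewrite -piE -tq1 -tq2 /pi K2 (emb_inj eq).
move=> /(congr1 (fun f : A => f (mi 0 0 n))).
rewrite /mulift !miE /= => /complexI E.
rewrite E /rename; congr (b2 _); apply/ffunP=> j.
by rewrite ffunE permM -nn' permKV.
Qed.

End UniquenessTheorem.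
Lemma symm_lin_rot (R : realType) (m : nat) (x y : mindex (pvar m) -> R) :
  let v := Yjk R 1 0 0 + formal_sum (@Ldom m) x (@Xq R m)
                       + formal_sum (@Ldom m) y (@Yq R m) in
  symm v /\ lin_rot v.
Proof.
move=> v; have Y1 := @symm_Yq R m (mi 1 0 0); split.
  have Xs := symm_fs (@Ldom m) x (@symm_Xq R m).
  have Ys := symm_fs (@Ldom m) y (@symm_Yq R m).
  exact: symmD (symmD Y1 Xs) Ys.
move=> q nq; rewrite ps_addE ps_oppE coef_psCM zvE -mi100.
have -> : vz v q = 'i%C * (q == mi 1 0 0)%:R +
   (if Ldom q then (x q)%:C%C else 0) + (if Ldom q then 'i%C * (y q)%:C%C else 0).
  by rewrite -fsXz -fsYz.
by rewrite (negPf nq) !addr0 /mon subrr.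
Qed.

Theorem corollary4p7 (R : realType) (N0 : nat) (hN0 : (1 <= N0)%N)
    (e : nat -> lmono N0) (he : basis_order (2 * N0 + 1) e)
    (a0 b0 : mindex (pvar N0) -> R)
    (v : vfield R N0)
    (hv : v = Yjk R 1 0 0 + formal_sum (@Ldom N0) a0 (@Xq R N0)
                          + formal_sum (@Ldom N0) b0 (@Yq R N0))
    (vt : nat -> vfield R N0)
    (hvt : extended_partial_nf (2 * N0 + 1) e v vt)
    (hdim : parametric_dimension vt N0)
    (hgen : parametric_generic vt N0) :
  exists (s : 'S_N0) (a : R) (b : mindex 'I_N0 -> R),
    transforms (2 * N0 + 1) v (vinfty s a b) /\
    forall (s' : 'S_N0) (a' : R) (b' : mindex 'I_N0 -> R),
      transforms (2 * N0 + 1) v (vinfty s' a' b') ->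
      a' = a /\
      forall n n' : mindex 'I_N0,
        (forall k : 'I_N0, n' (s' k) = n (s k)) -> b' n' = b n.
Proof.
have alpha_gt0 : (0 < 2 * N0 + 1)%N by rewrite addn1.
have [vs v10] := symm_lin_rot a0 b0; rewrite -hv in vs v10.
have [vt0 /(_ 1%N isT) [[P [T [S [[PF TF SF] vt1]]]] vt1N]] := hvt.
rewrite /= vt0 in vt1N.
pose t : ps (option 'I_N0) R := fun b => T (b None) (bmu b).
have g2 := (FP_Fil P alpha_gt0).1 PF.
have g1 k : Fil w1 1 (gpar P k) := Fil1_near_psX (g2 k).
have t0 : t 0 = 0.
  have -> : t 0 = T 0%N 0.
    by rewrite /t ffunE; congr (T _ _); apply/ffunP=> k; rewrite !ffunE.
  exact: (FR_coef T alpha_gt0).1.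
have uE c : vt 1%N c = tau (gpar P) ((1 + rlift t) * (phiS S v c : ps _ _)).
  by rewrite vt1 phiPE phiTE tliftE.
have lin := transform_linear_part vs v10 SF t0 (paramor_tau g1) uE.
have [r rE] := first_level_radial alpha_gt0 he vs v10 vt1N lin.
have [low lead] := hdim 1%N isT.
have rlow j : (j < N0)%N -> r (bi j 0) = 0.
  by move=> jN; rewrite -coef_radfield -rE; apply: low.
have rN : r (bi N0 0) != 0 by rewrite -coef_radfield -rE.
have rU : (\matrix_(k, j) r (bi (nat_of_ord k) (munit j)) : 'M[R]_N0) \in unitmx.
  rewrite -row_free_unit /row_free; apply/eqP; rewrite -[RHS]hgen; congr (\rank _).
  by apply/matrixP=> k j; rewrite !mxE rE coef_radfield.
have uE' c : radfield r c = tau (gpar P) ((1 + rlift t) * (phiS S v c : ps _ _)).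
  by rewrite -rE uE.
have [a [b [a_neq0 tr]]] := normal_form_exists hN0 alpha_gt0 vs v10 SF t0 g2 uE' rlow rN rU.
exists 1%g, a, b; split=> // s' a' b' tr'.
by have := normal_form_unique hN0 alpha_gt0 vs v10 a_neq0 tr tr'.
Qed.
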